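(* Let $F$ be a finite field of odd characteristic. Let $\eta$ be a primitive element of $F$. Let $\xi\in F$ be a non-square such that $\xi-1$ is a square and fix $\sigma_\xi\in F$ with $\sigma_\xi^2=\xi-1$. If $|F|>3$, let moreover $\zeta\in F$ be a non-square such that $1-\zeta$ is a square and fix $\sigma_\zeta\in F$ with $\sigma_\zeta^2=1-\zeta$. Let $\mathcal{A}$ be a maximal subset of $F$ with $0\in\mathcal{A}$, $\pm1\notin\mathcal{A}$, and such that if $\alpha\in\mathcal{A}$, $\alpha\neq0$, then $\alpha^{-1}\notin\mathcal{A}$. If $|F|>3$, then the following is the list of $4$-dimensional nilpotent associative algebras over $F$ up to isomorphism (every such algebra is isomorphic to exactly one of them): $A_{4,1}$, $A_{4,2}$, $A_{4,3}^\delta$ ($\delta=1,\eta$), $A_{4,4}^\delta$ ($\delta\in F$), $A_{4,5}$, $A_{4,6}$, $A_{4,7}$, $A_{4,8}^{1,1}$, $A_{4,9}^{1,\beta}$ ($\beta\in F$, $\beta\neq\frac14$), $A_{4,9}^{1,\frac14}$, $A_{4,9}^{\eta,\frac14}$, $A_{4,10}^0$, $A_{4,11}$, $A_{4,12}$, $A_{4,13}$, $A_{4,14}$, $A_{4,15}$, $A_{4,16}$, $A_{4,18}^\delta$ ($\delta=0,1,\eta$), $A_{4,20}$, $A_{4,21}^\delta$ ($\delta\in F$, $\delta\neq-1$), $A_{4,23}^\delta$ ($\delta=1,\eta$), $A_{4,24}$, $A_{4,25}^{\alpha,0,1}$ ($\alpha\in\mathcal{A}$), $A_{4,25}^{\alpha,\sigma_\xi(1-\alpha),1}$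 ($\alpha\in\mathcal{A}$), $A_{4,25}^{\alpha,\sigma_\zeta(1-\alpha),\zeta}$ ($\alpha\in\mathcal{A}$), $A_{4,25}^{\alpha,0,\xi}$ ($\alpha\in\mathcal{A}$). If $|F|=3$, then the list of $4$-dimensional nilpotent associative algebras over $F$ up to isomorphism (every such algebra is isomorphic to exactly one of them) is: $A_{4,1}$, $A_{4,2}$, $A_{4,3}^\delta$ ($\delta=1,\eta$), $A_{4,4}^\delta$ ($\delta\in F$), $A_{4,5}$, $A_{4,6}$, $A_{4,7}$, $A_{4,8}^{1,1}$, $A_{4,9}^{1,\beta}$ ($\beta\in F$, $\beta\neq\frac14$), $A_{4,9}^{1,\frac14}$, $A_{4,9}^{\eta,\frac14}$, $A_{4,10}^0$, $A_{4,11}$, $A_{4,12}$, $A_{4,13}$, $A_{4,14}$, $A_{4,15}$, $A_{4,16}$, $A_{4,18}^\delta$ ($\delta=0,1,\eta$), $A_{4,20}$, $A_{4,21}^\delta$ ($\delta\in F$, $\delta\neq-1$), $A_{4,22}$, $A_{4,23}^\delta$ ($\delta=1,\eta$), $A_{4,24}$, $A_{4,25}^{\alpha,0,1}$ ($\alpha\in\mathcal{A}$), $A_{4,25}^{\alpha,\sigma_\xi(1-\alpha),1}$ ($\alpha\in\mathcal{A}$), $A_{4,25}^{\alpha,0,\xi}$ ($\alpha\in\mathcal{A}$).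
   Context: Algebras are associative algebras over $F$, not assumed unital; an algebra is nilpotent if all products of $n$ elements vanish for some $n$. A primitive element of a finite field $F$ is a generator of the multiplicative group $F^*=F\setminus\{0\}$. Notation: $\langle a,b,c,d\mid\text{relations}\rangle$ denotes the algebra with vector space basis $a,b,c,d$ whose multiplication is determined by the listed products of basis elements, all other products of basis elements being zero. The algebras are: $A_{4,1}=\langle a,b,c,d\mid\ \rangle$; $A_{4,2}=\langle a,b,c,d\mid a^2=b\rangle$; $A_{4,3}^\delta=\langle a,b,c,d\mid a^2=c, b^2=\delta c\rangle$; $A_{4,4}^\delta=\langle a,b,c,d\mid a^2=c, b^2=\delta c, ab=c\rangle$; $A_{4,5}=\langle a,b,c,d\mid ab=c, ba=-c\rangle$; $A_{4,6}=\langle a,b,c,d\mid a^2=b, ab=ba=c\rangle$; $A_{4,7}=\langle a,b,c,d\mid a^2=bc=d, cb=-d\rangle$; $A_{4,8}^{\alpha,\beta}=\langle a,b,c,d\mid a^2=d, b^2=\alpha d, c^2=\beta d\rangle$; $A_{4,9}^{\alpha,\beta}=\langle a,b,c,d\mid a^2=\alpha d, b^2=d, bc=d, c^2=\beta d\rangle$; $A_{4,10}^\alpha=\langle a,b,c,d\mid a^2=d, ab=d, b^2=\alpha d, bc=d, cb=d\rangle$; $A_{4,11}=\langle a,b,c,d\mid a^2=d, ab=d, cb=d, c^2=-d\rangle$; $A_{4,12}=\langle a,b,c,d\mid a^2=b, ab=ba=d, ac=d, c^2=d\rangle$; $A_{4,13}=\langle a,b,c,d\mid a^2=b, ab=ba=d,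 c^2=d\rangle$; $A_{4,14}=\langle a,b,c,d\mid a^2=b, ab=ba=d, ac=d\rangle$; $A_{4,15}=\langle a,b,c,d\mid a^2=b, ab=ba=c, b^2=ac=ca=d\rangle$; $A_{4,16}=\langle a,b,c,d\mid a^2=c, ba=d\rangle$; $A_{4,18}^\delta=\langle a,b,c,d\mid a^2=c, ab=d, ba=-d, b^2=\delta c\rangle$; $A_{4,20}=\langle a,b,c,d\mid a^2=c, ab=d, ba=c\rangle$; $A_{4,21}^\delta=\langle a,b,c,d\mid a^2=c, ab=d, ba=\delta d\rangle$; $A_{4,22}=\langle a,b,c,d\mid a^2=c, ab=d, ba=c+d, b^2=c\rangle$; $A_{4,23}^\delta=\langle a,b,c,d\mid a^2=c, ab=ba=d, b^2=-\delta c\rangle$; $A_{4,24}=\langle a,b,c,d\mid a^2=c, ab=d, ba=-c, b^2=c\rangle$; $A_{4,25}^{\alpha,\beta,\gamma}=\langle a,b,c,d\mid a^2=c, ab=d, ba=-\beta c+\alpha d, b^2=-\gamma c\rangle$. *)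

(* Defs.v *)
From HB Require Import structures.
From mathcomp Require Import all_boot all_order all_algebra all_fingroup
  all_solvable.

Set Implicit Arguments.
Unset Strict Implicit.
Unset Printing Implicit Defensive.

Import GRing.Theory.
Local Open Scope ring_scope.

(* A finite-dimensional, not necessarily unital algebra: a vector space with a
   bilinear product. The library's algType is unital, hence this record;
   associativity is a separate predicate (mul_assoc) so that algebras can be
   given by multiplication tables. *)
Record algebra (F : fieldType) := Algebra {
  alg_sort :> vectType F;
  alg_mul : {bilinear alg_sort -> alg_sort -> alg_sort}
}.

Section AlgebraPredicates.
Variable F : fieldType.
Implicit Types X Y : algebra F.

Definition mul_assoc X : Prop := associative (alg_mul X).

(* foldl forms the left-bracketed product of x and the n elements of s, that is
   a product of n.+1 elements; without a unit only products of at least one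
   element make sense. *)
Definition nilpotent_alg X : Prop :=
  exists n : nat, forall (x : X) (s : n.-tuple X),
    foldl (alg_mul X) x s = 0.

Definition alg_iso X Y : Prop :=
  exists f : {linear X -> Y},
    bijective f /\ forall x y : X, f (alg_mul X x y) = alg_mul Y (f x) (f y).

Definition nilpotent_assoc_alg4 X : Prop :=
  [/\ mul_assoc X, nilpotent_alg X & \dim {: X} = 4%N].

End AlgebraPredicates.

(* An entry (i, j, v) is the relation e_i e_j = v; products of basis elements
   without an entry are zero. *)
Definition presentation (F : fieldType) := seq ('I_4 * 'I_4 * 'rV[F]_4).

Section Presentation.
Variables (F : fieldType) (r : presentation F).

Definition table (i j : 'I_4) : 'rV[F]_4 := \sum_(p <- r | p.1 == (i, j)) p.2.

Definition table_mul (x y : 'rV[F]_4) : 'rV[F]_4 :=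
  \sum_(i < 4) \sum_(j < 4) (x 0 i * y 0 j) *: table i j.

Lemma table_mul_bilinear :
  bilinear_for (GRing.Scale.Law.clone _ _ *:%R _)
    (GRing.Scale.Law.clone _ _ *:%R _) table_mul.
Proof.
split=> [y k x1 x2 | x k y1 y2] /=; rewrite /table_mul scaler_sumr -big_split /=;
  apply: eq_bigr => i _; rewrite scaler_sumr -big_split /=;
  apply: eq_bigr => j _; rewrite !mxE scalerA -scalerDl.
  by rewrite mulrDl mulrA.
by rewrite mulrDr mulrCA.
Qed.

HB.instance Definition _ := bilinear_isBilinear.Build F 'rV[F]_4 'rV[F]_4
  'rV[F]_4 *:%R *:%R table_mul table_mul_bilinear.

Definition presented : algebra F :=
  @Algebra F ('rV[F]_4 : vectType F) table_mul.

End Presentation.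

(* The entries of L present the 4-dimensional nilpotent associative algebras up
   to isomorphism: each is one, and each such algebra is isomorphic to the entry
   at exactly one position of L. (Lists of presentations rather than of algebras
   avoid a universe inconsistency with tnth.) *)
Definition classifies4 (F : fieldType) (L : seq (presentation F)) : Prop :=
  (forall i : 'I_(size L),
     nilpotent_assoc_alg4 (presented (tnth (in_tuple L) i))) /\
  (forall X : algebra F, nilpotent_assoc_alg4 X ->
     exists! i : 'I_(size L), alg_iso X (presented (tnth (in_tuple L) i))).

Section Algebras.
Variable F : fieldType.
Implicit Types alpha beta gamma delta : F.

Let a : 'I_4 := @Ordinal 4 0 isT.
Let b : 'I_4 := @Ordinal 4 1 isT.
Let c : 'I_4 := @Ordinal 4 2 isT.
Let d : 'I_4 := @Ordinal 4 3 isT.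

Definition A4_1 : presentation F := [::].
Definition A4_2 : presentation F := [:: (a, a, 'e_b)].
Definition A4_3 delta : presentation F := [:: (a, a, 'e_c); (b, b, delta *: 'e_c)].
Definition A4_4 delta : presentation F :=
  [:: (a, a, 'e_c); (b, b, delta *: 'e_c); (a, b, 'e_c)].
Definition A4_5 : presentation F := [:: (a, b, 'e_c); (b, a, - 'e_c)].
Definition A4_6 : presentation F := [:: (a, a, 'e_b); (a, b, 'e_c); (b, a, 'e_c)].
Definition A4_7 : presentation F := [:: (a, a, 'e_d); (b, c, 'e_d); (c, b, - 'e_d)].
Definition A4_8 alpha beta : presentation F :=
  [:: (a, a, 'e_d); (b, b, alpha *: 'e_d); (c, c, beta *: 'e_d)].
Definition A4_9 alpha beta : presentation F :=
  [:: (a, a, alpha *: 'e_d); (b, b, 'e_d); (b, c, 'e_d);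
      (c, c, beta *: 'e_d)].
Definition A4_10 alpha : presentation F :=
  [:: (a, a, 'e_d); (a, b, 'e_d); (b, b, alpha *: 'e_d); (b, c, 'e_d);
      (c, b, 'e_d)].
Definition A4_11 : presentation F :=
  [:: (a, a, 'e_d); (a, b, 'e_d); (c, b, 'e_d); (c, c, - 'e_d)].
Definition A4_12 : presentation F :=
  [:: (a, a, 'e_b); (a, b, 'e_d); (b, a, 'e_d); (a, c, 'e_d);
      (c, c, 'e_d)].
Definition A4_13 : presentation F :=
  [:: (a, a, 'e_b); (a, b, 'e_d); (b, a, 'e_d); (c, c, 'e_d)].
Definition A4_14 : presentation F :=
  [:: (a, a, 'e_b); (a, b, 'e_d); (b, a, 'e_d); (a, c, 'e_d)].
Definition A4_15 : presentation F :=
  [:: (a, a, 'e_b); (a, b, 'e_c); (b, a, 'e_c); (b, b, 'e_d);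
      (a, c, 'e_d); (c, a, 'e_d)].
Definition A4_16 : presentation F := [:: (a, a, 'e_c); (b, a, 'e_d)].
Definition A4_18 delta : presentation F :=
  [:: (a, a, 'e_c); (a, b, 'e_d); (b, a, - 'e_d); (b, b, delta *: 'e_c)].
Definition A4_20 : presentation F := [:: (a, a, 'e_c); (a, b, 'e_d); (b, a, 'e_c)].
Definition A4_21 delta : presentation F :=
  [:: (a, a, 'e_c); (a, b, 'e_d); (b, a, delta *: 'e_d)].
Definition A4_22 : presentation F :=
  [:: (a, a, 'e_c); (a, b, 'e_d); (b, a, 'e_c + 'e_d); (b, b, 'e_c)].
Definition A4_23 delta : presentation F :=
  [:: (a, a, 'e_c); (a, b, 'e_d); (b, a, 'e_d);
      (b, b, - (delta *: 'e_c))].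
Definition A4_24 : presentation F :=
  [:: (a, a, 'e_c); (a, b, 'e_d); (b, a, - 'e_c); (b, b, 'e_c)].
Definition A4_25 alpha beta gamma : presentation F :=
  [:: (a, a, 'e_c); (a, b, 'e_d);
      (b, a, - (beta *: 'e_c) + alpha *: 'e_d);
      (b, b, - (gamma *: 'e_c))].

End Algebras.

Arguments A4_1 {F}.
Arguments A4_2 {F}.
Arguments A4_5 {F}.
Arguments A4_6 {F}.
Arguments A4_7 {F}.
Arguments A4_11 {F}.
Arguments A4_12 {F}.
Arguments A4_13 {F}.
Arguments A4_14 {F}.
Arguments A4_15 {F}.
Arguments A4_16 {F}.
Arguments A4_20 {F}.
Arguments A4_22 {F}.
Arguments A4_24 {F}.

Section Lists.
Variable F : finFieldType.
Implicit Types (eta xi sxi zeta szeta x : F) (cA : {set F}).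

Definition is_square x : Prop := exists s : F, s ^+ 2 = x.

(* {unit F} is the multiplicative group of F. *)
Definition primitive_element x : Prop :=
  exists2 u : {unit F}, FinRing.uval u = x & generator [set: {unit F}] u.

Definition inverse_free : pred {set F} := fun cA =>
  [&& 0 \in cA, 1 \notin cA, -1 \notin cA &
      [forall (x | x \in cA), (x != 0) ==> (x^-1 \notin cA)]].

Definition list_gt3 eta xi sxi zeta szeta cA : seq (presentation F) :=
  [:: A4_1; A4_2; A4_3 1; A4_3 eta]
  ++ [seq A4_4 delta | delta : F]
  ++ [:: A4_5; A4_6; A4_7; A4_8 1 1]
  ++ [seq A4_9 1 beta | beta in [pred x : F | x != 4^-1]]
  ++ [:: A4_9 1 4^-1; A4_9 eta 4^-1; A4_10 0; A4_11; A4_12; A4_13; A4_14;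
         A4_15; A4_16; A4_18 0; A4_18 1; A4_18 eta; A4_20]
  ++ [seq A4_21 delta | delta in [pred x : F | x != -1]]
  ++ [:: A4_23 1; A4_23 eta; A4_24]
  ++ [seq A4_25 alpha 0 1 | alpha in cA]
  ++ [seq A4_25 alpha (sxi * (1 - alpha)) 1 | alpha in cA]
  ++ [seq A4_25 alpha (szeta * (1 - alpha)) zeta | alpha in cA]
  ++ [seq A4_25 alpha 0 xi | alpha in cA].

Definition list_eq3 eta xi sxi cA : seq (presentation F) :=
  [:: A4_1; A4_2; A4_3 1; A4_3 eta]
  ++ [seq A4_4 delta | delta : F]
  ++ [:: A4_5; A4_6; A4_7; A4_8 1 1]
  ++ [seq A4_9 1 beta | beta in [pred x : F | x != 4^-1]]
  ++ [:: A4_9 1 4^-1; A4_9 eta 4^-1; A4_10 0; A4_11; A4_12; A4_13; A4_14;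
         A4_15; A4_16; A4_18 0; A4_18 1; A4_18 eta; A4_20]
  ++ [seq A4_21 delta | delta in [pred x : F | x != -1]]
  ++ [:: A4_22; A4_23 1; A4_23 eta; A4_24]
  ++ [seq A4_25 alpha 0 1 | alpha in cA]
  ++ [seq A4_25 alpha (sxi * (1 - alpha)) 1 | alpha in cA]
  ++ [seq A4_25 alpha 0 xi | alpha in cA].

End Lists.

(* Main.v *)
(* If all products of three elements vanish, the algebra is given by k linearly
   independent bilinear forms on F^n with n + k = 4, up to congruence and change
   of basis of their span; as k <= n^2, there is nothing to choose (k = 0), or it
   is one form in three variables (k = 1) or a pencil of forms in two variables
   (k = 2).  A single form is normalised by splitting off the radical of its
   alternating part; a x^2 + b y^2 always represents 1, because xi = 1 + sxi^2 is
   a nonsquare sum of two squares.  A generic noncommutative pencil contains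
   diag(1, -D) with D = 1 or D = xi, and a second member with parameters (t, u) on
   which the similitudes of x^2 - D y^2 act with the single invariant
   D t^2 - u^2; its values are matched with A_{4,25} through
   alpha |-> ((1 + alpha) / (1 - alpha))^2, which identifies exactly alpha and
   alpha^-1.  Otherwise X X X is nonzero, and either X is generated by one element
   (A_{4,15}) or the filtration X > X X > X X X has dimensions 4, 2, 1, which
   leaves A_{4,6}, A_{4,12}, A_{4,13} and A_{4,14}.  Determinants, adjugates and
   the alternating parts of the forms separate the cases. *)

Require Import Defs.
From HB Require Import structures.
From mathcomp Require Import all_boot all_order all_algebra all_fingroup
  all_solvable.
From mathcomp Require Import ring.

Set Implicit Arguments.
Unset Strict Implicit.
Unset Printing Implicit Defensive.

Import GRing.Theory.
Local Open Scope ring_scope.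

(** * Isomorphisms and two-step algebras *)

(** For both values of D the pencils [pair25 alpha sigma gamma] must reach every nonzero m = D t^2 -
    u^2. Such a pencil has D = gamma + sigma^2 and kappa(alpha)^2 gamma = - m D with kappa(alpha) =
    (1 + alpha) / (1 - alpha). So each D needs one gamma in either square class, chosen such that D
    - gamma is a square: 1 and zeta for D = 1, xi and 1 for D = xi. With three elements the only
    nonsquare is -1, and 1 - (-1) = -1 is not a square, so no zeta exists; the one value then
    missed, m = 1 with D = 1, is A_{4,22}. On the side of uniqueness the obstacle is that the
    invariants of a form or a pencil are defined only up to factors coming from the changes of
    basis. The numerical tests are therefore vanishing conditions, square classes, or comparisons of
    two quantities that acquire the same factor. An algebra is addressed by a code, a pair of a tag
    and a parameter. Both lists are images of duplicate-free lists of codes, a boolean [q3]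
    selecting the list, so uniqueness of the position becomes injectivity on codes. *)

Section AlgIso.
Variable F : fieldType.
Implicit Types X Y Z : algebra F.

Lemma alg_isoI X Y (f : X -> Y) : linear f -> bijective f ->
  (forall x y, f (alg_mul X x y) = alg_mul Y (f x) (f y)) -> alg_iso X Y.
Proof.
move=> lf bf mf.
by exists (HB.pack_for {linear X -> Y} f (GRing.isLinear.Build _ _ _ _ f lf)).
Qed.

Lemma alg_iso_refl X : alg_iso X X.
Proof. by apply: (@alg_isoI X X id) => //; exists id. Qed.

Lemma alg_iso_sym X Y : alg_iso X Y -> alg_iso Y X.
Proof.
case=> f [[g fK gK] fM]; apply: (@alg_isoI Y X g).
- by move=> a x y; apply: (can_inj fK); rewrite linearP !gK.
- by exists f.
- by move=> x y; apply: (can_inj fK); rewrite fM !gK.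
Qed.

Lemma alg_iso_trans Y X Z : alg_iso X Y -> alg_iso Y Z -> alg_iso X Z.
Proof.
case=> f [bf fM] [g [bg gM]]; apply: (@alg_isoI X Z (g \o f)).
- by move=> a x y; rewrite /= !linearP.
- exact: bij_comp.
- by move=> x y; rewrite /= fM gM.
Qed.

Lemma alg_iso_dim X Y : alg_iso X Y -> \dim {: X} = \dim {: Y}.
Proof.
case=> f [bf _]; pose h := linfun f.
have k0 : lker h == 0%VS.
  by apply/lker0P => x y; rewrite !lfunE; apply: bij_inj.
have <- : limg h = fullv.
  apply/eqP; rewrite eqEsubv subvf /=; apply/subvP => y _.
  by case: bf => g _ gK; rewrite -[y]gK -(lfunE f) memv_img ?memvf.
by rewrite limg_dim_eq // (eqP k0) capv0.
Qed.

Lemma alg_iso_nilpotent4 X Y :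
  alg_iso X Y -> nilpotent_assoc_alg4 X -> nilpotent_assoc_alg4 Y.
Proof.
move=> iXY [XA [n Xn] X4]; have dXY := alg_iso_dim iXY.
case: iXY => f [[g fK gK] fM]; split; last by rewrite -dXY.
  by move=> x y z; rewrite -[x]gK -[y]gK -[z]gK -!fM XA.
exists n => x s; rewrite -[x]gK.
have ->: tval s = map f (map g s).
  by rewrite -map_comp map_id_in // => y _ /=; rewrite gK.
have E : forall t z, foldl (alg_mul Y) (f z) (map f t) = f (foldl (alg_mul X) z t).
  by elim=> //= y t IH z; rewrite -fM IH.
by rewrite E (Xn _ [tuple of map g s]) linear0.
Qed.

Lemma surj_bij (U V : vectType F) (f : U -> V) : linear f ->
  \dim {: U} = \dim {: V} -> (forall y, exists x, y = f x) -> bijective f.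
Proof.
move=> lf dUV sf.
pose fL : {linear U -> V} :=
  HB.pack_for {linear U -> V} f (GRing.isLinear.Build _ _ _ _ f lf).
pose h := linfun fL.
have hE x : h x = f x by rewrite lfunE.
have lh : limg h = fullv.
  apply/eqP; rewrite eqEsubv subvf /=; apply/subvP => y _.
  by have [x ->] := sf y; rewrite -hE memv_img ?memvf.
have k0 : lker h == 0%VS.
  have := limg_ker_dim h fullv; rewrite lh capfv dUV -[RHS]add0n => /addIn /eqP.
  by rewrite dimv_eq0.
exists (h^-1)%VF => x; rewrite -?hE; first by rewrite lker0_lfunK.
by rewrite limg_lfunVK ?lh ?memvf.
Qed.

(** Four vectors spanning a space of dimension four form a basis, so surjectivity of the induced
    linear map is all that has to be shown. *)
Lemma presented_iso X (r : presentation F) (e : 'I_4 -> X) :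
  \dim {: X} = 4%N -> (forall x, exists v : 'rV[F]_4, x = \sum_i v 0 i *: e i) ->
  (forall i j, alg_mul X (e i) (e j) = \sum_k table r i j 0 k *: e k) ->
  alg_iso X (presented r).
Proof.
move=> X4 eS eM; apply/alg_iso_sym.
pose g (v : presented r) : X := \sum_i (v : 'rV[F]_4) 0 i *: e i.
have gl : linear g.
  move=> a x y; rewrite /g scaler_sumr -big_split /=; apply: eq_bigr => i _.
  by rewrite !mxE scalerDl scalerA.
apply: (@alg_isoI (presented r) X g gl).
  by apply: surj_bij; rewrite // X4 dimvf dim_matrix.
move=> x y; rewrite {2}/g linear_sumlz.
under eq_bigr => i _ do rewrite linearZl_LR /= /g linear_sumr scaler_sumr.
rewrite /g /= /table_mul; under eq_bigr => k _.
  rewrite summxE scaler_suml.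
  under eq_bigr => i _ do rewrite summxE scaler_suml.
  over.
rewrite exchange_big; apply: eq_bigr => i _ /=.
rewrite exchange_big; apply: eq_bigr => j _ /=.
rewrite linearZr_LR eM scalerA [RHS]scaler_sumr; apply: eq_bigr => k _.
by rewrite mxE !scalerA.
Qed.

End AlgIso.

Section TwoStep.
Variables (F : fieldType) (n k : nat).
Implicit Types M : 'I_k -> 'M[F]_n.

(** The second summand contains every product and annihilates the algebra; the first one carries the
    arguments of the forms [M l]. *)
Definition ts_mul M (x y : 'rV[F]_n * 'rV[F]_k) : 'rV[F]_n * 'rV[F]_k :=
  (0, \row_l (x.1 *m M l *m y.1^T) 0 0).

Lemma ts_mul_bilinear M :
  bilinear_for (GRing.Scale.Law.clone _ _ *:%R _)
    (GRing.Scale.Law.clone _ _ *:%R _) (ts_mul M).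
Proof.
split=> [y a x1 x2 | x a y1 y2] /=; rewrite /ts_mul;
  congr pair; rewrite /= ?scaler0 ?addr0 //; apply/rowP => l.
  by rewrite [LHS]mxE !mulmxDl -!scalemxAl !mxE.
by rewrite [LHS]mxE linearP mulmxDr -scalemxAr !mxE.
Qed.

HB.instance Definition _ M := bilinear_isBilinear.Build F _ _ _ *:%R *:%R
  (ts_mul M) (ts_mul_bilinear M).

Definition ts M : algebra F :=
  @Algebra F ('rV[F]_n * 'rV[F]_k : vectType F)%type (ts_mul M).

(** Equivalently, the products of [ts M] span the second summand: a relation between the forms is a
    linear functional on that summand killing all products. *)
Definition indep M := forall w : 'rV[F]_k, \sum_l w 0 l *: M l = 0 -> w = 0.

Lemma ts_nilpotent4 M : (n + k = 4)%N -> nilpotent_assoc_alg4 (ts M).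
Proof.
move=> nk4; split.
- move=> x y z; congr pair; apply/rowP=> l /=.
  by rewrite [LHS]mxE [RHS]mxE /= trmx0 mulmx0 !mul0mx.
- exists 2%N => x; case=> [[|y [|z [|]]]] //= _.
  congr pair; apply/rowP=> l /=.
  by rewrite [LHS]mxE /= !mul0mx !mxE.
- rewrite dimvf; transitivity (dim 'rV[F]_n + dim 'rV[F]_k)%N; first by [].
  by rewrite !dim_matrix !mul1r.
Qed.

(** The isomorphism is [(x, u) |-> (x P, u R)]. The condition compares the [l]-th coordinates of
    products, which is why [R] enters through its column [l]. *)
Lemma ts_iso_intro M M' (P : 'M[F]_n) (R : 'M[F]_k) :
    P \in unitmx -> R \in unitmx ->
    (forall l, P *m M' l *m P^T = \sum_m R m l *: M m) ->
  alg_iso (ts M) (ts M').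
Proof.
move=> Pu Ru E; pose f (x : ts M) : ts M' := (x.1 *m P, x.2 *m R).
apply: (@alg_isoI _ (ts M) (ts M') f).
- move=> a [x u] [y v]; rewrite /f /=.
  by congr pair; rewrite mulmxDl -scalemxAl.
- exists (fun x => (x.1 *m invmx P, x.2 *m invmx R)) => -[x u].
    by rewrite /f /= !mulmxK.
  by rewrite /f /= !mulmxKV.
move=> [x u] [y v]; rewrite /f /= /ts_mul /=; congr pair; first by rewrite mul0mx.
apply/rowP => l; rewrite [RHS]mxE trmx_mul !mulmxA -(mulmxA x P).
rewrite -(mulmxA x (P *m _)) E mulmx_sumr mulmx_suml summxE [LHS]mxE.
apply: eq_bigr => m _.
by rewrite [X in X * _ = _]mxE -scalemxAr -scalemxAl [RHS]mxE mulrC.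
Qed.

Lemma ts_ext M M' : M =1 M' -> alg_iso (ts M) (ts M').
Proof.
move=> E; apply: (@ts_iso_intro _ _ 1%:M 1%:M); rewrite ?unitmx1 // => l.
rewrite mul1mx trmx1 mulmx1 (bigD1 l) //= big1 => [|m ml].
  by rewrite mxE eqxx scale1r addr0 E.
by rewrite mxE (negPf ml) scale0r.
Qed.

Lemma indep_dim M : indep M -> (k <= n * n)%N.
Proof.
move=> iM; suff: row_free (\matrix_l mxvec (M l)).
  by rewrite /row_free => /eqP {1}<-; apply: rank_leq_col.
apply: inj_row_free => v; rewrite mulmx_sum_row => E; apply: iM.
apply: (can_inj mxvecK); rewrite linear0 -[RHS]E linear_sum.
by apply: eq_bigr => l _; rewrite rowK linearZ.
Qed.

End TwoStep.

Lemma linear_rV_mx (F : fieldType) m n (g : 'rV[F]_m -> 'rV[F]_n) :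
  linear g -> exists P : 'M_(m, n), forall x, g x = x *m P.
Proof.
move=> lg; pose h : {linear 'rV[F]_m -> 'rV[F]_n} :=
  HB.pack_for {linear 'rV[F]_m -> 'rV[F]_n} g (GRing.isLinear.Build _ _ _ _ g lg).
by exists (lin1_mx h) => x; rewrite mul_rV_lin1.
Qed.

Lemma delta_form (F : fieldType) n (A : 'M[F]_n) a b :
  ((delta_mx 0 a : 'rV_n) *m A *m (delta_mx 0 b : 'rV_n)^T) 0 0 = A a b.
Proof. by rewrite trmx_delta -rowE -colE !mxE. Qed.

(* As the M l are independent, the products of ts M span 0 * 'rV_k; hence the
   isomorphism f maps 0 * 'rV_k into 0 * 'rV_k', so it is block triangular. *)
Lemma ts_iso_elim (F : fieldType) n k n' k' (M : 'I_k -> 'M[F]_n)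
    (M' : 'I_k' -> 'M[F]_n') : indep M -> alg_iso (ts M) (ts M') ->
  exists P : 'M[F]_(n, n'), exists R : 'M[F]_(k, k'),
    [/\ row_full P, row_free R
      & forall l, P *m M' l *m P^T = \sum_m R m l *: M m].
Proof.
move=> iM [f [[g fK gK] fM]].
have [P fP] : exists P : 'M_(n, n'), forall x, (f (x, 0)).1 = x *m P.
  apply: (@linear_rV_mx _ _ _ (fun x => (f (x, 0)).1)) => a x y.
  have -> : (a *: x + y, 0) = a *: (x, 0) + (y, 0) :> ts M.
    by congr pair; rewrite /= scaler0 addr0.
  by rewrite linearP.
have [H fH] : exists H : 'M_(k, n'), forall x, (f (0, x)).1 = x *m H.
  apply: (@linear_rV_mx _ _ _ (fun x => (f (0, x)).1)) => a x y.
  have -> : (0, a *: x + y) = a *: (0, x) + (0, y) :> ts M.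
    by congr pair; rewrite /= scaler0 addr0.
  by rewrite linearP.
have [R fR] : exists R : 'M_(k, k'), forall x, (f (0, x)).2 = x *m R.
  apply: (@linear_rV_mx _ _ _ (fun x => (f (0, x)).2)) => a x y.
  have -> : (0, a *: x + y) = a *: (0, x) + (0, y) :> ts M.
    by congr pair; rewrite /= scaler0 addr0.
  by rewrite linearP.
have mE x y : alg_mul (ts M) (x, 0) (y, 0) = (0, \row_l (x *m M l *m y^T) 0 0).
  by [].
have H0 : H = 0.
  apply/matrixP => i j; rewrite mxE.
  suff: (row j H^T) = 0 by move/rowP/(_ i); rewrite !mxE.
  apply: iM; apply/matrixP => a b; rewrite summxE mxE.
  have := congr1 fst (fM (delta_mx 0 a, 0) (delta_mx 0 b, 0)).
  rewrite mE fH /= => /rowP/(_ j); rewrite mxE [RHS]mxE => E; rewrite -[RHS]E.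
  by apply: eq_bigr => l _; rewrite [in RHS]mxE delta_form !mxE mulrC.
have fE x u : f (x, u) = (x *m P, (f (x, 0)).2 + u *m R).
  have -> : (x, u) = (x, 0) + (0, u) :> ts M by congr pair; rewrite /= ?addr0 ?add0r.
  rewrite linearD [LHS]surjective_pairing; congr pair; rewrite /= ?fP ?fH ?fR //.
  by rewrite H0 mulmx0 addr0.
exists P, R; split.
- rewrite -sub1mx; apply/row_subP => i; apply/submxP.
  exists (g (row i 1%:M, 0)).1; have := congr1 fst (gK (row i 1%:M, 0)).
  by rewrite [g _]surjective_pairing fE /=.
- apply: inj_row_free => v vR.
  suff: (0, v) = 0 :> ts M by case.
  by apply: (can_inj fK); rewrite linear0 fE vR addr0 linear0 mul0mx.
move=> l; apply/matrixP => a b; rewrite summxE.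
have := congr1 snd (fM (delta_mx 0 a, 0) (delta_mx 0 b, 0)).
rewrite mE fR /= !fP => /rowP/(_ l); rewrite [RHS]mxE => E.
rewrite -(delta_form (P *m _ *m _)) !mulmxA.
move: E; rewrite trmx_mul !mulmxA => <-; rewrite [LHS]mxE.
by apply: eq_bigr => m _; rewrite [in LHS]mxE delta_form !mxE mulrC.
Qed.

(** A row free [R] gives [k <= k'], and the inverse isomorphism gives the converse. This separates
    algebras with different numbers of forms. *)
Lemma ts_iso_dim (F : fieldType) n k n' k' (M : 'I_k -> 'M[F]_n)
    (M' : 'I_k' -> 'M[F]_n') :
  indep M -> indep M' -> alg_iso (ts M) (ts M') -> k = k'.
Proof.
move=> iM iM' I; apply/eqP; rewrite eqn_leq.
have [_ [R [_ Rf _]]] := ts_iso_elim iM I.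
have [_ [R' [_ R'f _]]] := ts_iso_elim iM' (alg_iso_sym I).
by move: (rank_leq_col R) (rank_leq_col R'); rewrite (eqP Rf) (eqP R'f) => -> ->.
Qed.

(** * Products of subspaces *)

Section Products.
Variables (F : fieldType) (X : algebra F).
Implicit Types U V W : {vspace X}.
Local Notation "x ** y" := (alg_mul X x y) (at level 40, left associativity).

Definition prodv U V : {vspace X} :=
  <<[seq u ** v | u <- vbasis U, v <- vbasis V]>>%VS.

Lemma mem_prodv U V u v : u \in U -> v \in V -> u ** v \in prodv U V.
Proof.
move=> uU vV; rewrite (coord_vbasis uU) (coord_vbasis vV) linear_sumlz.
apply: memv_suml => i _; rewrite linear_sumr; apply: memv_suml => j _.
rewrite linearZl_LR linearZr_LR !memvZ // memv_span //.
by apply: allpairs_f; apply: mem_nth; rewrite size_tuple.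
Qed.

Lemma prodv_subP U V W :
  (forall u v, u \in U -> v \in V -> u ** v \in W) -> (prodv U V <= W)%VS.
Proof.
move=> UVW; apply/span_subvP => _ /allpairsP[[u v] /= [uU vV ->]].
by apply: UVW; apply: vbasis_mem.
Qed.

(* If U <= X U then every element of U is a sum of products of arbitrarily many
   elements. *)
Lemma nilpotent_prodv U :
  mul_assoc X -> nilpotent_alg X -> (U <= prodv fullv U)%VS -> U = 0%VS.
Proof.
move=> XA [n Xn] UU.
suff H m (h : 'End(X)) : (forall x (s : m.-tuple X) u,
    u \in U -> h (foldl (alg_mul X) x s ** u) = 0) -> (U <= lker h)%VS.
  apply/eqP; rewrite -subv0; apply/subvP => u uU; rewrite memv0.
  have: u \in lker (\1%VF : 'End(X)).
    apply: (subvP (H n _ _)) uU => x s v _.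
    by rewrite Xn linear0l linear0.
  by rewrite memv_ker id_lfunE.
elim: m h => [|m IH] h hU.
  apply: subv_trans UU _; apply: prodv_subP => x u _ uU.
  by rewrite memv_ker (hU x [tuple]).
(* Writing [u] as a sum of products [y ** v] with [v] in [U] moves [y] into the left factor, which
   becomes one element longer. *)
apply: IH => x s u uU.
suff: (U <= lker (h \o linfun (alg_mul X (foldl (alg_mul X) x s))))%VS.
  by move/subvP/(_ _ uU); rewrite memv_ker lfunE /= lfunE => /eqP.
apply: subv_trans UU _; apply: prodv_subP => y v _ vU.
rewrite memv_ker lfunE /= lfunE /= XA.
by have := hU x [tuple of rcons s y] v vU; rewrite foldl_rcons => ->.
Qed.

End Products.

Lemma linear_prodv0 (F : fieldType) (X : algebra F) (phi : X -> F^o) :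
    linear phi -> (forall x y, phi (alg_mul X x y) = 0) ->
  forall z, z \in prodv {: X} {: X} -> phi z = 0.
Proof.
move=> lphi phi0 z zW; pose h : {linear X -> F^o} :=
  HB.pack_for {linear X -> F^o} phi (GRing.isLinear.Build _ _ _ _ phi lphi).
have: (prodv {: X} {: X} <= lker (linfun h))%VS.
  by apply: prodv_subP => u v _ _; rewrite memv_ker lfunE; apply/eqP/phi0.
by move/subvP/(_ _ zW); rewrite memv_ker lfunE => /eqP.
Qed.

Lemma form_sum (F : fieldType) n (A : 'M[F]_n) (x y : 'rV_n) :
  (x *m A *m y^T) 0 0 = \sum_i \sum_j x 0 i * y 0 j * A i j.
Proof.
rewrite [LHS]mxE exchange_big; apply: eq_bigr => j _ /=.
rewrite !mxE mulr_suml; apply: eq_bigr => i _.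
by rewrite mulrAC.
Qed.

(** The forms are the coordinates in [X X] of the products of a basis of a complement. They are
    independent because a relation between them is a functional on [X X] that vanishes on all
    products, hence is zero. *)
Lemma two_step (F : fieldType) (X : algebra F) :
    (forall x y z, alg_mul X x (alg_mul X y z) = 0) ->
    (forall x y z, alg_mul X (alg_mul X x y) z = 0) ->
  exists n k, [/\ (n + k = \dim {: X})%N &
    exists2 M : 'I_k -> 'M[F]_n, indep M & alg_iso X (ts M)].
Proof.
move=> X1 X2; pose W := prodv {: X} {: X}; pose C := (W^C)%VS.
exists (\dim C), (\dim W).
have nk : (\dim C + \dim W)%N = \dim {: X}.
  by rewrite dimv_compl subnK // dimvS ?subvf.
split=> //.
have W0l x w : w \in W -> alg_mul X x w = 0.
  move=> wW; have: (W <= lker (linfun (alg_mul X x)))%VS.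
    by apply: prodv_subP => u v _ _; rewrite memv_ker lfunE /= X1.
  by move/subvP/(_ _ wW); rewrite memv_ker lfunE => /eqP.
have W0r x w : w \in W -> alg_mul X w x = 0.
  move=> wW; have: (W <= lker (linfun (applyr (alg_mul X) x)))%VS.
    by apply: prodv_subP => u v _ _; rewrite memv_ker lfunE /= X2.
  by move/subvP/(_ _ wW); rewrite memv_ker lfunE => /eqP.
pose M (l : 'I_(\dim W)) := \matrix_(i < \dim C, j < \dim C)
  coord (vbasis W) l (alg_mul X (vbasis C)`_i (vbasis C)`_j).
pose gC (v : 'rV_(\dim C)) := \sum_i v 0 i *: (vbasis C)`_i.
pose gW (v : 'rV_(\dim W)) := \sum_i v 0 i *: (vbasis W)`_i.
have gWW v : gW v \in W.
  apply: memv_suml => i _; rewrite memvZ // vbasis_mem // mem_nth //.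
  by rewrite size_tuple.
have MW (i j : 'I_(\dim C)) : alg_mul X (vbasis C)`_i (vbasis C)`_j = gW (\row_l M l i j).
  rewrite {1}(coord_vbasis (mem_prodv (memvf (vbasis C)`_i) (memvf (vbasis C)`_j))).
  by apply: eq_bigr => l _; rewrite !mxE.
have gWP : linear gW.
  move=> a x y; rewrite /gW scaler_sumr -big_split /=; apply: eq_bigr => i _.
  by rewrite !mxE scalerDl scalerA.
have gCP : linear gC.
  move=> a x y; rewrite /gC scaler_sumr -big_split /=; apply: eq_bigr => i _.
  by rewrite !mxE scalerDl scalerA.
pose g (v : ts M) : X := gC v.1 + gW v.2.
have gl : linear g.
  by move=> a x y; rewrite /g gCP gWP scalerDr addrACA.
have gC0 : gC 0 = 0.
  by rewrite /gC big1 // => i _; rewrite mxE scale0r.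
have gM x y : g (alg_mul (ts M) x y) = alg_mul X (g x) (g y).
  pose hW : {linear 'rV[F]_(\dim W) -> X} := HB.pack_for
    {linear 'rV[F]_(\dim W) -> X} gW (GRing.isLinear.Build _ _ _ _ gW gWP).
  rewrite /g linearDl !linearDr /= !(W0l _ _ (gWW _)) (W0r _ _ (gWW _)) !addr0.
  rewrite gC0 add0r {1}/gC linear_sumlz.
  have -> : \row_l (x.1 *m M l *m y.1^T) 0 0 =
      \sum_i \sum_j (x.1 0 i * y.1 0 j) *: \row_l M l i j.
    apply/rowP => l; rewrite mxE form_sum summxE; apply: eq_bigr => i _.
    by rewrite summxE; apply: eq_bigr => j _; rewrite !mxE.
  rewrite -[gW]/(hW : _ -> _) linear_sum; apply: eq_bigr => i _.
  rewrite linear_sum linearZl_LR /= {1}/gC linear_sumr [RHS]scaler_sumr.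
  by apply: eq_bigr => j _; rewrite -[gW]/(hW : _ -> _) linearZ linearZr_LR /= MW scalerA.
have sg y : exists x, y = g x.
  have: y \in (C + W)%VS by rewrite addvC addv_complf memvf.
  case/memv_addP => c cC [w wW ->].
  exists (\row_i coord (vbasis C) i c, \row_i coord (vbasis W) i w).
  rewrite /g {1}(coord_vbasis cC) {1}(coord_vbasis wW).
  by congr (_ + _); apply: eq_bigr => i _; rewrite mxE.
exists M; last first.
  apply/alg_iso_sym; apply: (@alg_isoI _ (ts M) X g gl) => //.
  apply: surj_bij => //.
    rewrite -nk dimvf.
    transitivity (dim 'rV[F]_(\dim C) + dim 'rV[F]_(\dim W))%N; first by [].
    by rewrite !dim_matrix !mul1r.
move=> w Mw.
pose phi (z : X) : F^o := \sum_l w 0 l * coord (vbasis W) l z.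
have lphi : linear phi.
  move=> a x y; rewrite /phi scaler_sumr -big_split /=; apply: eq_bigr => l _.
  by rewrite linearP mulrDr /= mulrCA.
have phiW z : z \in W -> phi z = 0.
  apply: linear_prodv0 => // x y.
  have [[u1 u2] ->] := sg x; have [[v1 v2] ->] := sg y.
  rewrite -gM /g /= gC0 add0r.
  have phi_gW v : phi (gW v) = \sum_l w 0 l * v 0 l.
    apply: eq_bigr => l _; congr (_ * _).
    by rewrite coord_sum_free ?(basis_free (vbasisP _)).
  rewrite phi_gW; transitivity ((u1 *m (\sum_l w 0 l *: M l) *m v1^T) 0 0).
    rewrite mulmx_sumr mulmx_suml summxE; apply: eq_bigr => l _.
    by rewrite -scalemxAr -scalemxAl mxE [RHS]mxE.
  by rewrite Mw mulmx0 mul0mx mxE.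
apply/rowP => l; rewrite mxE.
have := phiW (vbasis W)`_l; rewrite vbasis_mem ?mem_nth ?size_tuple // => /(_ isT) <-.
rewrite /phi (bigD1 l) //= coord_free ?eqxx ?(basis_free (vbasisP _)) // mulr1.
rewrite big1 ?addr0 // => j jl.
by rewrite coord_free ?(basis_free (vbasisP _)) // eq_sym (negPf jl) mulr0.
Qed.

(** * Algebras with a nonzero product of three elements *)

Section Table.
Variables (F : fieldType) (X : algebra F).
Local Notation "x ** y" := (alg_mul X x y) (at level 40, left associativity).

Lemma presented_iso4 (r : presentation F) (e0 e1 e2 e3 : X) :
    \dim {: X} = 4%N ->
    (forall x, exists s t u v, x = s *: e0 + t *: e1 + u *: e2 + v *: e3) ->
    (forall i j : 'I_4, [:: e0; e1; e2; e3]`_i ** [:: e0; e1; e2; e3]`_j =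
      table r i j 0 ord0 *: e0 + table r i j 0 (inord 1) *: e1
      + table r i j 0 (inord 2) *: e2 + table r i j 0 (inord 3) *: e3) ->
  alg_iso X (presented r).
Proof.
move=> X4 eS eM; pose e (i : 'I_4) := [:: e0; e1; e2; e3]`_i.
have sumE (v : 'I_4 -> F) : \sum_i v i *: e i =
    v ord0 *: e0 + v (inord 1) *: e1 + v (inord 2) *: e2 + v (inord 3) *: e3.
  rewrite !big_ord_recl big_ord0 /e /= addr0 !addrA.
  congr (_ *: _ + _ *: _ + _ *: _ + _ *: _); congr v; apply: val_inj;
  by rewrite /= inordK.
apply: (@presented_iso _ X r e X4) => [x|i j]; last by rewrite eM sumE.
have [s [t [u [v ->]]]] := eS x.
exists (\row_(i < 4) [:: s; t; u; v]`_i).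
by rewrite sumE !mxE /= !inordK.
Qed.

End Table.

Ltac ord4_cases i := case: i => [[|[|[|[|//]]]] ?].

Ltac table_eval :=
  rewrite /table unlock /= ?mxE /= -?val_eqE /= ?inordK //=.

Lemma sub3K (V : zmodType) (x a b c : V) : x = a + b + c + (x - a - b - c).
Proof.
have -> : x - a - b - c = x - (a + b + c) by rewrite !opprD !addrA.
by rewrite addrC subrK.
Qed.

Section NonTwoStep.
Variables (F : fieldType) (X : algebra F).
Implicit Types (U V W : {vspace X}) (x y z : X).
Local Notation "x ** y" := (alg_mul X x y) (at level 40, left associativity).

Lemma prodv_subPn U V W : ~~ (prodv U V <= W)%VS ->
  exists u v, [/\ u \in U, v \in V & u ** v \notin W].
Proof.
move=> nW; pose s := [seq u ** v | u <- vbasis U, v <- vbasis V].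
have /allPn[_ /allpairsP[[u v] /= [uU vV ->]] uvW] : ~~ all (mem W) s.
  by apply: contra nW => /allP sW; apply/span_subvP.
by exists u, v; split; [exact: vbasis_mem | exact: vbasis_mem |].
Qed.

Lemma prodvSr U V W : (V <= W)%VS -> (prodv U V <= prodv U W)%VS.
Proof.
by move=> VW; apply: prodv_subP => u v uU /(subvP VW) vW; apply: mem_prodv.
Qed.

Lemma mem_prodv_mul U V W z : (forall u v, u \in U -> v \in V -> u ** v ** z \in W) ->
  forall w, w \in prodv U V -> w ** z \in W.
Proof.
move=> UVW w wUV.
have: (prodv U V <= linfun (applyr (alg_mul X) z) @^-1: W)%VS.
  by apply: prodv_subP => u v uU vV; rewrite -memv_preim lfunE /=; apply: UVW.
by move/subvP/(_ _ wUV); rewrite -memv_preim lfunE.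
Qed.

Lemma hyperplane_mem U V a : (U <= V)%VS -> a \in V -> a \notin U ->
  \dim V = (\dim U).+1 -> forall x, x \in V -> exists s, x - s *: a \in U.
Proof.
move=> UV aV aU dV x.
suff -> : V = (<[a]> + U)%VS.
  case/memv_addP => _ /vlineP[s ->] [u uU ->].
  by exists s; rewrite addrC addrA addNr add0r.
apply/eqP; rewrite eq_sym eqEdim subv_add -memvE aV UV /= dV.
rewrite dimv_disjoint_sum ?dim_vline; last first.
  apply/eqP; rewrite -subv0; apply/subvP => y /memv_capP[/vlineP[s ->]] sU.
  have [->|s0] := eqVneq s 0; first by rewrite scale0r mem0v.
  by case/negP: aU; rewrite -[a](scalerK s0) memvZ.
by case: eqP aU => [->|]; rewrite ?mem0v.
Qed.

Hypotheses (XA : mul_assoc X) (Xn : nilpotent_alg X) (X4 : \dim {: X} = 4%N).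

Let W1 := prodv {: X} {: X}.
Let W2 := prodv {: X} W1.
Let W3 := prodv {: X} W2.
Let W4 := prodv {: X} W3.

(** By nilpotency [X U = U] only for [U = 0], so each step of the filtration loses a dimension; the
    truncated predecessor covers [U = 0]. *)
Lemma dim_prodv_lt U : (prodv {: X} U <= U)%VS ->
  (\dim (prodv {: X} U) <= (\dim U).-1)%N.
Proof.
move=> sU; have [U0|U0] := eqVneq U 0%VS.
  by rewrite {}U0 in sU *; rewrite (eqP (_ : prodv fullv 0 == 0)%VS) -?subv0 // dimv0.
rewrite -ltnS prednK ?lt0n ?dimv_eq0 //.
rewrite ltn_neqAle dimvS // andbT; apply: contra U0 => /eqP dU.
apply/eqP/nilpotent_prodv => //.
by have /eqP -> : prodv fullv U == U by rewrite eqEdim sU dU /=.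
Qed.

Let s21 : (W2 <= W1)%VS. Proof. exact/prodvSr/subvf. Qed.
Let s32 : (W3 <= W2)%VS. Proof. exact: prodvSr. Qed.
Let s43 : (W4 <= W3)%VS. Proof. exact: prodvSr. Qed.

Let d1 : (\dim W1 <= 3)%N.
Proof. by have := dim_prodv_lt (subvf _); rewrite X4. Qed.
Let d2 : (\dim W2 <= (\dim W1).-1)%N. Proof. exact: dim_prodv_lt. Qed.
Let d3 : (\dim W3 <= (\dim W2).-1)%N. Proof. exact: dim_prodv_lt. Qed.
Let d4 : (\dim W4 <= (\dim W3).-1)%N. Proof. exact: dim_prodv_lt. Qed.

Let W1V w x : w \in W1 -> w ** x \in W2.
Proof.
by apply: mem_prodv_mul => u v _ _; rewrite -XA mem_prodv ?memvf ?mem_prodv ?memvf.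
Qed.

Let W1W1 w x : w \in W1 -> x \in W1 -> w ** x \in W3.
Proof.
move=> wW xW; move: w wW; apply: mem_prodv_mul => u v _ _.
by rewrite -XA mem_prodv ?memvf ?mem_prodv ?memvf.
Qed.

Let W2V w x : w \in W2 -> w ** x \in W3.
Proof.
apply: mem_prodv_mul => u v _ vW1.
by rewrite -XA mem_prodv ?memvf ?W1V.
Qed.

Let W40 w : w \in W4 -> w = 0.
Proof.
suff /eqP : \dim W4 == 0%N.
  by move=> /eqP; rewrite dimv_eq0 => /eqP ->; rewrite memv0 => /eqP.
rewrite -leqn0; apply: leq_trans d4 _; rewrite -subn1 leq_subLR addn0.
apply: leq_trans d3 _; rewrite -subn1 leq_subLR.
apply: leq_trans d2 _; rewrite -subn1 leq_subLR.
exact: d1.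
Qed.

(** If [X] is a line plus [X X], a layer of the filtration that is a line yields a next layer that
    is a line, spanned by [a] times the previous generator; the contribution of [X X] sits one layer
    deeper. *)
Lemma prodv_line U U' b a :
    (forall x, exists s, x - s *: a \in W1) ->
    (forall w, w \in U -> exists t, w - t *: b \in U') ->
    (prodv W1 U <= prodv {: X} U')%VS ->
  forall w, w \in prodv {: X} U -> exists s, w - s *: (a ** b) \in prodv {: X} U'.
Proof.
move=> ha hb sU w wU.
suff /(subvP)/(_ w wU)/memv_addP[_ /vlineP[s ->] [u uW ->]] :
    (prodv {: X} U <= <[a ** b]> + prodv {: X} U')%VS.
  by exists s; rewrite addrC addrA addNr add0r.
apply: prodv_subP => x y _ yU.
have [s sW] := ha x; have [t tW] := hb y yU.
have -> : x ** y = (s * t) *: (a ** b) +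
    (s *: (a ** (y - t *: b)) + (x - s *: a) ** y).
  rewrite linearBl linearBr linearZl_LR /= linearZr_LR scalerBr scalerA.
  by rewrite addrA [X in _ = X + _]addrC subrK addrC subrK.
apply: memv_add; first by rewrite memvZ // memv_line.
apply: memvD; first by rewrite memvZ // mem_prodv ?memvf.
by apply: (subvP sU); rewrite mem_prodv.
Qed.

Let W1prod U : (prodv W1 U <= prodv {: X} (prodv {: X} U))%VS.
Proof.
apply: prodv_subP => w u wW uU; move: w wW; apply: mem_prodv_mul => x y _ _.
by rewrite -XA !mem_prodv ?memvf.
Qed.

(** An element [a] outside [X X] generates: [X] is spanned by the first four powers of [a], and the
    fifth lies in [W4 = 0]. Thus [A4_15] is the ideal (x) of F[x]/(x^5). *)
Lemma one_generated : \dim W1 = 3%N -> alg_iso X (presented A4_15).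
Proof.
move=> e1; have /subvPn[a _ aW1] : ~~ (fullv <= W1)%VS.
  by apply/negP => /dimvS; rewrite e1 X4.
have hyp x : exists s, x - s *: a \in W1.
  by apply: (hyperplane_mem (subvf W1) (memvf a) aW1) => //; rewrite ?e1 ?X4 ?memvf.
have hyp1 w : w \in W1 -> exists s, w - s *: (a ** a) \in W2.
  by apply: prodv_line.
have hyp2 w : w \in W2 -> exists s, w - s *: (a ** (a ** a)) \in W3.
  by apply: prodv_line.
have hyp3 w : w \in W3 -> exists s, w = s *: (a ** (a ** (a ** a))).
  move=> wW; have [|s /W40/eqP sE] := prodv_line hyp hyp2 _ wW; first exact: W1prod.
  by exists s; apply/eqP; rewrite -subr_eq0.
have a5 : a ** (a ** (a ** (a ** a))) = 0.
  by apply: W40; rewrite !mem_prodv ?memvf.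
apply: (@presented_iso4 _ _ _ a (a ** a) (a ** (a ** a)) (a ** (a ** (a ** a)))) => //.
  move=> x; have [s sW] := hyp x; have [t tW] := hyp1 _ sW.
  have [u uW] := hyp2 _ tW; have [v vE] := hyp3 _ uW.
  by exists s, t, u, v; rewrite -vE -sub3K.
move=> i j; ord4_cases i; ord4_cases j; table_eval.
all: rewrite -?XA ?a5 ?linear0r.
all: by rewrite ?(addr0, add0r, scale0r, scale1r).
Qed.

(** The shape shared by [A4_6], [A4_12], [A4_13] and [A4_14], the first with its last two basis
    elements exchanged: [e1 = e0^2], [e3 = e0^3], and [e2] is a second generator. The name lists the
    dimension drops of the filtration; the empty row of [e3] reads as zero by default. *)
Definition table_211 (kappa lambda : F) (e0 e1 e2 e3 : X) :=
  forall i j : 'I_4, [:: e0; e1; e2; e3]`_i ** [:: e0; e1; e2; e3]`_j =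
    nth 0 (nth [::] [:: [:: e1; e3; kappa *: e3; 0]; [:: e3; 0; 0; 0];
                        [:: 0; 0; lambda *: e3; 0]; [::]] i) j.

Lemma filtration_211 : \dim W1 = 2%N -> W2 != 0%VS ->
  exists a b c d kappa lambda, table_211 kappa lambda a b c d /\
    (forall x, exists s t u v, x = s *: a + t *: b + u *: c + v *: d).
Proof.
move=> e1 W2n0.
have W30 w : w \in W3 -> w = 0.
  suff /eqP : \dim W3 == 0%N.
    by move=> /eqP; rewrite dimv_eq0 => /eqP ->; rewrite memv0 => /eqP.
  rewrite -leqn0; apply: leq_trans d3 _; rewrite -subn1 leq_subLR.
  by apply: leq_trans d2 _; rewrite e1.
have VW2 x w : w \in W2 -> x ** w = 0 by move=> wW; apply: W30; rewrite mem_prodv ?memvf.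
have W20 x w : w \in W2 -> w ** x = 0 by move=> wW; apply: W30; apply: W2V.
have e2 : \dim W2 = 1%N.
  apply/eqP; rewrite eqn_leq lt0n dimv_eq0 W2n0 andbT.
  by apply: leq_trans d2 _; rewrite e1.
have hypW b : b \in W1 -> b \notin W2 -> forall w, w \in W1 -> exists s, w - s *: b \in W2.
  by move=> bW1 bW2; apply: hyperplane_mem; rewrite ?e1 ?e2.
have [a [x [y axy]]] : exists a x y, a ** (x ** y) != 0.
  have /prodv_subPn[a [w [_ wW aw]]] : ~~ (W2 <= 0)%VS by rewrite subv0.
  have /prodv_subPn[x [y [_ _ xy]]] : ~~ (W1 <= lker (linfun (alg_mul X a)))%VS.
    by apply: contra aw => /subvP/(_ w wW); rewrite memv_ker lfunE memv0.
  by exists a, x, y; move: xy; rewrite memv_ker lfunE.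
have xyW1 : x ** y \in W1 by rewrite mem_prodv ?memvf.
have W1mul u v : u ** v \in W1 by rewrite mem_prodv ?memvf.
(* The same exchange is made twice: an element of [X X] outside [W2] spans [X X] modulo [W2], and
   [a] kills [W2]. So the nonzero product [a ** (x ** y)] leads to [a ** (a ** x)] and then to
   [a ** (a ** a)]. *)
have axW2 : a ** x \notin W2 by apply: contra axy => /(W20 y) E; rewrite XA E.
have aax : a ** (a ** x) != 0.
  have [s sW] := hypW _ (W1mul a x) axW2 _ (W1mul x y).
  apply: contra axy => /eqP aax0.
  by rewrite -[x ** y](subrK (s *: (a ** x))) linearDr linearZr_LR /= aax0 VW2 // scaler0 addr0.
have aaW2 : a ** a \notin W2 by apply: contra aax => /(W20 x) E; rewrite XA E.
have aaa : a ** (a ** a) != 0.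
  have [s sW] := hypW _ (W1mul a a) aaW2 _ (W1mul a x).
  apply: contra aax => /eqP aaa0.
  by rewrite -[a ** x](subrK (s *: (a ** a))) linearDr linearZr_LR /= aaa0 VW2 // scaler0 addr0.
pose b := a ** a; pose d := a ** b.
have dW2 : d \in W2 by rewrite mem_prodv ?memvf ?W1mul.
have lineW2 w : w \in W2 -> exists s, w = s *: d.
  move=> wW; apply/vlineP; suff -> : <[d]>%VS = W2 by [].
  by apply/eqP; rewrite eqEdim -memvE dW2 e2 dim_vline aaa.
have decW1 w : w \in W1 -> exists s t, w = s *: b + t *: d.
  move=> wW; have [s /lineW2[t tE]] := hypW _ (W1mul a a) aaW2 _ wW.
  by exists s, t; rewrite -tE addrC subrK.
have dr z : d ** z = 0 by exact: W20.
have dl z : z ** d = 0 by exact: VW2.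
have ba : b ** a = d by rewrite /d /b XA.
have aW1 : a \notin W1.
  apply/negP => aW; case/eqP: aaa.
  by rewrite (W30 (a ** a)) ?linear0r // W1W1.
have /subvPn[c0 _ c0n] : ~~ (fullv <= <[a]> + W1)%VS.
  apply/negP => /dimvS; rewrite X4.
  by move/leq_trans/(_ (dimv_add_leqif _ _)); rewrite e1 dim_vline; case: eqP.
have [s [t E1]] := decW1 _ (W1mul a c0).
(* Subtracting a multiple of [a] removes the [b]-component of [a ** c0]; subtracting one of [b] then
   gives [c ** a = 0]. What is left of [a ** c] is the parameter [kappa]. *)
pose c1 := c0 - s *: a.
have ac1 : a ** c1 = t *: d.
  by rewrite /c1 linearBr linearZr_LR /= -/b E1 addrAC subrr add0r.
have [s' [rho E2]] := decW1 _ (W1mul c1 a).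
(* A [b]-component of [c1 ** a] would survive in [a ** (c1 ** a)], but [(a ** c1) ** a = 0]. The
   argument for [c ** c] below is the same. *)
have s'0 : s' = 0.
  have: (a ** c1) ** a = 0 by rewrite ac1 linearZl_LR /= dr scaler0.
  rewrite -XA E2 linearDr !linearZr_LR /= dl scaler0 addr0 => /eqP.
  by rewrite scaler_eq0 (negPf aaa) orbF => /eqP.
pose c := c1 - rho *: b.
have ca : c ** a = 0.
  by rewrite /c linearBl linearZl_LR /= ba E2 s'0 scale0r add0r subrr.
have ac : a ** c = (t - rho) *: d.
  by rewrite /c linearBr linearZr_LR /= ac1 -/d scalerBl.
have bc : b ** c = 0 by rewrite /b -XA ac linearZr_LR /= dl scaler0.
have cb : c ** b = 0 by rewrite /b XA ca linear0l.
have [s'' [lambda E3]] := decW1 _ (W1mul c c).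
have s''0 : s'' = 0.
  have: (a ** c) ** c = 0 by rewrite ac linearZl_LR /= dr scaler0.
  rewrite -XA E3 linearDr !linearZr_LR /= dl scaler0 addr0 => /eqP.
  by rewrite scaler_eq0 (negPf aaa) orbF => /eqP.
have cc : c ** c = lambda *: d by rewrite E3 s''0 scale0r add0r.
have bb : b ** b = 0 by rewrite {1}/b -XA -/d dl.
exists a, b, c, d, (t - rho), lambda; split.
  move=> i j; ord4_cases i; ord4_cases j => /=;
  by rewrite -?/b -?/d ?ba ?ca ?ac ?bc ?cb ?cc ?dr ?dl.
move=> z.
have aU : a \in (<[a]> + W1)%VS by apply: (subvP (addvSl _ _)); exact: memv_line.
have W1U : (W1 <= <[a]> + W1)%VS by exact: addvSr.
have dU : \dim (<[a]> + W1) = 3%N.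
  rewrite dimv_disjoint_sum ?e1 ?dim_vline.
    by case: eqP aW1 => [->|]; rewrite ?mem0v.
  apply/eqP; rewrite -subv0; apply/subvP => v /memv_capP[/vlineP[r ->]] sU.
  have [->|r0] := eqVneq r 0; first by rewrite scale0r mem0v.
  by case/negP: aW1; rewrite -[a](scalerK r0) memvZ.
have cU : c \notin (<[a]> + W1)%VS.
  apply: contra c0n => cU; rewrite -[c0](subrK (s *: a)) -/c1 memvD ?memvZ //.
  by rewrite -[c1](subrK (rho *: b)) memvD // memvZ // (subvP W1U) ?W1mul.
have [u uU] : exists u, z - u *: c \in (<[a]> + W1)%VS.
  by apply: (hyperplane_mem (subvf _) (memvf c) cU); rewrite ?memvf // X4 dU.
have [r rW] : exists r, z - u *: c - r *: a \in W1.
  by apply: (hyperplane_mem W1U aU aW1) uU; rewrite dU e1.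
have [p [q pq]] := decW1 _ rW.
exists r, p, u, q; rewrite [LHS](sub3K z (u *: c) (r *: a) 0) subr0 pq addr0.
by rewrite [u *: c + _]addrC !addrA [X in X + _]addrAC.
Qed.
End NonTwoStep.

Lemma table_211_scale (F : fieldType) (X : algebra F) kappa lambda t u
    (a b c d : X) : t != 0 -> table_211 kappa lambda a b c d ->
  table_211 (kappa * u / t ^+ 2) (lambda * u ^+ 2 / t ^+ 3)
    (t *: a) (t ^+ 2 *: b) (u *: c) (t ^+ 3 *: d).
Proof.
move=> t0 T i j.
have E s1 s2 (x y z : X) : alg_mul X x y = z ->
    alg_mul X (s1 *: x) (s2 *: y) = (s1 * s2) *: z.
  by move=> <-; rewrite linearZl_LR linearZr_LR /= scalerA.
have := T i j; ord4_cases i; ord4_cases j => /= /E -> //;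
  rewrite ?scaler0 // ?scalerA -?expr2 -?exprS -?exprSr //;
  congr (_ *: _); by field.
Qed.

Lemma table_211_iso (F : fieldType) (X : algebra F) kappa lambda (a b c d : X) :
    \dim {: X} = 4%N -> table_211 kappa lambda a b c d ->
    (forall x, exists s t u v, x = s *: a + t *: b + u *: c + v *: d) ->
  [\/ alg_iso X (presented A4_6), alg_iso X (presented A4_12),
      alg_iso X (presented A4_13) | alg_iso X (presented A4_14)].
Proof.
move=> X4 T sp.
have sp' t1 t2 t3 t4 : t1 != 0 -> t2 != 0 -> t3 != 0 -> t4 != 0 -> forall x : X,
    exists s t u v, x = s *: (t1 *: a) + t *: (t2 *: b) + u *: (t3 *: c) + v *: (t4 *: d).
  move=> h1 h2 h3 h4 x; have [s [t [u [v ->]]]] := sp x.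
  exists (s / t1), (t / t2), (u / t3), (v / t4).
  by rewrite !scalerA !divfK.
have [l0|l0] := eqVneq lambda 0; have [k0|k0] := eqVneq kappa 0.
- apply: Or41; apply: (@presented_iso4 _ _ _ a b d c) => //.
    move=> x; have [s [t [u [v ->]]]] := sp x.
    by exists s, t, v, u; rewrite addrAC.
  pose f (i : 'I_4) := nth (@Ordinal 4 0 isT)
    [:: @Ordinal 4 0 isT; @Ordinal 4 1 isT; @Ordinal 4 3 isT; @Ordinal 4 2 isT] i.
  have fE (i : 'I_4) : [:: a; b; d; c]`_i = [:: a; b; c; d]`_(f i).
    by ord4_cases i.
  move=> i j; rewrite !fE T k0 l0.
  by ord4_cases i; ord4_cases j; table_eval; rewrite ?(addr0, add0r, scale0r, scale1r).
- apply: Or44; have := table_211_scale kappa^-1 (oner_neq0 _) T.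
  rewrite l0 !expr1n invr1 mulr1 divff // !mul0r !scale1r => T'.
  apply: (presented_iso4 X4) => [|i j].
    have := sp' 1 1 kappa^-1 1; rewrite !scale1r; apply=> //;
    by rewrite ?oner_neq0 ?invr_neq0.
  rewrite T'; ord4_cases i; ord4_cases j; table_eval;
  by rewrite ?(addr0, add0r, scale0r, scale1r).
- apply: Or43; have := table_211_scale lambda l0 T.
  rewrite k0 !mul0r -exprS divff ?expf_neq0 // => T'.
  apply: (presented_iso4 X4 (sp' lambda (lambda ^+ 2) lambda (lambda ^+ 3) _ _ _ _));
    rewrite ?expf_neq0 // => i j.
  rewrite T'; ord4_cases i; ord4_cases j; table_eval;
  by rewrite ?(addr0, add0r, scale0r, scale1r).
(* The scaling factors solve [kappa u = t^2] and [lambda u^2 = t^3]. *)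
- apply: Or42; pose t := kappa ^+ 2 / lambda; pose u := kappa ^+ 3 / lambda ^+ 2.
  have t0 : t != 0 by rewrite mulf_neq0 ?expf_neq0 ?invr_neq0.
  have u0 : u != 0 by rewrite mulf_neq0 ?expf_neq0 ?invr_neq0 ?expf_neq0.
  have := table_211_scale u t0 T.
  rewrite (_ : _ / _ = 1); last by rewrite /t /u; field; rewrite ?k0 ?l0.
  rewrite (_ : lambda * _ / _ = 1); last by rewrite /t /u; field; rewrite ?k0 ?l0.
  move=> T'.
  apply: (presented_iso4 X4 (sp' t (t ^+ 2) u (t ^+ 3) _ _ _ _));
    rewrite ?expf_neq0 // => i j.
  rewrite T'; ord4_cases i; ord4_cases j; table_eval;
  by rewrite ?(addr0, add0r, scale0r, scale1r).
Qed.

Lemma nilpotent4_cases (F : fieldType) (X : algebra F) : nilpotent_assoc_alg4 X ->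
    (exists n k, (n + k = 4)%N /\
       exists2 M : 'I_k -> 'M[F]_n, indep M & alg_iso X (ts M)) \/
  (alg_iso X (presented A4_15) \/
   [\/ alg_iso X (presented A4_6), alg_iso X (presented A4_12),
       alg_iso X (presented A4_13) | alg_iso X (presented A4_14)]).
Proof.
case=> XA Xn X4; set W1 := prodv {: X} {: X}; set W2 := prodv {: X} W1.
have [W20|W20] := eqVneq W2 0%VS.
  left; have X30 x y z : alg_mul X x (alg_mul X y z) = 0.
    by apply/eqP; rewrite -memv0 -W20 !mem_prodv ?memvf.
  have [|n [k [nk iX]]] := two_step X30; first by move=> x y z; rewrite -XA.
  by exists n, k; rewrite nk X4.
right; have [W13|W13] := eqVneq (\dim W1) 3%N.
  by left; apply: one_generated.
right; have [|a [b [c [d [k [l [T sp]]]]]]] := filtration_211 XA Xn X4 _ W20.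
  have := dim_prodv_lt XA Xn (subvf (prodv fullv fullv)).
  have := dim_prodv_lt XA Xn (prodvSr _ (subvf (prodv fullv fullv))).
  move: W20 W13; rewrite -dimv_eq0 X4 -/W1 -/W2.
  by case: (\dim W1) => [|[|[|[]]]] //; case: (\dim W2).
exact: table_211_iso T sp.
Qed.

(** * Invariants of the algebras with nonzero triple products *)

Section Long.
Variable F : fieldType.

Definition row4 (p q s t : F) : 'rV[F]_4 := \row_j [:: p; q; s; t]`_j.

Lemma row4_eta (x : 'rV[F]_4) : exists p q s t, x = row4 p q s t.
Proof.
exists (x 0 0), (x 0 1), (x 0 2%:R), (x 0 3%:R).
by apply/rowP; case=> [[|[|[|[|//]]]] i]; rewrite mxE /=; congr (x _ _); apply: val_inj.
Qed.

Lemma row4_eq0 p q s t : row4 p q s t = 0 -> [/\ p = 0, q = 0, s = 0 & t = 0].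
Proof.
move=> /rowP E; split; [have := E 0 | have := E 1 | have := E 2%:R | have := E 3%:R];
by rewrite !mxE.
Qed.

Ltac long_mul :=
  apply/rowP; case=> [[|[|[|[|//]]]] ?];
  rewrite /= /table_mul !big_ord_recl !big_ord0 /table unlock /= !mxE /= -?val_eqE /=; ring.

Lemma mul_A4_6 p q s t p' q' s' t' :
  alg_mul (presented A4_6) (row4 p q s t) (row4 p' q' s' t') =
  row4 0 (p * p') (p * q' + q * p') 0.
Proof. long_mul. Qed.

Lemma mul_A4_12 p q s t p' q' s' t' :
  alg_mul (presented A4_12) (row4 p q s t) (row4 p' q' s' t') =
  row4 0 (p * p') 0 (p * q' + q * p' + p * s' + s * s').
Proof. long_mul. Qed.

Lemma mul_A4_13 p q s t p' q' s' t' :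
  alg_mul (presented A4_13) (row4 p q s t) (row4 p' q' s' t') =
  row4 0 (p * p') 0 (p * q' + q * p' + s * s').
Proof. long_mul. Qed.

Lemma mul_A4_14 p q s t p' q' s' t' :
  alg_mul (presented A4_14) (row4 p q s t) (row4 p' q' s' t') =
  row4 0 (p * p') 0 (p * q' + q * p' + p * s').
Proof. long_mul. Qed.

Lemma mul_A4_15 p q s t p' q' s' t' :
  alg_mul (presented A4_15) (row4 p q s t) (row4 p' q' s' t') =
  row4 0 (p * p') (p * q' + q * p') (q * q' + p * s' + s * p').
Proof. long_mul. Qed.

Definition mul_long := (mul_A4_6, mul_A4_12, mul_A4_13, mul_A4_14, mul_A4_15).

Lemma long_nilpotent4 r : r \in [:: A4_6; A4_12; A4_13; A4_14; A4_15] ->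
  nilpotent_assoc_alg4 (presented r : algebra F).
Proof.
rewrite !inE => hr; split; last by rewrite dimvf dim_matrix.
{ move=> x y z; have [p [q [s [t ->]]]] := row4_eta x.
  have [p' [q' [s' [t' ->]]]] := row4_eta y.
  have [p'' [q'' [s'' [t'' ->]]]] := row4_eta z.
  move: hr; do 4?[case/orP=> [/eqP->|]]; last move=> /eqP->.
  all: by rewrite !mul_long; congr row4; ring. }
exists 4%N => x; case=> [[|y [|z [|u [|v [|]]]]]] //= _.
have [? [? [? [? ->]]]] := row4_eta x; have [? [? [? [? ->]]]] := row4_eta y.
have [? [? [? [? ->]]]] := row4_eta z; have [? [? [? [? ->]]]] := row4_eta u.
have [? [? [? [? ->]]]] := row4_eta v.
move: hr; do 4?[case/orP=> [/eqP->|]]; last move=> /eqP->.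
all: rewrite !mul_long; apply/rowP => -[[|[|[|[|//]]]] i]; rewrite !mxE /=; ring.
Qed.

Implicit Types X Y : algebra F.
(** [cube] excludes the algebras [ts M], [fourth] singles out [A4_15], and commutativity separates
    [A4_6], [A4_13] from [A4_12], [A4_14]. Within either pair [null_squares] decides: in [A4_12] and
    [A4_13] the basis element [c] kills [X X] from the left but has square [d]. *)
Definition cube X := exists x y z : X, alg_mul X x (alg_mul X y z) <> 0.
Definition fourth X := exists x y z t : X, alg_mul X x (alg_mul X y (alg_mul X z t)) <> 0.
Definition commutative_alg X := forall x y : X, alg_mul X x y = alg_mul X y x.
Definition null_squares X := forall v : X,
  (forall x y : X, alg_mul X v (alg_mul X x y) = 0) -> alg_mul X v v = 0.

Lemma cube_iso X Y : alg_iso X Y -> cube X -> cube Y.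
Proof.
case=> f [/bij_inj fI fM] [x [y [z h]]]; exists (f x), (f y), (f z).
by rewrite -!fM => h'; apply/h/fI; rewrite h' linear0.
Qed.

Lemma fourth_iso X Y : alg_iso X Y -> fourth X -> fourth Y.
Proof.
case=> f [/bij_inj fI fM] [x [y [z [t h]]]]; exists (f x), (f y), (f z), (f t).
by rewrite -!fM => h'; apply/h/fI; rewrite h' linear0.
Qed.

Lemma commutative_alg_iso X Y : alg_iso X Y -> commutative_alg X -> commutative_alg Y.
Proof.
by case=> f [[g fK gK] fM] XC x y; rewrite -[x]gK -[y]gK -!fM XC.
Qed.

Lemma null_squares_iso X Y : alg_iso X Y -> null_squares X -> null_squares Y.
Proof.
case=> f [[g fK gK] fM] XN v hv; rewrite -[v]gK -fM XN ?linear0 // => x y.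
by apply: (can_inj fK); rewrite !fM gK hv linear0.
Qed.

Lemma cube_long r : r \in [:: A4_6; A4_12; A4_13; A4_14; A4_15] ->
  cube (presented r : algebra F).
Proof.
move=> hr; exists (row4 1 0 0 0), (row4 1 0 0 0), (row4 1 0 0 0).
move: hr; rewrite !inE; do 4?[case/orP=> [/eqP->|]]; last move=> /eqP->.
all: rewrite !mul_long => /row4_eq0[]; rewrite ?(mulr0, mul0r, mulr1, addr0, add0r) => A B C D.
all: have [E|E] : (1 = 0 :> F) \/ (1 = 0 :> F) by auto.
all: by move/eqP: E; rewrite oner_eq0.
Qed.

Lemma cube_ts n k (M : 'I_k -> 'M[F]_n) : ~ cube (ts M).
Proof.
case=> x [y [z]]; apply; congr pair; apply/rowP => l.
by rewrite [LHS]mxE /= trmx0 mulmx0 !mxE.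
Qed.

Lemma fourth_A4_15 : fourth (presented A4_15).
Proof.
exists (row4 1 0 0 0), (row4 1 0 0 0), (row4 1 0 0 0), (row4 1 0 0 0).
rewrite !mul_long => /row4_eq0[_ _ _].
by rewrite ?(mulr0, mul0r, mulr1, addr0, add0r) => /eqP; rewrite oner_eq0.
Qed.

Lemma fourth_211 r : r \in [:: A4_6; A4_12; A4_13; A4_14] -> ~ fourth (presented r).
Proof.
move=> hr [x [y [z [t]]]]; apply.
have [? [? [? [? ->]]]] := row4_eta x; have [? [? [? [? ->]]]] := row4_eta y.
have [? [? [? [? ->]]]] := row4_eta z; have [? [? [? [? ->]]]] := row4_eta t.
move: hr; rewrite !inE; do 3?[case/orP=> [/eqP->|]]; last move=> /eqP->.
all: rewrite !mul_long; apply/rowP => -[[|[|[|[|//]]]] i]; rewrite !mxE /=; ring.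
Qed.

Lemma commutative_A4_6 : commutative_alg (presented A4_6).
Proof.
move=> x y; have [? [? [? [? ->]]]] := row4_eta x.
by have [? [? [? [? ->]]]] := row4_eta y; rewrite !mul_long; congr row4; ring.
Qed.

Lemma commutative_A4_13 : commutative_alg (presented A4_13).
Proof.
move=> x y; have [? [? [? [? ->]]]] := row4_eta x.
by have [? [? [? [? ->]]]] := row4_eta y; rewrite !mul_long; congr row4; ring.
Qed.

Lemma noncommutative_A4_12 : ~ commutative_alg (presented A4_12).
Proof.
move=> /(_ (row4 1 0 0 0) (row4 0 0 1 0)); rewrite !mul_long => /rowP/(_ 3%:R).
rewrite !mxE /= ?(mulr0, mul0r, mulr1, addr0, add0r) => /eqP.
by rewrite oner_eq0.
Qed.

Lemma noncommutative_A4_14 : ~ commutative_alg (presented A4_14).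
Proof.
move=> /(_ (row4 1 0 0 0) (row4 0 0 1 0)); rewrite !mul_long => /rowP/(_ 3%:R).
rewrite !mxE /= ?(mulr0, mul0r, mulr1, addr0, add0r) => /eqP.
by rewrite oner_eq0.
Qed.

Lemma null_squares_A4_6 : null_squares (presented A4_6).
Proof.
move=> v; have [p [q [s [t ->]]]] := row4_eta v.
move=> /(_ (row4 1 0 0 0) (row4 1 0 0 0)); rewrite !mul_long => /row4_eq0[_ _ + _].
rewrite ?(mulr0, mul0r, mulr1, addr0, add0r) => ->.
by apply/rowP => -[[|[|[|[|//]]]] i]; rewrite !mxE /=; ring.
Qed.

Lemma null_squares_A4_14 : null_squares (presented A4_14).
Proof.
move=> v; have [p [q [s [t ->]]]] := row4_eta v.
move=> /(_ (row4 1 0 0 0) (row4 1 0 0 0)); rewrite !mul_long => /row4_eq0[_ _ _].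
rewrite ?(mulr0, mul0r, mulr1, addr0, add0r) => ->.
by apply/rowP => -[[|[|[|[|//]]]] i]; rewrite !mxE /=; ring.
Qed.

Lemma not_null_squares_A4_12 : ~ null_squares (presented A4_12).
Proof.
move=> /(_ (row4 0 0 1 0)); rewrite !mul_long => H.
have /row4_eq0[_ _ _] : row4 0 (0 * 0) 0 (0 * 0 + 0 * 0 + 0 * 1 + 1 * 1) = 0.
  apply: H => x y; have [? [? [? [? ->]]]] := row4_eta x.
  have [? [? [? [? ->]]]] := row4_eta y; rewrite !mul_long.
  by apply/rowP => -[[|[|[|[|//]]]] i]; rewrite !mxE /=; ring.
by rewrite ?(mulr0, mul0r, mulr1, addr0, add0r) => /eqP; rewrite oner_eq0.
Qed.

Lemma not_null_squares_A4_13 : ~ null_squares (presented A4_13).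
Proof.
move=> /(_ (row4 0 0 1 0)); rewrite !mul_long => H.
have /row4_eq0[_ _ _] : row4 0 (0 * 0) 0 (0 * 0 + 0 * 0 + 1 * 1) = 0.
  apply: H => x y; have [? [? [? [? ->]]]] := row4_eta x.
  have [? [? [? [? ->]]]] := row4_eta y; rewrite !mul_long.
  by apply/rowP => -[[|[|[|[|//]]]] i]; rewrite !mxE /=; ring.
by rewrite ?(mulr0, mul0r, mulr1, addr0, add0r) => /eqP; rewrite oner_eq0.
Qed.
End Long.

(** * Bilinear forms in three variables *)

Definition mx3 (R : Type) (a b c d e f g h i : R) : 'M[R]_3 :=
  \matrix_(r, s) nth a (nth [::] [:: [:: a; b; c]; [:: d; e; f]; [:: g; h; i]] r) s.

Section Mx3.
Variable F : fieldType.
Implicit Types (a b c d e f g h i : F) (M : 'M[F]_3).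

Lemma mx3_eta M : exists a b c d e f g h i, M = mx3 a b c d e f g h i.
Proof.
exists (M 0 0), (M 0 1), (M 0 2%:R), (M 1 0), (M 1 1), (M 1 2%:R),
  (M 2%:R 0), (M 2%:R 1), (M 2%:R 2%:R).
by apply/matrixP; do 2![case=> [[|[|[|//]]] ?]]; rewrite mxE /=;
  congr (M _ _); apply: val_inj.
Qed.

Lemma mx3_mul a b c d e f g h i a' b' c' d' e' f' g' h' i' :
  mx3 a b c d e f g h i *m mx3 a' b' c' d' e' f' g' h' i' =
  mx3 (a * a' + b * d' + c * g') (a * b' + b * e' + c * h') (a * c' + b * f' + c * i')
      (d * a' + e * d' + f * g') (d * b' + e * e' + f * h') (d * c' + e * f' + f * i')
      (g * a' + h * d' + i * g') (g * b' + h * e' + i * h') (g * c' + h * f' + i * i').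
Proof.
apply/matrixP; do 2![case=> [[|[|[|//]]] ?]];
by rewrite !mxE !big_ord_recl big_ord0 !mxE /= addr0 addrA.
Qed.

Lemma mx3_tr a b c d e f g h i :
  (mx3 a b c d e f g h i)^T = mx3 a d g b e h c f i.
Proof. by apply/matrixP; do 2![case=> [[|[|[|//]]] ?]]; rewrite !mxE. Qed.

Lemma mx3_scale r a b c d e f g h i : r *: mx3 a b c d e f g h i =
  mx3 (r * a) (r * b) (r * c) (r * d) (r * e) (r * f) (r * g) (r * h) (r * i).
Proof. by apply/matrixP; do 2![case=> [[|[|[|//]]] ?]]; rewrite !mxE. Qed.

Lemma mx3_det a b c d e f g h i : \det (mx3 a b c d e f g h i) =
  a * (e * i - f * h) - b * (d * i - f * g) + c * (d * h - e * g).
Proof.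
rewrite (expand_det_row _ 0) !big_ord_recl big_ord0 /cofactor.
rewrite !(expand_det_row _ 0) !big_ord_recl !big_ord0 /cofactor !det_mx11 !mxE /=.
by rewrite /bump /=; ring.
Qed.

Definition ts3 M := ts (fun _ : 'I_1 => M).

Lemma ts_ts3 (M : 'I_1 -> 'M_3) : alg_iso (ts M) (ts3 (M ord0)).
Proof.
have E : M =1 fun=> M ord0 by move=> l; rewrite ord1.
exact: ts_ext E.
Qed.

Lemma ts3_iso (P : 'M[F]_3) (r : F) M M' :
    \det P != 0 -> r != 0 -> P *m M *m P^T = r *: M' ->
  alg_iso (ts3 M) (ts3 M').
Proof.
move=> P0 r0 E; apply: alg_iso_sym; apply: (@ts_iso_intro _ _ _ _ _ P r%:M).
- by rewrite unitmxE unitfE.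
- by rewrite unitmxE unitfE det_scalar1.
by move=> l; rewrite big_ord1 E !ord1 mxE eqxx mulr1n.
Qed.

(** The rows [(p, q, s)], [(t, u, v)], [(w, x, y)] form the new basis, with determinant [D], and [r]
    is the factor split off the target form. [B] is the form of the source, abstracted together with
    its defining equation so that the nine conditions stay short until they are checked. *)
Lemma mx3_iso p q s t u v w x y r D a b c d e f g h i a' b' c' d' e' f' g' h' i' :
    (forall B : F -> F -> F -> F -> F -> F -> F,
    (forall x1 x2 x3 y1 y2 y3, B x1 x2 x3 y1 y2 y3 =
      x1 * (a * y1 + b * y2 + c * y3) + x2 * (d * y1 + e * y2 + f * y3)
      + x3 * (g * y1 + h * y2 + i * y3)) ->
    [/\ p * (u * y - v * x) - q * (t * y - v * w) + s * (t * x - u * w) = D,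
      D != 0 & r != 0] /\
    [/\ B p q s p q s = r * a', B p q s t u v = r * b' & B p q s w x y = r * c'] /\
    [/\ B t u v p q s = r * d', B t u v t u v = r * e' & B t u v w x y = r * f'] /\
    [/\ B w x y p q s = r * g', B w x y t u v = r * h' & B w x y w x y = r * i']) ->
  alg_iso (ts3 (mx3 a b c d e f g h i)) (ts3 (mx3 a' b' c' d' e' f' g' h' i')).
Proof.
pose B x1 x2 x3 y1 y2 y3 :=
      x1 * (a * y1 + b * y2 + c * y3) + x2 * (d * y1 + e * y2 + f * y3)
      + x3 * (g * y1 + h * y2 + i * y3).
move=> /(_ B (fun _ _ _ _ _ _ => erefl)).
move=> [[DE D0 r0] [[E1 E2 E3] [[E4 E5 E6] [E7 E8 E9]]]].
apply: (@ts3_iso (mx3 p q s t u v w x y) r) => //; first by rewrite mx3_det DE.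
rewrite mx3_tr !mx3_mul mx3_scale -E1 -E2 -E3 -E4 -E5 -E6 -E7 -E8 -E9 /B.
by congr mx3; ring.
Qed.

End Mx3.
Arguments ts3_iso {F} P r {M M'}.
Arguments mx3_iso {F} p q s t u v w x y r D {a b c d e f g h i a' b' c' d' e' f' g' h' i'}.

Ltac mx3_check conds :=
  let B := fresh "B" in let BE := fresh "BE" in
  move=> B BE; rewrite !{}BE; split; [|split; [|split]]; split;
  first [by field; conds
        | by rewrite ?(mulf_neq0, expf_neq0, invr_neq0, oner_neq0, oppr_eq0) //; conds].

(* The tag is the second index of the algebra A_{4,tag} presented by the form,
   with 17 standing for A_{4,9}^{delta,1/4}. *)
Definition form3 (F : fieldType) (c : nat * F) : 'M[F]_3 :=
  let delta := c.2 in
  match c.1 with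
  | 2 => mx3 1 0 0 0 0 0 0 0 0
  | 3 => mx3 1 0 0 0 delta 0 0 0 0
  | 4 => mx3 1 1 0 0 delta 0 0 0 0
  | 5 => mx3 0 1 0 (-1) 0 0 0 0 0
  | 7 => mx3 1 0 0 0 0 1 0 (-1) 0
  | 8 => mx3 1 0 0 0 1 0 0 0 1
  | 9 => mx3 1 0 0 0 1 1 0 0 delta
  | 10 => mx3 1 1 0 0 0 1 0 1 0
  | 11 => mx3 1 1 0 0 0 0 0 1 (-1)
  | 17 => mx3 delta 0 0 0 1 1 0 0 4^-1
  | _ => 0
  end.

Definition valid3 (F : fieldType) (eta : F) (c : nat * F) : bool :=
  let delta := c.2 in
  match c.1 with
  | 2 | 5 | 7 | 8 | 10 | 11 => delta == 0
  | 3 | 17 => (delta == 1) || (delta == eta)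
  | 4 => true
  | 9 => delta != 4^-1
  | _ => false
  end.

(* Closes an equation that is [c] times the equation [H]. *)
Ltac lincomb H c conds :=
  match type of H with ?l = ?r =>
    apply/eqP; rewrite -subr_eq0; apply/eqP; transitivity (c * (l - r));
    [by field; conds | by rewrite H subrr mulr0] end.

(** * Normal forms of one form in three variables *)

Section Forms3.
#[local] Opaque mx3 ts3.
Variables (F : fieldType) (eta : F).
Hypothesis two_neq0 : 2%:R != 0 :> F.
Hypothesis sq_class : forall x : F, x != 0 ->
  exists2 k, k != 0 & x = k ^+ 2 \/ x = eta * k ^+ 2.
Hypothesis sum2sq : forall x y : F, x != 0 -> y != 0 ->
  exists u v, x * u ^+ 2 + y * v ^+ 2 = 1.
Hypothesis eta_neq0 : eta != 0.

Lemma alg3_sym_pivot (a b c d e f : F) : a != 0 ->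
  alg_iso (ts3 (mx3 a b c b d e c e f))
    (ts3 (mx3 a 0 0 0 (d - b ^+ 2 / a) (e - b * c / a) 0 (e - b * c / a) (f - c ^+ 2 / a))).
Proof.
move=> a0; apply: (mx3_iso 1 0 0 (- b / a) 1 0 (- c / a) 0 1 1 1).
mx3_check ltac:(rewrite ?a0).
Qed.

(** Diagonalisation in odd characteristic, with zero entries moved to the end, which is what
    [y = 0 -> z = 0] records. If the diagonal vanishes, adding one basis vector to another turns an
    entry [b] into a pivot [2 b]. *)
Lemma alg3_diag (a b c d e f : F) : mx3 a b c b d e c e f != 0 ->
  exists x y z : F, [/\ x != 0, y = 0 -> z = 0 &
    alg_iso (ts3 (mx3 a b c b d e c e f)) (ts3 (mx3 x 0 0 0 y 0 0 0 z))].
Proof.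
have blk (x y y' z : F) : x != 0 -> exists s t : F, [/\ s = 0 -> t = 0 &
    alg_iso (ts3 (mx3 x 0 0 0 y y' 0 y' z)) (ts3 (mx3 x 0 0 0 s 0 0 0 t))].
  move=> x0; have piv (u v w : F) : u != 0 -> exists s t : F, [/\ s = 0 -> t = 0 &
      alg_iso (ts3 (mx3 x 0 0 0 u v 0 v w)) (ts3 (mx3 x 0 0 0 s 0 0 0 t))].
    move=> u0; exists u, (w - v ^+ 2 / u); split; first by move/eqP; rewrite (negPf u0).
    apply: (mx3_iso 1 0 0 0 1 0 0 (- v / u) 1 1 1); mx3_check ltac:(rewrite ?u0).
  have [y0|] := eqVneq y 0; last exact: piv.
  have [z0|z0] := eqVneq z 0; last first.
    have [s [t [st I]]] := piv z y' y z0; exists s, t; split; first exact: st.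
    apply: alg_iso_trans I; apply: (mx3_iso 1 0 0 0 0 1 0 1 0 1 (-1)).
    mx3_check ltac:(rewrite ?oner_neq0).
  have [y'0|y'0] := eqVneq y' 0.
    by exists 0, 0; rewrite y0 z0 y'0; split; [by [] | exact: alg_iso_refl].
  have y20 : y' *+ 2 != 0 by rewrite -mulr_natr mulf_neq0.
  have [s [t [st I]]] := piv (y' *+ 2) y' z y20.
  exists s, t; split; first exact: st.
  apply: alg_iso_trans I; apply: (mx3_iso 1 0 0 0 1 1 0 0 1 1 1).
  rewrite y0 z0; mx3_check ltac:(rewrite ?oner_neq0).
have diag (u1 u2 u3 u4 u5 u6 : F) : u1 != 0 -> exists x y z : F, [/\ x != 0, y = 0 -> z = 0 &
    alg_iso (ts3 (mx3 u1 u2 u3 u2 u4 u5 u3 u5 u6)) (ts3 (mx3 x 0 0 0 y 0 0 0 z))].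
  move=> u0; have [s [t [st I]]] := blk u1 (u4 - u2 ^+ 2 / u1) (u5 - u2 * u3 / u1) (u6 - u3 ^+ 2 / u1) u0.
  exists u1, s, t; split; [exact: u0 | exact: st |]; apply: alg_iso_trans I; exact: alg3_sym_pivot.
have [a0|a0] := eqVneq a 0; last by move=> _; apply: diag.
have step (M M' : 'M[F]_3) : alg_iso (ts3 M') (ts3 M) ->
  (exists x y z : F, [/\ x != 0, y = 0 -> z = 0 &
    alg_iso (ts3 M) (ts3 (mx3 x 0 0 0 y 0 0 0 z))]) ->
  (exists x y z : F, [/\ x != 0, y = 0 -> z = 0 &
    alg_iso (ts3 M') (ts3 (mx3 x 0 0 0 y 0 0 0 z))]).
  move=> I [x [y [z [x0 yz J]]]]; exists x, y, z; split; [exact: x0 | exact: yz | exact: alg_iso_trans J].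
have [d0|d0] := eqVneq d 0; last first.
  move=> _; apply: step (diag _ b e a c f d0).
  apply: (mx3_iso 0 1 0 1 0 0 0 0 1 1 (-1)); mx3_check ltac:(rewrite ?oner_neq0).
have [f0|f0] := eqVneq f 0; last first.
  move=> _; apply: step (diag _ e c d b a f0).
  apply: (mx3_iso 0 0 1 0 1 0 1 0 0 1 (-1)); mx3_check ltac:(rewrite ?oner_neq0).
rewrite {}a0 {}d0 {}f0.
have [b0|b0] := eqVneq b 0; last first.
  move=> _; apply: (step (mx3 (b *+ 2) b (c + e) b 0 e (c + e) e 0)); last first.
    by apply: diag; rewrite -mulr_natr mulf_neq0.
  apply: (mx3_iso 1 1 0 0 1 0 0 0 1 1 1); mx3_check ltac:(rewrite ?oner_neq0).
have [c0|c0] := eqVneq c 0; last first.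
  move=> _; apply: (step (mx3 (c *+ 2) (b + e) c (b + e) 0 e c e 0)); last first.
    by apply: diag; rewrite -mulr_natr mulf_neq0.
  apply: (mx3_iso 1 0 1 0 1 0 0 0 1 1 1); mx3_check ltac:(rewrite ?oner_neq0).
have [e0|e0] := eqVneq e 0; last first.
  move=> _; apply: (step (mx3 (e *+ 2) (b + c) e (b + c) 0 c e c 0)); last first.
    by apply: diag; rewrite -mulr_natr mulf_neq0.
  apply: (mx3_iso 0 1 1 1 0 0 0 0 1 1 (-1)); mx3_check ltac:(rewrite ?oner_neq0).
by case/eqP; apply/matrixP; do 2![case=> [[|[|[|//]]] ?]]; rewrite !mxE.
Qed.

Definition normalizes3 (M : 'M[F]_3) :=
  exists c, valid3 eta c /\ alg_iso (ts3 M) (ts3 (form3 c)).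

Lemma normalizes3_iso (M M' : 'M[F]_3) :
  alg_iso (ts3 M) (ts3 M') -> normalizes3 M' -> normalizes3 M.
Proof. by move=> I [c [vc J]]; exists c; split; [exact: vc | exact: alg_iso_trans J]. Qed.

(** Scaling a form of rank [n] by [r] multiplies its discriminant by [r^n]. Hence two classes in
    rank two, and a single one in ranks one and three. *)
Lemma normalizes3_diag (x y z : F) : x != 0 -> (y = 0 -> z = 0) ->
  normalizes3 (mx3 x 0 0 0 y 0 0 0 z).
Proof.
move=> x0 yz; have [y0|y0] := eqVneq y 0.
  exists (2, 0); split; first exact: eqxx.
  rewrite yz // y0; apply: (mx3_iso 1 0 0 0 1 0 0 0 1 x 1); mx3_check ltac:(rewrite ?x0).
have [z0|z0] := eqVneq z 0.
  rewrite {}z0 {yz}; have [k k0 E] := sq_class (mulf_neq0 y0 (invr_neq0 x0)).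
  have {}E : y = x * k ^+ 2 \/ y = x * (eta * k ^+ 2).
    by case: E => E; [left | right]; rewrite -E mulrC divfK.
  case: E => -> {y y0}.
    exists (3, 1); rewrite /valid3 /form3 /= eqxx; split; first by [].
    apply: (mx3_iso 1 0 0 0 k^-1 0 0 0 1 x k^-1); mx3_check ltac:(rewrite ?x0 ?k0).
  exists (3, eta); rewrite /valid3 /form3 /= eqxx orbT; split; first by [].
  apply: (mx3_iso 1 0 0 0 k^-1 0 0 0 1 x k^-1); mx3_check ltac:(rewrite ?x0 ?k0).
exists (8, 0); split; first exact: eqxx.
pose y' := y / x; pose z' := z / x.
have y'0 : y' != 0 by rewrite mulf_neq0 ?invr_neq0.
have z'0 : z' != 0 by rewrite mulf_neq0 ?invr_neq0.
(* As [<y', z'>] represents 1, it is equivalent to [<1, y' z'>]; the vector [(- z' v, y' u)] is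
   orthogonal to [(u, v)]. *)
have [u [v uv]] := sum2sq y'0 z'0.
apply: alg_iso_trans (_ : alg_iso _ (ts3 (mx3 1 0 0 0 1 0 0 0 (y' * z')))) _.
  have -> : y = x * y' by rewrite mulrC divfK.
  have -> : z = x * z' by rewrite mulrC divfK.
  apply: (mx3_iso 1 0 0 0 u v 0 (- z' * v) (y' * u) x 1) => B BE; rewrite !{}BE.
  split; [|split; [|split]]; split; rewrite ?x0 ?oner_neq0 //; try by ring.
  - by lincomb uv (1 : F) idtac.
  - by lincomb uv x idtac.
  - by lincomb uv (x * y' * z') idtac.
have [k k0 [->|->]] := sq_class (mulf_neq0 y'0 z'0).
  apply: (mx3_iso 1 0 0 0 1 0 0 0 k^-1 1 k^-1); mx3_check ltac:(rewrite ?k0).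
(* Since [p^2 + q^2 = eta^-1], the form [<1, 1>] is equivalent to [<eta^-1, eta^-1>], and
   [<1, 1, eta k^2>] becomes [eta^-1] times a sum of three squares. *)
have [p [q pq]] := sum2sq eta_neq0 eta_neq0.
apply: (mx3_iso p q 0 (- q) p 0 0 0 (eta * k)^-1 eta^-1 (eta ^+ 2 * k)^-1) => B BE.
rewrite !{}BE; split; [|split; [|split]]; split; try by ring.
- by lincomb pq ((eta ^+ 2 * k)^-1) ltac:(rewrite ?k0 ?eta_neq0).
- by rewrite invr_neq0 // mulf_neq0 // expf_neq0.
- by rewrite invr_neq0.
- by lincomb pq (eta^-1) ltac:(rewrite ?k0 ?eta_neq0).
- by lincomb pq (eta^-1) ltac:(rewrite ?k0 ?eta_neq0).
- by field; rewrite ?k0 ?eta_neq0.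
Qed.

Lemma normalizes3_blk (a b d e g : F) : b != d ->
  normalizes3 (mx3 a b 0 d e 0 0 0 g).
Proof.
have four0 : 4%:R != 0 :> F.
  by rewrite -[4%N]/(2 * 2)%N natrM mulf_neq0.
have piv (a' b' d' e' : F) : a' != 0 -> b' != d' -> normalizes3 (mx3 a' b' 0 d' e' 0 0 0 g).
  move=> a0 bd; pose w := b' - d'; have w0 : w != 0 by rewrite subr_eq0.
  have bE : b' = d' + w by rewrite addrC subrK.
  (* The determinant of the block over the square of its alternating part does not change under
     congruence and scaling. *)
  pose s := (a' * e' - b' * d') / w ^+ 2; pose h := g / a'.
  apply: (@normalizes3_iso _ (mx3 1 1 0 0 s 0 0 0 h)).
    rewrite /s /h bE.
    apply: (mx3_iso 1 0 0 (- d' / w) (a' / w) 0 0 0 1 a' (a' / w)).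
    mx3_check ltac:(rewrite ?a0 ?w0).
  have [h0|h0] := eqVneq h 0.
    by rewrite h0; exists (4, s); split; [by [] | exact: alg_iso_refl].
  (* The block has the quadratic form [u^2 + u v + s v^2 = (u + v / 2)^2 + (s - 1/4) v^2]. For
     [s = 1/4] it represents only squares and the class of [h] remains; otherwise it represents [h],
     which can then be scaled away. *)
  have [s4|s4] := eqVneq s 4^-1.
    rewrite {}s4; have [k k0 [->|->]] := sq_class h0.
      exists (17, 1); rewrite /valid3 /form3 /= eqxx; split; first by [].
      apply: (mx3_iso 0 0 k^-1 1 0 0 0 1 0 1 k^-1); mx3_check ltac:(rewrite ?k0 ?four0).
    exists (17, eta); rewrite /valid3 /form3 /= eqxx orbT; split; first by [].
    apply: (mx3_iso 0 0 k^-1 1 0 0 0 1 0 1 k^-1); mx3_check ltac:(rewrite ?k0 ?four0).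
  exists (9, s); split; [exact: s4 | rewrite /form3 /=].
  have s40 : (s - 4^-1) / h != 0 by rewrite mulf_neq0 ?invr_neq0 ?subr_eq0.
  have [p [q pq]] := sum2sq (invr_neq0 h0) s40.
  pose v := q; pose u := p - q / 2%:R.
  have uv : u ^+ 2 + u * v + s * v ^+ 2 = h.
    rewrite /u /v; by lincomb pq h ltac:(rewrite ?h0 ?two_neq0 ?four0).
  move: u v uv => u v uv {pq}.
  apply: (mx3_iso 0 0 1 u v 0 (- s * v) (u + v) 0 h h) => B BE; rewrite !{}BE.
  split; [|split; [|split]]; split=> //; try by ring.
  - by lincomb uv (1 : F) idtac.
  - by lincomb uv (1 : F) idtac.
  - by lincomb uv (1 : F) idtac.
  - by lincomb uv s idtac.
move=> bd; have [a0|a0] := eqVneq a 0; last exact: piv.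
have [e0|e0] := eqVneq e 0; last first.
  apply: normalizes3_iso (piv e d b a e0 _); last by rewrite eq_sym.
  apply: (mx3_iso 0 1 0 1 0 0 0 0 1 1 (-1)); mx3_check ltac:(rewrite ?oner_neq0).
have [bd0|bd0] := eqVneq (b + d) 0; last first.
  apply: normalizes3_iso (piv (b + d) b d 0 bd0 bd).
  rewrite a0 e0.
  apply: (mx3_iso 1 1 0 0 1 0 0 0 1 1 1); mx3_check ltac:(rewrite ?oner_neq0).
rewrite {}a0 {}e0; have dE : d = - b by apply/eqP; rewrite -addr_eq0 addrC bd0.
have b0 : b != 0 by apply: contra bd => /eqP b0; rewrite dE b0 oppr0.
rewrite {}dE.
have [->|g0] := eqVneq g 0.
  exists (5, 0); split; first exact: eqxx.
  apply: (mx3_iso 1 0 0 0 1 0 0 0 1 b 1); mx3_check ltac:(rewrite ?b0).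
exists (7, 0); split; first exact: eqxx.
apply: (mx3_iso 0 0 1 1 0 0 0 (g / b) 0 g (g / b)); mx3_check ltac:(rewrite ?b0 ?g0).
Qed.

(** The third vector spans the radical of the alternating part, is isotropic, and is paired with the
    second one by [f]. This pairing clears everything but the upper left entry and the alternating
    part [w]; the entry being zero or not gives [A4_11] or [A4_10]. *)
Lemma normalizes3_isotropic (a b c d e f : F) : b != d -> f != 0 ->
  normalizes3 (mx3 a b c d e f c f 0).
Proof.
move=> bd f0; pose w := b - d; have w0 : w != 0 by rewrite subr_eq0.
have bE : b = d + w by rewrite addrC subrK.
move: w w0 bE => w w0 -> {bd}.
pose a' := a - (c / f) * (d + d + w) + (c / f) ^+ 2 * e.
apply: (@normalizes3_iso _ (mx3 a' (d - c / f * e + w) 0 (d - c / f * e) e f 0 f 0)).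
  rewrite /a'; apply: (mx3_iso 1 (- c / f) 0 0 1 0 0 0 1 1 1).
  mx3_check ltac:(rewrite ?f0).
move: a' (d - c / f * e) => {a d}a d.
apply: (@normalizes3_iso _ (mx3 a w 0 0 0 f 0 f 0)).
  apply: (mx3_iso 1 0 (- d / f) 0 1 (- e / (2%:R * f)) 0 0 1 1 1).
  mx3_check ltac:(rewrite ?f0 ?two_neq0).
have [->|a0] := eqVneq a 0.
  exists (11, 0); split; first exact: eqxx.
  apply: alg_iso_trans (_ : alg_iso _ (ts3 (mx3 0 (-1) 0 0 0 1 0 1 0))) _.
    apply: (mx3_iso (- w^-1) 0 0 0 1 0 0 0 f^-1 1 (- (w * f)^-1)).
    mx3_check ltac:(rewrite ?f0 ?w0).
  apply: alg_iso_sym.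
  apply: (mx3_iso (-1) 1 1 2%:R^-1 0 2%:R^-1 1 0 (-1) 1 1).
  mx3_check ltac:(rewrite ?two_neq0).
exists (10, 0); split; first exact: eqxx.
apply: (mx3_iso 1 0 0 0 (a / w) 0 0 0 (w / f) a (a / f)).
mx3_check ltac:(rewrite ?f0 ?w0 ?a0).
Qed.

Lemma normalizes3_all (M : 'M[F]_3) : M != 0 -> normalizes3 M.
Proof.
have ker (a b c d e f g h i : F) : b != d -> normalizes3 (mx3 a b c d e f g h i).
  (* The vector [(k1, k2, k3)] spans the radical of the alternating part. Taken as third basis
     vector, it splits off unless it is isotropic. *)
  move=> bd; pose k1 := f - h; pose k2 := g - c; pose k3 := b - d.
  have k30 : k3 != 0 by rewrite subr_eq0.
  pose c' := a * k1 + b * k2 + c * k3; pose f' := d * k1 + e * k2 + f * k3.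
  pose n := k1 * c' + k2 * f' + k3 * (g * k1 + h * k2 + i * k3).
  apply: (@normalizes3_iso _ (mx3 a b c' d e f' c' f' n)).
    rewrite /n /c' /f' /k1 /k2; apply: (mx3_iso 1 0 0 0 1 0 (f - h) (g - c) k3 1 k3).
    rewrite /k3 in k30 *; mx3_check ltac:(rewrite ?k30).
  move: c' f' n => {}c {}f {}g {h i k1 k2 k3 k30}.
  have [g0|g0] := eqVneq g 0; last first.
    apply: (@normalizes3_iso _ (mx3 (a - c ^+ 2 / g) (b - c * f / g) 0
       (d - c * f / g) (e - f ^+ 2 / g) 0 0 0 g)); last first.
      by apply: normalizes3_blk; rewrite (inj_eq (addIr _)).
    apply: (mx3_iso 1 0 (- c / g) 0 1 (- f / g) 0 0 1 1 1).
    mx3_check ltac:(rewrite ?g0).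
  rewrite {}g0; have [f0|f0] := eqVneq f 0; last exact: normalizes3_isotropic.
  have [c0|c0] := eqVneq c 0; first by rewrite f0 c0; apply: normalizes3_blk.
  apply: (@normalizes3_iso _ (mx3 e d f b a c f c 0)).
    apply: (mx3_iso 0 1 0 1 0 0 0 0 1 1 (-1)); mx3_check ltac:(rewrite ?oner_neq0).
  by apply: normalizes3_isotropic; rewrite // eq_sym.
have [a [b [c [d [e [f [g [h [i ->]]]]]]]]] := mx3_eta M.
have [db|bd] := eqVneq d b; last by move=> _; apply: ker; rewrite eq_sym.
have [gc|cg] := eqVneq g c; last first.
  move=> _; apply: (@normalizes3_iso _ (mx3 a c b g i h d f e)).
    apply: (mx3_iso 1 0 0 0 0 1 0 1 0 1 (-1)); mx3_check ltac:(rewrite ?oner_neq0).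
  by apply: ker; rewrite eq_sym.
have [hf|fh] := eqVneq h f; last first.
  move=> _; apply: (@normalizes3_iso _ (mx3 i h g f e d c b a)).
    apply: (mx3_iso 0 0 1 0 1 0 1 0 0 1 (-1)); mx3_check ltac:(rewrite ?oner_neq0).
  exact: ker.
rewrite db gc hf => /alg3_diag[x [y [z [x0 yz I]]]].
exact: normalizes3_iso I (normalizes3_diag x0 yz).
Qed.
End Forms3.

(** * Invariants of one form in three variables *)

Section Invariants3.
Variable F : fieldType.
Implicit Types (M P : 'M[F]_3).

Lemma mx3_adj (a b c d e f g h i : F) : \adj (mx3 a b c d e f g h i) =
  mx3 (e * i - f * h) (c * h - b * i) (b * f - c * e)
      (f * g - d * i) (a * i - c * g) (c * d - a * f)
      (d * h - e * g) (b * g - a * h) (a * e - b * d).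
Proof.
apply/matrixP; do 2![case=> [[|[|[|//]]] ?]];
rewrite !mxE /cofactor !(expand_det_row _ 0) !big_ord_recl !big_ord0 /cofactor;
by rewrite !det_mx11 !mxE /= /bump /=; ring.
Qed.

Lemma mx3_add (a b c d e f g h i a' b' c' d' e' f' g' h' i' : F) :
  mx3 a b c d e f g h i + mx3 a' b' c' d' e' f' g' h' i' =
  mx3 (a + a') (b + b') (c + c') (d + d') (e + e') (f + f') (g + g') (h + h') (i + i').
Proof. by apply/matrixP; do 2![case=> [[|[|[|//]]] ?]]; rewrite !mxE. Qed.

Lemma mx3_opp (a b c d e f g h i : F) : - mx3 a b c d e f g h i =
  mx3 (- a) (- b) (- c) (- d) (- e) (- f) (- g) (- h) (- i).
Proof. by apply/matrixP; do 2![case=> [[|[|[|//]]] ?]]; rewrite !mxE. Qed.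

Lemma mx3_inj (a b c d e f g h i a' b' c' d' e' f' g' h' i' : F) :
  mx3 a b c d e f g h i = mx3 a' b' c' d' e' f' g' h' i' ->
  [/\ a = a', b = b' & c = c'] /\ [/\ d = d', e = e' & f = f'] /\
  [/\ g = g', h = h' & i = i'].
Proof.
move=> E; have D r s := congr1 (fun M : 'M_3 => M r s) E.
by split; [split | split; split]; [have := D 0 0 | have := D 0 1 | have := D 0 2%:R
  | have := D 1 0 | have := D 1 1 | have := D 1 2%:R
  | have := D 2%:R 0 | have := D 2%:R 1 | have := D 2%:R 2%:R]; rewrite !mxE.
Qed.

Lemma mx3_eq0 (a b c d e f g h i : F) : (mx3 a b c d e f g h i == 0) =
  [&& a == 0, b == 0, c == 0, d == 0, e == 0, f == 0, g == 0, h == 0 & i == 0].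
Proof.
have z : 0 = mx3 0 0 0 0 0 0 0 0 0 :> 'M[F]_3.
  by apply/matrixP; do 2![case=> [[|[|[|//]]] ?]]; rewrite !mxE.
apply/eqP/idP => [|/and5P[/eqP-> /eqP-> /eqP-> /eqP-> /and5P[/eqP-> /eqP-> /eqP-> /eqP-> /eqP->]] //].
by rewrite z => /mx3_inj[[-> -> ->] [[-> -> ->] [-> -> ->]]]; rewrite eqxx.
Qed.

(** Checked on entries, so that singular matrices are included; for invertible ones this is the rule
    for inverses. *)
Lemma adj_mul3 M P : \adj (M *m P) = \adj P *m \adj M.
Proof.
have [a [b [c [d [e [f [g [h [i ->]]]]]]]]] := mx3_eta M.
have [a' [b' [c' [d' [e' [f' [g' [h' [i' ->]]]]]]]]] := mx3_eta P.
by rewrite mx3_mul !mx3_adj mx3_mul; congr mx3; ring.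
Qed.

(* Separates the families of form3; the branches are named by their tags. *)
Definition code3 M : nat :=
  let S := M + M^T in let A := M - M^T in
  if A == 0 then if \adj M == 0 then 2 else if \det M == 0 then 3 else 8
  else if S == 0 then 5
  else if \det S != 0 then if \det S == 8%:R * \det M then 10 else 9
  else if \det M != 0 then if \adj S == 0 then 7 else 17
  else if \adj M *m A == 0 then 4 else 11.

Lemma congr_eq0 P M : P \in unitmx -> (P *m M *m P^T == 0) = (M == 0).
Proof.
move=> Pu; apply/eqP/eqP => [E|->]; last by rewrite mulmx0 mul0mx.
have PTu : P^T \in unitmx by rewrite unitmx_tr.
by rewrite -[M](mulKmx Pu) -[P *m M](mulmxK PTu) E mul0mx mulmx0.
Qed.

Lemma unitmx_adj P : P \in unitmx -> \adj P \in unitmx.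
Proof.
move=> Pu; have d0 : \det P != 0 by rewrite -unitfE -unitmxE.
have: (P *m \adj P) \in unitmx by rewrite mul_mx_adj unitmxE det_scalar unitfE expf_neq0.
by rewrite unitmx_mul => /andP[].
Qed.

(** Symmetric and alternating parts follow the congruence, determinants acquire [det P^2], and
    adjugates follow the congruence by [(adj P)^T]. With the entries of [M - M^T] arranged as a
    vector [k] of its radical, [8 det M = det S + k S k^T]; so comparing [det S] with [8 det M]
    tests whether [k] is isotropic. *)
Lemma code3_congr P M : P \in unitmx -> code3 (P *m M *m P^T) = code3 M.
Proof.
move=> Pu; rewrite /code3; set N := P *m M *m P^T.
have NT : N^T = P *m M^T *m P^T by rewrite /N !trmx_mul trmxK mulmxA.
have SE : N + N^T = P *m (M + M^T) *m P^T by rewrite NT -mulmxDl -mulmxDr.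
have AE : N - N^T = P *m (M - M^T) *m P^T by rewrite NT -mulmxBl -mulmxBr.
have adjE K : \adj (P *m K *m P^T) = (\adj P)^T *m \adj K *m (\adj P)^T^T.
  by rewrite !adj_mul3 trmxK -trmx_adj mulmxA.
have au : (\adj P)^T \in unitmx by rewrite unitmx_tr unitmx_adj.
have d0 : \det P != 0 by rewrite -unitfE -unitmxE.
have detE K : \det (P *m K *m P^T) = \det P ^+ 2 * \det K.
  by rewrite !det_mulmx det_tr; ring.
rewrite SE AE !detE !adjE !congr_eq0 // !mulf_eq0 /= (negPf d0) /=.
rewrite [8%:R * _]mulrCA (inj_eq (mulfI (expf_neq0 2 d0))).
rewrite trmxK.
have -> : (\adj P)^T *m \adj M *m \adj P *m (P *m (M - M^T) *m P^T) =
    \det P *: ((\adj P)^T *m (\adj M *m (M - M^T)) *m P^T).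
  rewrite !mulmxA -(mulmxA _ (\adj P) P) mul_adj_mx mul_mx_scalar.
  by rewrite -!scalemxAl.
rewrite scaler_eq0 (negPf d0) /=.
have -> K : ((\adj P)^T *m K *m P^T == 0) = (K == 0).
  apply/eqP/eqP => [E|->]; last by rewrite mulmx0 mul0mx.
  have PTu : P^T \in unitmx by rewrite unitmx_tr.
  by rewrite -[K](mulKmx au) -[_ *m K](mulmxK PTu) E mul0mx mulmx0.
by [].
Qed.

Lemma code3_scale (r : F) M : r != 0 -> code3 (r *: M) = code3 M.
Proof.
move=> r0; rewrite /code3 linearZ /= -scalerDr -scalerBr !scaler_eq0 (negPf r0) /=.
rewrite !adjZ !detZ -scalemxAl -scalemxAr !scaler_eq0 !mulf_eq0 /= (negPf r0) /=.
by rewrite [8%:R * _]mulrCA (inj_eq (mulfI (expf_neq0 3 r0))).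
Qed.

Lemma ts3_iso_congr M M' : M != 0 -> alg_iso (ts3 M) (ts3 M') ->
  exists P r, [/\ P \in unitmx, r != 0 & P *m M' *m P^T = r *: M].
Proof.
move=> M0 /ts_iso_elim[|P [R [Pf Rf E]]].
  move=> w; rewrite big_ord1 => /eqP; rewrite scaler_eq0 (negPf M0) orbF => /eqP w0.
  by apply/rowP => j; rewrite ord1 w0 mxE.
exists P, (R ord0 ord0); split; last by rewrite (E ord0) big_ord1.
  by rewrite -row_full_unit.
move: Rf; rewrite row_free_unit unitmxE det_mx11 unitfE; exact.
Qed.

Hypothesis two_neq0 : 2%:R != 0 :> F.
Variable eta : F.
Hypothesis eta_nsq : forall s : F, s ^+ 2 != eta.

Lemma code3_form3 c : valid3 eta c -> code3 (form3 c) = c.1.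
Proof.
have four0 : 4%:R != 0 :> F.
  by rewrite -[4%N]/(2 * 2)%N natrM mulf_neq0.
have eta0 : eta != 0 by have := eta_nsq 0; rewrite expr0n eq_sym.
have sd (d : F) : (d == 1) || (d == eta) -> d != 0.
  by case/orP => /eqP->; rewrite ?oner_neq0.
case: c => n d; rewrite /valid3 /form3 /code3 /=.
do 18?[case: n => [|n] //].
all: rewrite ?mx3_tr ?mx3_opp ?mx3_add ?mx3_adj ?mx3_mul ?mx3_det ?mx3_eq0.
all: rewrite ?(mulr0, mul0r, subr0, addr0, add0r, sub0r, mulr1, mul1r, subrr, oppr0, addNr, eqxx, mulrN1, mulN1r, opprK, mulrN, mulNr, opprD) /=.
all: have two2 : 1 + 1 = 2%:R :> F by [].
all: rewrite ?two2 ?(oner_eq0, oppr_eq0, negPf two_neq0, mulrBr, mulrDr) //=.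
all: try by move/sd/negPf->.
- move=> d4; rewrite (_ : _ - _ = 2%:R * 4%:R * (d - 4^-1)); last by field; rewrite ?four0.
  rewrite !mulf_neq0 ?subr_eq0 //= -subr_eq0.
  rewrite (_ : _ - _ = - 2%:R); last by field; rewrite ?four0.
  by rewrite oppr_eq0 (negPf two_neq0).
- move=> _; rewrite (_ : _ + _ = 2%:R * 4%:R); last by ring.
  by rewrite mulf_neq0 //=; case: eqP => [|[]] //; ring.
- move=> /sd d0; rewrite (_ : (d + d) * (2%:R / 4%:R) + _ - _ = 0); last by field; rewrite ?four0.
  rewrite eqxx /= mulf_neq0 ?invr_neq0 // -opprD oppr_eq0.
  have -> : (d + d == 0) = false.
    by rewrite -mulr2n -mulr_natr mulf_eq0 (negPf d0) (negPf two_neq0).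
  by rewrite /= !andbF.
Qed.

End Invariants3.

Section Injective3.
Variables (F : fieldType) (eta : F).
Hypothesis two_neq0 : 2%:R != 0 :> F.
Hypothesis eta_nsq : forall s : F, s ^+ 2 != eta.

(** A quotient of 1 and [eta] is never a square. The lemma is applied to [xi] in place of [eta] as
    well. *)
Lemma sq_class_inj (d d' q r : F) : r != 0 ->
    (d == 1) || (d == eta) -> (d' == 1) || (d' == eta) ->
  d' * q ^+ 2 = r ^+ 2 * d -> d = d'.
Proof.
move=> r0 /orP[]/eqP-> /orP[]/eqP-> //; rewrite ?mul1r ?mulr1 => E.
  have q0 : q != 0.
    apply/eqP => q0; move: (esym E); rewrite q0 expr0n !mulr0 => /eqP.
    by rewrite sqrf_eq0 (negPf r0).
  by case/eqP: (eta_nsq (r / q)); rewrite expr_div_n -E mulfK ?expf_neq0.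
by case/eqP: (eta_nsq (q / r)); rewrite expr_div_n E mulrC mulKf ?expf_neq0.
Qed.

Lemma form3_neq0 c : valid3 eta c -> form3 c != 0.
Proof.
case: c => n d; rewrite /valid3 /form3 /=.
by do 18?[case: n => [|n] //]; rewrite mx3_eq0 ?(oner_eq0, oppr_eq0, andbF) //= andbF.
Qed.

(** [code3] recovers the tag. The parameter is read off from [adj M] for tag 3, from [adj M] against
    [adj (M - M^T)] for 4, from [det M] against [det (M + M^T)] for 9, and from [adj (M + M^T)] for
    17. *)
Lemma form3_inj c c' : valid3 eta c -> valid3 eta c' ->
  alg_iso (ts3 (form3 c)) (ts3 (form3 c')) -> c = c'.
Proof.
have four0 : 4%:R != 0 :> F.
  by rewrite -[4%N]/(2 * 2)%N natrM mulf_neq0.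
move=> vc vc' /(ts3_iso_congr (form3_neq0 vc))[P [r [Pu r0 E]]].
have tags : c.1 = c'.1.
  rewrite -(code3_form3 two_neq0 eta_nsq vc) -(code3_form3 two_neq0 eta_nsq vc').
  by rewrite -[RHS](code3_congr _ Pu) E code3_scale.
have adjE K K' : P *m K' *m P^T = r *: K -> (\adj P)^T *m \adj K' *m \adj P = r ^+ 2 *: \adj K.
  by move=> /(congr1 (fun N => \adj N)); rewrite adjZ !adj_mul3 -trmx_adj mulmxA.
have detE K K' : P *m K' *m P^T = r *: K -> \det P ^+ 2 * \det K' = r ^+ 3 * \det K.
  by move=> /(congr1 determinant); rewrite detZ !det_mulmx det_tr => <-; ring.
have ET := congr1 trmx E; rewrite !trmx_mul trmxK mulmxA linearZ /= in ET.
have SE : P *m (form3 c' + (form3 c')^T) *m P^T = r *: (form3 c + (form3 c)^T).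
  by rewrite mulmxDr mulmxDl E ET scalerDr.
have AE : P *m (form3 c' - (form3 c')^T) *m P^T = r *: (form3 c - (form3 c)^T).
  by rewrite mulmxBr mulmxBl E ET scalerBr.
move: (adjE _ _ E) (adjE _ _ SE) (adjE _ _ AE) (detE _ _ E) (detE _ _ SE).
have [q1 [q2 [q3 [q4 [q5 [q6 [q7 [q8 [q9 ->]]]]]]]]] := mx3_eta (\adj P).
move: (\det P) => D.
move: c c' vc vc' tags {E ET SE AE adjE detE} => [n d] [m d'] + + /= nm; rewrite -{}nm {m}.
rewrite /valid3 /form3 /=.
do 18?[case: n => [|n] //].
all: try by move=> /eqP-> /eqP->.
all: rewrite ?mx3_tr ?mx3_opp ?mx3_add ?mx3_adj ?mx3_mul ?mx3_scale ?mx3_det.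
- move=> v v' /mx3_inj[_ [_ [_ _ H]]] _ _ _ _; congr pair.
  apply: (sq_class_inj (q := q9) (r := r)) => //.
  by lincomb H (1 : F) idtac.
- move=> _ _ /mx3_inj[_ [_ [_ _ H]]] _ /mx3_inj[_ [_ [_ _ H']]] _ _; congr pair.
  apply: (mulfI (expf_neq0 2 r0)).
  transitivity (d' * q9 ^+ 2); first by apply/esym; lincomb H (1 : F) idtac.
  by lincomb H' d' idtac.
- move=> _ _ _ _ _ H H'; congr pair.
  have {}H : D ^+ 2 * d' = r ^+ 3 * d by lincomb H (1 : F) idtac.
  have D2 : D ^+ 2 = r ^+ 3.
    apply: (mulIf two_neq0); apply/eqP; rewrite -subr_eq0.
    rewrite (_ : _ - _ = 8%:R * (D ^+ 2 * d' - r ^+ 3 * d) -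
      (D ^+ 2 * (2%:R * (4%:R * d' - 1)) - r ^+ 3 * (2%:R * (4%:R * d - 1)))); last by ring.
    rewrite H subrr mulr0 sub0r oppr_eq0; apply/eqP.
    by transitivity (r ^+ 3 * 0); [lincomb H' (1 : F) idtac | rewrite mulr0].
  by apply: (mulfI (expf_neq0 3 r0)); rewrite -H D2.
(* For tag 17 the adjugate of the symmetric part is [delta] times the square of the linear form with
   coefficients [(0, 1, -2)]; hence [q5 - 2 q8]. *)
- move=> v v' _ /mx3_inj[_ [[_ H _] _]] _ _ _; congr pair.
  apply: (sq_class_inj (q := q5 - 2%:R * q8) (r := r)) => //.
  by lincomb H (1 : F) ltac:(rewrite ?four0).
Qed.
End Injective3.

(** * Pencils of bilinear forms in two variables *)

Definition mx2 (R : Type) (a b c d : R) : 'M[R]_2 :=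
  \matrix_(r, s) nth a (nth [::] [:: [:: a; b]; [:: c; d]] r) s.

Section Mx2.
Variable F : fieldType.
Implicit Types (a b c d : F) (M N : 'M[F]_2).

Lemma mx2_eta M : exists a b c d, M = mx2 a b c d.
Proof.
exists (M 0 0), (M 0 1), (M 1 0), (M 1 1).
by apply/matrixP; do 2![case=> [[|[|//]] ?]]; rewrite mxE /=;
  congr (M _ _); apply: val_inj.
Qed.

Lemma mx2_mul a b c d a' b' c' d' : mx2 a b c d *m mx2 a' b' c' d' =
  mx2 (a * a' + b * c') (a * b' + b * d') (c * a' + d * c') (c * b' + d * d').
Proof.
apply/matrixP; do 2![case=> [[|[|//]] ?]];
by rewrite !mxE !big_ord_recl big_ord0 !mxE /= addr0.
Qed.

Lemma mx2_tr a b c d : (mx2 a b c d)^T = mx2 a c b d.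
Proof. by apply/matrixP; do 2![case=> [[|[|//]] ?]]; rewrite !mxE. Qed.

Lemma mx2_scale r a b c d : r *: mx2 a b c d = mx2 (r * a) (r * b) (r * c) (r * d).
Proof. by apply/matrixP; do 2![case=> [[|[|//]] ?]]; rewrite !mxE. Qed.

Lemma mx2_add a b c d a' b' c' d' :
  mx2 a b c d + mx2 a' b' c' d' = mx2 (a + a') (b + b') (c + c') (d + d').
Proof. by apply/matrixP; do 2![case=> [[|[|//]] ?]]; rewrite !mxE. Qed.

Lemma mx2_det a b c d : \det (mx2 a b c d) = a * d - b * c.
Proof.
rewrite (expand_det_row _ 0) !big_ord_recl big_ord0 /cofactor.
by rewrite !det_mx11 !mxE /= /bump /=; ring.
Qed.

Lemma mx2_inj a b c d a' b' c' d' : mx2 a b c d = mx2 a' b' c' d' ->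
  [/\ a = a', b = b', c = c' & d = d'].
Proof.
move=> E; have D r s := congr1 (fun M : 'M_2 => M r s) E.
by split; [have := D 0 0 | have := D 0 1 | have := D 1 0 | have := D 1 1]; rewrite !mxE.
Qed.

Lemma mx2_0 : mx2 0 0 0 0 = 0 :> 'M[F]_2.
Proof. by apply/matrixP; do 2![case=> [[|[|//]] ?]]; rewrite !mxE. Qed.

Lemma mx2_opp (a b c d : F) : - mx2 a b c d = mx2 (- a) (- b) (- c) (- d).
Proof. by apply/matrixP; do 2![case=> [[|[|//]] ?]]; rewrite !mxE. Qed.

Lemma mx2_eq0 (a b c d : F) :
  (mx2 a b c d == 0) = [&& a == 0, b == 0, c == 0 & d == 0].
Proof.
apply/eqP/and4P => [|[/eqP-> /eqP-> /eqP-> /eqP->]]; last exact: mx2_0.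
by rewrite -mx2_0 => /mx2_inj[-> -> -> ->].
Qed.

Definition ts22 M N := ts (fun l : 'I_2 => if l == 0 then M else N).

Lemma ts22_iso (P K : 'M[F]_2) M N M' N' : \det P != 0 -> \det K != 0 ->
    M' = K 0 0 *: (P *m M *m P^T) + K 0 1 *: (P *m N *m P^T) ->
    N' = K 1 0 *: (P *m M *m P^T) + K 1 1 *: (P *m N *m P^T) ->
  alg_iso (ts22 M N) (ts22 M' N').
Proof.
move=> P0 K0 EM EN; have Ku : K \in unitmx by rewrite unitmxE unitfE.
(* [K] expresses the new forms through the old ones, while [ts_iso_intro] asks for the opposite and
   indexes by columns. *)
apply: alg_iso_sym; apply: (@ts_iso_intro _ _ _ _ _ P (invmx K)^T).
- by rewrite unitmxE unitfE.
- by rewrite unitmx_tr unitmx_inv.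
pose A l := if l == 0 :> 'I_2 then M else N.
pose A' l := if l == 0 :> 'I_2 then M' else N'.
rewrite -/(A _) => l; have A'E m : A' m = \sum_j K m j *: (P *m A j *m P^T).
  rewrite big_ord_recl big_ord1 /A' /A /=.
  have -> : lift ord0 ord0 = 1 :> 'I_2 by apply: val_inj.
  by case: m => [[|[|//]] i]; rewrite ?EM ?EN; congr (K _ _ *: _ + K _ _ *: _); apply: val_inj.
under eq_bigr => m _ do rewrite -/(A' m) A'E scaler_sumr.
rewrite exchange_big (bigD1 l) //= [X in _ + X]big1 ?addr0 => [|j jl].
  under eq_bigr => m _ do rewrite scalerA mxE.
  rewrite -scaler_suml; have := congr1 (fun B : 'M_2 => B l l) (mulVmx Ku).
  by rewrite !mxE eqxx => ->; rewrite scale1r.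
under eq_bigr => m _ do rewrite scalerA mxE.
rewrite -scaler_suml; have := congr1 (fun B : 'M_2 => B l j) (mulVmx Ku).
by rewrite !mxE eq_sym (negPf jl) => ->; rewrite scale0r.
Qed.

(* The rows (p, q), (s, t) form the new basis and k, k', l, l' combine the two
   forms; B and C are the forms of the source. *)
Lemma mx2_iso p q s t D k k' l l' E a b c d a' b' c' d' x y z w x' y' z' w' :
    (forall B : F -> F -> F -> F -> F,
    (forall x1 x2 y1 y2, B x1 x2 y1 y2 = x1 * (a * y1 + b * y2) + x2 * (c * y1 + d * y2)) ->
    forall C : F -> F -> F -> F -> F,
    (forall x1 x2 y1 y2, C x1 x2 y1 y2 = x1 * (a' * y1 + b' * y2) + x2 * (c' * y1 + d' * y2)) ->
    [/\ p * t - q * s = D, D != 0, k * l' - k' * l = E & E != 0] /\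
    [/\ k * B p q p q + k' * C p q p q = x, k * B p q s t + k' * C p q s t = y,
        k * B s t p q + k' * C s t p q = z & k * B s t s t + k' * C s t s t = w] /\
    [/\ l * B p q p q + l' * C p q p q = x', l * B p q s t + l' * C p q s t = y',
        l * B s t p q + l' * C s t p q = z' & l * B s t s t + l' * C s t s t = w']) ->
  alg_iso (ts22 (mx2 a b c d) (mx2 a' b' c' d'))
    (ts22 (mx2 x y z w) (mx2 x' y' z' w')).
Proof.
move=> /(_ _ (fun _ _ _ _ => erefl) _ (fun _ _ _ _ => erefl)).
move=> [[DE D0 EE E0] [[<- <- <- <-] [<- <- <- <-]]].
apply: (@ts22_iso (mx2 p q s t) (mx2 k k' l l')); rewrite ?mx2_det ?DE ?EE //.
  rewrite !mxE /= mx2_tr !mx2_mul !mx2_scale mx2_add; congr mx2; ring.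
rewrite !mxE /= mx2_tr !mx2_mul !mx2_scale mx2_add; congr mx2; ring.
Qed.

End Mx2.
Arguments mx2_iso {F} p q s t D k k' l l' E {a b c d a' b' c' d' x y z w x' y' z' w'}.

Ltac mx2_check conds :=
  let B := fresh "B" in let BE := fresh "BE" in
  let C := fresh "C" in let CE := fresh "CE" in
  move=> B BE C CE; rewrite !{}BE !{}CE; split; [|split]; split;
  first [by field; conds
        | by rewrite ?(mulf_neq0, expf_neq0, invr_neq0, oner_neq0, oppr_eq0) //; conds].

Lemma indep_iso (F : fieldType) n k (M M' : 'I_k -> 'M[F]_n) :
  indep M -> alg_iso (ts M) (ts M') -> indep M'.
Proof.
move=> iM /(ts_iso_elim iM)[P [R [_ Rf E]]] w Mw.
have: \row_m \sum_l w 0 l * R m l = 0.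
  apply: iM; transitivity (P *m (\sum_l w 0 l *: M' l) *m P^T); last first.
    by rewrite Mw mulmx0 mul0mx.
  rewrite mulmx_sumr mulmx_suml.
  under [RHS]eq_bigr => l _ do rewrite -scalemxAr -scalemxAl E scaler_sumr.
  rewrite exchange_big; apply: eq_bigr => m _ /=.
  by rewrite mxE scaler_suml; apply: eq_bigr => l _; rewrite scalerA.
move=> Rw; have: w *m R^T = 0.
  rewrite -Rw; apply/rowP => m; rewrite !mxE; apply: eq_bigr => l _.
  by rewrite mxE.
have Ru : R^T \in unitmx by rewrite unitmx_tr -row_free_unit.
by move/(congr1 (mulmx^~ (invmx R^T))); rewrite mulmxK // mul0mx.
Qed.

(** The second member is normalised by its alternating part, with entries 1 and -1, and by a
    symmetric part apolar to [x^2 - D y^2]. The determinant of that symmetric part is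
    [D t^2 - u^2]. *)
Definition nf22 (F : fieldType) (D t u : F) : algebra F :=
  ts22 (mx2 1 0 0 (- D)) (mx2 t (u + 1) (u - 1) (D * t)).

(** The tag is the second index of the algebra; the default branch stands for [A4_24]. *)
Definition pair2 (F : fieldType) (c : nat * F) : 'M[F]_2 * 'M[F]_2 :=
  let delta := c.2 in
  match c.1 with
  | 16 => (mx2 1 0 0 0, mx2 0 0 1 0)
  | 18 => (mx2 1 0 0 delta, mx2 0 1 (-1) 0)
  | 20 => (mx2 1 0 1 0, mx2 0 1 0 0)
  | 21 => (mx2 1 0 0 0, mx2 0 1 delta 0)
  | 22 => (mx2 1 0 1 1, mx2 0 1 1 0)
  | 23 => (mx2 1 0 0 (- delta), mx2 0 1 1 0)
  | _ => (mx2 1 0 (-1) 1, mx2 0 1 0 0)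
  end.

Definition form2 (F : fieldType) (c : nat * F) : algebra F :=
  ts22 (pair2 c).1 (pair2 c).2.

Definition valid2 (F : fieldType) (eta : F) (c : nat * F) : bool :=
  let delta := c.2 in
  match c.1 with
  | 16 | 20 | 24 => delta == 0
  | 18 => (delta == 0) || ((delta == 1) || (delta == eta))
  | 21 => delta != -1
  | 23 => (delta == 1) || (delta == eta)
  | _ => false
  end.

(** * Normal forms of pencils in two variables *)

Section Pairs.
#[local] Opaque mx2 ts22.
Variables (F : fieldType) (eta xi : F).
Hypothesis two_neq0 : 2%:R != 0 :> F.
Hypothesis sq_eta : forall x : F, x != 0 ->
  exists2 k, k != 0 & x = k ^+ 2 \/ x = eta * k ^+ 2.
Hypothesis sq_xi : forall x : F, x != 0 ->
  exists2 k, k != 0 & x = k ^+ 2 \/ x = xi * k ^+ 2.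
Hypothesis eta_neq0 : eta != 0.
Hypothesis xi_nsq : forall s : F, s ^+ 2 != xi.
Implicit Types (D t u : F) (X : algebra F).

(* The elements g0 + g1 * sqrt D act on (t, u) through a norm-one element of
   F[sqrt D], and every norm-one element arises (Hilbert 90); hence the norm
   D t^2 - u^2 is the only invariant. *)
Lemma nf22_rot D t u t' u' : D != 0 -> D * t ^+ 2 - u ^+ 2 != 0 ->
    D * t' ^+ 2 - u' ^+ 2 = D * t ^+ 2 - u ^+ 2 ->
  alg_iso (nf22 D t u) (nf22 D t' u').
Proof.
move=> D0 m0 H.
have rot g0 g1 : g0 ^+ 2 - D * g1 ^+ 2 != 0 ->
    t * (g0 ^+ 2 + D * g1 ^+ 2) + 2%:R * u * g0 * g1 = t' * (g0 ^+ 2 - D * g1 ^+ 2) ->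
    u * (g0 ^+ 2 + D * g1 ^+ 2) + 2%:R * D * t * g0 * g1 = u' * (g0 ^+ 2 - D * g1 ^+ 2) ->
    alg_iso (nf22 D t u) (nf22 D t' u').
  set n := g0 ^+ 2 - D * g1 ^+ 2 => n0 E1 E2.
  have inv (X Y Z : F) : X = n * Y -> n^-1 * X + 0 * Z = Y.
    by move=> ->; rewrite mulKf // mul0r addr0.
  have inv' (X Y Z : F) : X = n * Y -> 0 * Z + n^-1 * X = Y.
    by move=> ->; rewrite mulKf // mul0r add0r.
  apply: (mx2_iso g0 g1 (D * g1) g0 n n^-1 0 0 n^-1 (n^-1 * n^-1)) => B BE C CE.
  rewrite !{}BE !{}CE; split; [|split]; split=> //.
  - by rewrite /n; ring.
  - by ring.
  - by rewrite mulf_neq0 ?invr_neq0.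
  - by apply: inv; rewrite /n; ring.
  - by apply: inv; rewrite /n; ring.
  - by apply: inv; rewrite /n; ring.
  - by apply: inv; rewrite /n; ring.
  - by apply: inv'; rewrite /n in E1 *; lincomb E1 (1 : F) idtac.
  - by apply: inv'; rewrite /n in E2 *; lincomb E2 (1 : F) idtac.
  - by apply: inv'; rewrite /n in E2 *; lincomb E2 (1 : F) idtac.
  - by apply: inv'; rewrite /n in E1 *; lincomb E1 D idtac.
(* With [z = u + t sqrt D] and [z' = u' + t' sqrt D] this is [g = conj z (z + z')], so that
   [g / conj g = z' / z]. *)
pose g0 := u ^+ 2 - D * t ^+ 2 + u * u' - D * t * t'; pose g1 := u * t' - t * u'.
(* The norm of [g] is [2 (u^2 - D t^2) g0]. Even if [D] is a square it vanishes only for [g = 0],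
   that is [z' = - z], and then [g = sqrt D] does the job. *)
have [n0|n0] := eqVneq (g0 ^+ 2 - D * g1 ^+ 2) 0; last first.
  apply: (rot g0 g1 n0); rewrite /g0 /g1.
    by lincomb H ((u ^+ 2 - D * t ^+ 2 + u * u' - D * t * t') * t + (u * t' - t * u') * u) idtac.
  by lincomb H ((u ^+ 2 - D * t ^+ 2 + u * u' - D * t * t') * u + D * (u * t' - t * u') * t) idtac.
have N0 : u ^+ 2 - D * t ^+ 2 != 0 by rewrite -opprB oppr_eq0.
have g00 : g0 = 0.
  have: 2%:R * (u ^+ 2 - D * t ^+ 2) * g0 = g0 ^+ 2 - D * g1 ^+ 2.
    by rewrite /g0 /g1; lincomb H (u ^+ 2 - D * t ^+ 2) idtac.
  by rewrite n0 => /eqP; rewrite !mulf_eq0 (negPf two_neq0) (negPf N0) => /eqP.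
have g10 : g1 = 0.
  move/eqP: n0; rewrite g00 expr0n sub0r oppr_eq0 mulf_eq0 (negPf D0) sqrf_eq0.
  by move/eqP.
have t'E : t' = - t.
  apply/eqP; rewrite -addr_eq0; apply/eqP/(mulfI N0).
  by transitivity (t * g0 + u * g1); [rewrite /g0 /g1; ring | rewrite g00 g10; ring].
have u'E : u' = - u.
  apply/eqP; rewrite -addr_eq0; apply/eqP/(mulfI N0).
  by transitivity (u * g0 + D * t * g1); [rewrite /g0 /g1; ring | rewrite g00 g10; ring].
apply: (rot 0 1); rewrite ?t'E ?u'E; last by ring.
  by rewrite expr0n expr1n mulr1 sub0r oppr_eq0.
by ring.
Qed.

Definition normalizes2 X :=
  (exists c, valid2 eta c /\ alg_iso X (form2 c)) \/
  (exists D t u, [/\ D = 1 \/ D = xi, D * t ^+ 2 - u ^+ 2 != 0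
     & alg_iso X (nf22 D t u)]).

Lemma normalizes2_iso X X' : alg_iso X X' -> normalizes2 X' -> normalizes2 X.
Proof.
move=> I [[c [vc J]]|[D [t [u [hD hm J]]]]]; [left | right].
  by exists c; split; [exact: vc | exact: alg_iso_trans J].
by exists D, t, u; split; [exact: hD | exact: hm | exact: alg_iso_trans J].
Qed.

Lemma normalizes2_form c X : valid2 eta c -> alg_iso X (form2 c) -> normalizes2 X.
Proof. by move=> vc I; left; exists c; split; [exact: vc | exact: I]. Qed.

Lemma normalizes2_alt D : D != 0 ->
  normalizes2 (ts22 (mx2 1 0 0 (- D)) (mx2 0 1 (-1) 0)).
Proof.
rewrite -oppr_eq0 => /sq_eta[k k0 [->|->]].
  apply: (@normalizes2_form (18, 1)); first by rewrite /valid2 /= eqxx orbT.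
  rewrite /form2 /pair2 /=; apply: (mx2_iso 1 0 0 k^-1 k^-1 1 0 0 k k).
  mx2_check ltac:(rewrite ?k0).
apply: (@normalizes2_form (18, eta)); first by rewrite /valid2 /= eqxx !orbT.
rewrite /form2 /pair2 /=; apply: (mx2_iso 1 0 0 k^-1 k^-1 1 0 0 k k).
mx2_check ltac:(rewrite ?k0).
Qed.

Lemma normalizes2_polar D q : q != 0 ->
  normalizes2 (ts22 (mx2 1 0 0 (- D)) (mx2 0 q q 0)).
Proof.
move=> q0; have [->|] := eqVneq D 0.
  apply: (@normalizes2_form (21, 1)).
    by rewrite /valid2 /= -addr_eq0.
  rewrite /form2 /pair2 /=; apply: (mx2_iso 1 0 0 1 1 1 0 0 q^-1 q^-1).
  mx2_check ltac:(rewrite ?q0).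
move=> /sq_eta[k k0 [->|->]].
  apply: (@normalizes2_form (23, 1)); first by rewrite /valid2 /= eqxx.
  rewrite /form2 /pair2 /=; apply: (mx2_iso 1 0 0 k^-1 k^-1 1 0 0 (k / q) (k / q)).
  mx2_check ltac:(rewrite ?k0 ?q0).
apply: (@normalizes2_form (23, eta)); first by rewrite /valid2 /= eqxx orbT.
rewrite /form2 /pair2 /=; apply: (mx2_iso 1 0 0 k^-1 k^-1 1 0 0 (k / q) (k / q)).
mx2_check ltac:(rewrite ?k0 ?q0).
Qed.

Lemma normalizes2_comm D n q s : indep (fun l : 'I_2 =>
    if l == 0 then mx2 1 0 0 (- D) else mx2 n q q s) ->
  normalizes2 (ts22 (mx2 1 0 0 (- D)) (mx2 n q q s)).
Proof.
move=> ind; pose s' := s + n * D.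
apply: (@normalizes2_iso _ (ts22 (mx2 1 0 0 (- D)) (mx2 0 q q s'))).
  rewrite /s'; apply: (mx2_iso 1 0 0 1 1 1 0 (- n) 1 1).
  mx2_check ltac:(rewrite ?oner_neq0).
have [q0|q0] := eqVneq q 0; last first.
  (* Adding [r] times the first basis vector to the second makes it isotropic for the second
     form. *)
  pose r := - s' / (2%:R * q).
  apply: normalizes2_iso (normalizes2_polar (D - r ^+ 2) q0).
  rewrite /r; apply: (mx2_iso 1 0 (- s' / (2%:R * q)) 1 1 1 (s' / (2%:R * q ^+ 2)) 0 1 1).
  mx2_check ltac:(rewrite ?q0 ?two_neq0).
have [s0|s0] := eqVneq s' 0.
  have /rowP/(_ 1) : (\row_(i < 2) if i == 0 then - n else 1) = 0 :> 'rV[F]_2.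
    apply: ind; rewrite !big_ord_recl big_ord0 !mxE /= !mx2_scale addr0 mx2_add q0.
    rewrite -mx2_0; congr mx2; try ring.
    by rewrite -[RHS]s0 /s'; ring.
  by rewrite !mxE /= => /eqP; rewrite oner_eq0.
(* The pencil now consists of all diagonal forms; in the basis [(1, 1)], [(1, -1)] it is spanned by
   [x^2 + y^2] and [x y]. *)
apply: normalizes2_iso (normalizes2_polar (-1) (oner_neq0 _)).
rewrite q0; apply: (mx2_iso 1 1 1 (-1) (- 2%:R) (2%:R^-1) ((D + 1) / (2%:R * s'))
  (2%:R^-1) ((D - 1) / (2%:R * s')) (- (2%:R * s')^-1)).
mx2_check ltac:(rewrite ?s0 ?two_neq0).
Qed.

(** When the invariant vanishes, either [t = u = 0] and the second member is alternating, which is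
    [A4_18], or [D = (u / t)^2] is a square, so [D = 1] and [u] is [t] or [- t], which is
    [A4_20]. *)
Lemma normalizes2_nf D t u : D = 1 \/ D = xi -> normalizes2 (nf22 D t u).
Proof.
move=> hD; have D0 : D != 0.
  by case: hD => ->; rewrite ?oner_neq0 //; have := xi_nsq 0; rewrite expr0n eq_sym.
have [m0|m0] := eqVneq (D * t ^+ 2 - u ^+ 2) 0; last first.
  by right; exists D, t, u; split; [exact: hD | exact: m0 | exact: alg_iso_refl].
have [t0|t0] := eqVneq t 0.
  have u0 : u = 0.
    move/eqP: m0; rewrite t0 expr0n mulr0 sub0r oppr_eq0 sqrf_eq0; exact/eqP.
  by have := normalizes2_alt D0; rewrite /nf22 t0 u0 mulr0 add0r sub0r.
case: hD => D1; last first.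
  case/eqP: (xi_nsq (u / t)); rewrite -D1 expr_div_n.
  by move/eqP: m0; rewrite subr_eq0 => /eqP <-; rewrite mulfK ?expf_neq0.
have {m0} : (t == u) || (t == - u).
  by rewrite -eqf_sqr -subr_eq0 -m0 D1 mul1r.
rewrite D1 => tu; have {tu} : exists2 e, e = 1 \/ e = -1 & u = e * t.
  case/orP: tu => /eqP ->; first by exists 1; [left | rewrite mul1r].
  by exists (-1); [right | rewrite mulN1r opprK].
case=> e e1 ->.
apply: (@normalizes2_form (20, 0)); first exact: eqxx.
rewrite /nf22 /form2 /pair2 /=.
apply: (mx2_iso ((e / t + 1) / 2%:R) (e * (e / t - 1) / 2%:R) 1 (- e) (- t^-1)
  (e * t / 2%:R) (t / 2%:R) (e * t / 2%:R) (- t / 2%:R) (- e * t ^+ 2 / 2%:R)).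
by case: e1 => ->; mx2_check ltac:(rewrite ?t0 ?two_neq0).
Qed.

(** For [D = 0] the symmetric member is [x^2], and the second form matters on its radical: a nonzero
    value there gives [A4_24]. Otherwise [r / q] is the parameter of [A4_21], infinity giving
    [A4_16] and -1 giving [A4_18 0]. For [D != 0] rescaling makes [D] equal to 1 or [xi]. *)
Lemma normalizes2_noncomm D n q r s : q != r ->
  normalizes2 (ts22 (mx2 1 0 0 (- D)) (mx2 n q r s)).
Proof.
move=> qr; have w0 : q - r != 0 by rewrite subr_eq0.
have [->|D0] := eqVneq D 0.
  apply: (@normalizes2_iso _ (ts22 (mx2 1 0 0 0) (mx2 0 q r s))).
    apply: (mx2_iso 1 0 0 1 1 1 0 (- n) 1 1); mx2_check ltac:(rewrite ?oner_neq0).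
  have [->|s0] := eqVneq s 0; last first.
    apply: (@normalizes2_form (24, 0)); first exact: eqxx.
    rewrite /form2 /pair2 /=.
    apply: alg_iso_trans (_ : alg_iso _ (ts22 (mx2 1 0 0 0) (mx2 0 1 0 1))) _.
      apply: (mx2_iso 1 (- r / s) 0 ((q - r) / s) ((q - r) / s) 1 0 (q * r / (q - r) ^+ 2)
        (s / (q - r) ^+ 2) (s / (q - r) ^+ 2)).
      mx2_check ltac:(rewrite ?w0 ?s0).
    apply: alg_iso_sym; apply: (mx2_iso 1 0 1 1 1 1 (-1) 0 1 1).
    mx2_check ltac:(rewrite ?oner_neq0).
  have [q0|q0] := eqVneq q 0.
    move: w0; rewrite q0 sub0r oppr_eq0 => r0.
    apply: (@normalizes2_form (16, 0)); first exact: eqxx.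
    apply: (mx2_iso 1 0 0 1 1 1 0 0 r^-1 r^-1); mx2_check ltac:(rewrite ?r0).
  have [rq|rq] := eqVneq (r / q) (-1).
    apply: (@normalizes2_form (18, 0)); first by rewrite /valid2 /= eqxx.
    rewrite /form2 /pair2 /= -rq.
    apply: (mx2_iso 1 0 0 1 1 1 0 0 q^-1 q^-1); mx2_check ltac:(rewrite ?q0).
  apply: (@normalizes2_form (21, r / q)); first exact: rq.
  rewrite /form2 /pair2 /=.
  apply: (mx2_iso 1 0 0 1 1 1 0 0 q^-1 q^-1); mx2_check ltac:(rewrite ?q0).
have unitD D' : D' = 1 \/ D' = xi -> forall n' q' r' s', q' != r' ->
    normalizes2 (ts22 (mx2 1 0 0 (- D')) (mx2 n' q' r' s')).
  move=> hD n' q' r' s' qr'; have w'0 : q' - r' != 0 by rewrite subr_eq0.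
  have D'0 : D' != 0.
    by case: hD => ->; rewrite ?oner_neq0 //; have := xi_nsq 0; rewrite expr0n eq_sym.
  (* Obtained by dividing the second form by half of [q' - r'] and subtracting the multiple of the
     first that makes the symmetric part apolar. *)
  pose t := (D' * n' + s') / (D' * (q' - r')); pose u := (q' + r') / (q' - r').
  apply: normalizes2_iso (normalizes2_nf t u hD); rewrite /nf22 /t /u.
  apply: (mx2_iso 1 0 0 1 1 1 0 (- (D' * n' - s') / (D' * (q' - r'))) (2%:R / (q' - r'))
    (2%:R / (q' - r'))).
  mx2_check ltac:(rewrite ?w'0 ?D'0 ?two_neq0).
have [k k0 E] := sq_xi D0.
have [D' hD DE] : exists2 D', D' = 1 \/ D' = xi & D = D' * k ^+ 2.
  by case: E => E; [exists 1; rewrite ?mul1r //; left | exists xi => //; right].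
apply: (@normalizes2_iso _ (ts22 (mx2 1 0 0 (- D')) (mx2 n (q / k) (r / k) (s / k ^+ 2)))).
  rewrite DE; apply: (mx2_iso 1 0 0 k^-1 k^-1 1 0 0 1 1); mx2_check ltac:(rewrite ?k0).
by apply: unitD => //; rewrite (inj_eq (mulIf (invr_neq0 k0))).
Qed.

Lemma sym_pivot2 a b d n q r s : (a != 0) || (b != 0) || (d != 0) ->
  exists D n' q' r' s', (q' == r') = (q == r) /\
    alg_iso (ts22 (mx2 a b b d) (mx2 n q r s))
            (ts22 (mx2 1 0 0 (- D)) (mx2 n' q' r' s')).
Proof.
have piv : forall a b d n q r s : F, a != 0 ->
    exists D n' q' r' s', (q' == r') = (q == r) /\
    alg_iso (ts22 (mx2 a b b d) (mx2 n q r s))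
            (ts22 (mx2 1 0 0 (- D)) (mx2 n' q' r' s')).
  move=> {}a {}b {}d {}n {}q {}r {}s a0; exists ((b ^+ 2 / a - d) / a), n, (q - b / a * n), (r - b / a * n),
    (s - b / a * (q + r) + (b / a) ^+ 2 * n).
  split; first by rewrite (inj_eq (addIr _)).
  apply: (mx2_iso 1 0 (- b / a) 1 1 a^-1 0 0 1 a^-1); mx2_check ltac:(rewrite ?a0).
have trans (X Y : algebra F) (q1 r1 : F) : alg_iso X Y -> (exists D n' q' r' s', (q' == r') = (q1 == r1) /\
    alg_iso Y (ts22 (mx2 1 0 0 (- D)) (mx2 n' q' r' s'))) ->
  exists D n' q' r' s', (q' == r') = (q1 == r1) /\
    alg_iso X (ts22 (mx2 1 0 0 (- D)) (mx2 n' q' r' s')).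
  move=> I [D [n' [q' [r' [s' [E J]]]]]]; exists D, n', q', r', s'.
  by split; [exact: E | exact: alg_iso_trans J].
have [a0|a0] := eqVneq a 0; last by move=> _; apply: piv.
have [d0|d0] := eqVneq d 0; last first.
  move=> _; rewrite (eq_sym q); apply: trans (piv d b a s r q n d0).
  apply: (mx2_iso 0 1 1 0 (-1) 1 0 0 1 1); mx2_check ltac:(rewrite ?oner_neq0).
rewrite orbF /= => b0; have b20 : 2%:R * b != 0 by rewrite mulf_neq0.
have -> : (q == r) = (q + s == r + s) by rewrite (inj_eq (addIr _)).
apply: trans (piv (2%:R * b) b 0 (n + q + r + s) (q + s) (r + s) s b20).
rewrite a0 d0; apply: (mx2_iso 1 1 0 1 1 1 0 0 1 1); mx2_check ltac:(rewrite ?oner_neq0).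
Qed.

Lemma normalizes2_all (M : 'I_2 -> 'M[F]_2) : indep M -> normalizes2 (ts M).
Proof.
move=> iM; have [a [b [c [d ME]]]] := mx2_eta (M 0).
have [a' [b' [c' [d' NE]]]] := mx2_eta (M 1).
have I0 : alg_iso (ts M) (ts22 (mx2 a b c d) (mx2 a' b' c' d')).
  rewrite -ME -NE; apply: ts_ext => l.
  by case: l => [[|[|//]] ?] /=; congr M; apply: val_inj.
have nz a1 b1 c1 d1 N : alg_iso (ts M) (ts22 (mx2 a1 b1 c1 d1) N) ->
    [|| a1 != 0, b1 != 0, c1 != 0 | d1 != 0].
  move=> I; have iI := indep_iso iM I.
  rewrite -!negb_and; apply/negP => /and4P[/eqP a0 /eqP b0 /eqP c0 /eqP d0].
  have /rowP/(_ 0) : (\row_(i < 2) if i == 0 then 1 else 0) = 0 :> 'rV[F]_2.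
    apply: iI; rewrite !big_ord_recl big_ord0 !mxE /= a0 b0 c0 d0 mx2_0.
    by rewrite scaler0 scale0r !addr0.
  by rewrite !mxE /= => /eqP; rewrite oner_eq0.
have sym a1 b1 d1 a2 b2 c2 d2 : alg_iso (ts M) (ts22 (mx2 a1 b1 b1 d1) (mx2 a2 b2 c2 d2)) ->
    normalizes2 (ts M).
  move=> I; have := nz _ _ _ _ _ I.
  have -> : [|| a1 != 0, b1 != 0, b1 != 0 | d1 != 0] = (a1 != 0) || (b1 != 0) || (d1 != 0).
    by case: (a1 != 0); case: (b1 != 0).
  move=> /(sym_pivot2 a2 b2 c2 d2)[D [n' [q' [r' [s' [qr J]]]]]].
  have {}J := alg_iso_trans I J.
  apply: (normalizes2_iso J); have [q'r'|] := eqVneq q' r'; last exact: normalizes2_noncomm.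
  by rewrite q'r' in J *; apply: normalizes2_comm; apply: indep_iso iM J.
have [bc|bc] := eqVneq b c; first by rewrite bc in I0; apply: sym I0.
(* The alternating part is a linear functional on the pencil, so the second form minus [h] times the
   first is symmetric. *)
pose g := b - c; have g0 : g != 0 by rewrite subr_eq0.
pose h := (b' - c') / g.
apply: (sym (a' - h * a) (b' - h * b) (d' - h * d) a b c d).
apply: (alg_iso_trans I0).
apply: (mx2_iso 1 0 0 1 1 (- h) 1 1 0 (-1)); rewrite /h /g.
rewrite /g in g0; mx2_check ltac:(rewrite ?g0).
Qed.
End Pairs.

(** The pencil of [A4_25 alpha beta gamma] with [beta = sigma (1 - alpha)]. In these terms the first
    form minus [sigma] times the second is symmetric and does not involve [alpha]; its discriminant
    gives [D = gamma + sigma^2]. *)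
Definition pair25 (F : fieldType) (alpha sigma gamma : F) : 'M[F]_2 * 'M[F]_2 :=
  (mx2 1 0 (- (sigma * (1 - alpha))) (- gamma), mx2 0 1 alpha 0).

(** * The parameter set of the families [A4_25] *)

Section Kappa.
Variables (F : finFieldType) (cA : {set F}).
Hypothesis two_neq0 : 2%:R != 0 :> F.
Hypothesis cA_max : maxset (@inverse_free F) cA.

(* As kappa alpha^-1 = - kappa alpha, the set cA is a transversal for the values
   of kappa ^+ 2. *)
Definition kappa (alpha : F) := (1 + alpha) / (1 - alpha).

Lemma cA_inverse_free : inverse_free cA.
Proof. by case/maxsetP: cA_max. Qed.

Lemma cA_neq (alpha : F) : alpha \in cA ->
  [/\ alpha != 1, 1 - alpha != 0 & 1 + alpha != 0].
Proof.
case/and4P: cA_inverse_free => _ n1 nN1 _ aA.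
have a1 : alpha != 1 by apply: contraNneq n1 => <-.
split=> //; first by rewrite subr_eq0 eq_sym.
by rewrite addrC addr_eq0; apply: contraNneq nN1 => <-.
Qed.

(** Otherwise [alpha] could be added to [cA]: excluding 1 and -1 makes [alpha] different from its
    inverse, except for 0, which lies in [cA] already. *)
Lemma cA_cover (alpha : F) : alpha != 1 -> alpha != -1 ->
  (alpha \in cA) || (alpha^-1 \in cA).
Proof.
move=> a1 aN1; apply/norP => -[aA iA].
have aV : alpha != alpha^-1.
  have [a0|a0] := eqVneq alpha 0.
    by case/and4P: cA_inverse_free aA => z0 _ _ _; rewrite a0 z0.
  apply/eqP => E; have: alpha ^+ 2 == 1 by rewrite expr2 {1}E mulVf.
  by rewrite sqrf_eq1 (negPf a1) (negPf aN1).
have: inverse_free (alpha |: cA).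
  case/and4P: cA_inverse_free => z0 n1 nN1 /forall_inP inv; apply/and4P; split.
  - by rewrite !inE z0 orbT.
  - by rewrite !inE eq_sym (negPf a1).
  - by rewrite !inE eq_sym (negPf aN1).
  apply/forall_inP => x; rewrite !inE => /orP[/eqP-> | xA]; apply/implyP => x0.
    by rewrite negb_or eq_sym aV iA.
  rewrite negb_or (implyP (inv x xA)) // andbT.
  by apply: contraNneq iA => <-; rewrite invrK.
case/maxsetP: cA_max => _ /(_ (alpha |: cA)) H /H{}H.
by case/negP: aA; rewrite -(H (subsetUr _ _)) !inE eqxx.
Qed.

Lemma kappa_inj (alpha alpha' : F) : alpha \in cA -> alpha' \in cA ->
  kappa alpha ^+ 2 = kappa alpha' ^+ 2 -> alpha = alpha'.
Proof.
move=> aA aA'; have [a1 m0 p0] := cA_neq aA; have [a'1 m'0 p'0] := cA_neq aA'.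
move/eqP; rewrite eqf_sqr /kappa => /orP[] /eqP E.
  apply: (mulfI two_neq0); apply/eqP; rewrite -subr_eq0; apply/eqP.
  transitivity ((1 - alpha) * (1 - alpha') *
    ((1 + alpha) / (1 - alpha) - (1 + alpha') / (1 - alpha'))).
    by field; rewrite m0 m'0.
  by rewrite E subrr mulr0.
have aa : alpha * alpha' = 1.
  apply: (mulfI two_neq0); apply/eqP; rewrite eq_sym -subr_eq0; apply/eqP.
  transitivity ((1 - alpha) * (1 - alpha') *
    ((1 + alpha) / (1 - alpha) - (- ((1 + alpha') / (1 - alpha'))))).
    by field; rewrite m0 m'0.
  by rewrite E subrr mulr0.
have a0 : alpha != 0 by apply: contra_eqN aa => /eqP->; rewrite mul0r eq_sym oner_neq0.
have := cA_inverse_free => /and4P[_ _ _ /forall_inP/(_ _ aA)].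
by rewrite a0 /= (_ : alpha^-1 = alpha') ?aA' // -[RHS](mulKf a0) aa mulr1.
Qed.

Lemma kappa_surj (k : F) : k != 0 -> exists2 alpha, alpha \in cA & kappa alpha ^+ 2 = k ^+ 2.
Proof.
(* The inverse of [kappa] has its pole at -1, but the square of -1 is attained at 0. *)
move=> k0; have [kN1|kN1] := eqVneq k (-1).
  exists 0; first by case/and4P: cA_inverse_free.
  by rewrite /kappa kN1 addr0 subr0 divr1 expr1n sqrrN expr1n.
have p0 : k + 1 != 0 by rewrite addr_eq0.
(* The inverse of the fractional linear map [kappa]. *)
pose a := (k - 1) / (k + 1).
have a1 : a != 1.
  rewrite /a -subr_eq0; have -> : (k - 1) / (k + 1) - 1 = - 2%:R / (k + 1) by field.
  by rewrite mulf_neq0 ?invr_neq0 ?oppr_eq0.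
have aN1 : a != -1.
  rewrite /a -addr_eq0.
  have -> : (k - 1) / (k + 1) + 1 = 2%:R * k / (k + 1) by field.
  by rewrite !mulf_neq0 ?invr_neq0.
have kE : 1 - (k - 1) / (k + 1) = 2%:R / (k + 1) by field.
case/orP: (cA_cover a1 aN1) => aA; [exists a | exists a^-1] => //; rewrite /kappa.
  congr (_ ^+ 2); rewrite /a; field.
  by rewrite p0 /= (_ : _ - _ = 2%:R) ?two_neq0 //; ring.
have [a0|a0] := eqVneq a 0.
  move/eqP: a0; rewrite mulf_eq0 invr_eq0 (negPf p0) orbF subr_eq0 => /eqP k1.
  by rewrite /a k1 subrr mul0r invr0 addr0 subr0 divr1.
rewrite -[RHS]sqrrN; congr (_ ^+ 2); rewrite /a.
have k1 : k - 1 != 0 by move: a0; rewrite mulf_eq0 negb_or => /andP[].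
field.
rewrite k1 p0 /= ?andbT.
by rewrite (_ : _ - _ = - 2%:R) ?oppr_eq0 ?two_neq0 //; ring.
Qed.

(** The invariant [D t^2 - u^2] of the target is [- kappa(alpha)^2 gamma / D], because
    [D - sigma^2 = gamma]. *)
Lemma pair25_iso (alpha sigma gamma : F) : alpha \in cA -> gamma + sigma ^+ 2 != 0 ->
  let D := gamma + sigma ^+ 2 in let p := pair25 alpha sigma gamma in
  alg_iso (ts22 p.1 p.2) (nf22 D (sigma * kappa alpha / D) (kappa alpha)).
Proof.
move=> aA D0 D /=; have [_ a0 p0] := cA_neq aA; rewrite -/D in D0.
rewrite /nf22 /kappa.
pose k := (1 + alpha) / (1 - alpha).
apply: (mx2_iso 1 0 sigma 1 1 1 (- sigma) (sigma * k / D) (2%:R / (1 - alpha) - sigma ^+ 2 * k / D)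
  (2%:R / (1 - alpha))).
rewrite /k /D; rewrite /D in D0; mx2_check ltac:(rewrite ?D0 ?a0 ?two_neq0).
Qed.
End Kappa.

(** * Invariants of pencils *)

Section Invariants2.
Variable F : finFieldType.
Implicit Types (M N P : 'M[F]_2) (p : 'M[F]_2 * 'M[F]_2).

Definition alt2 M : F := M 0 1 - M 1 0.
(** The polarisation of the determinant: [det (M + N) = det M + polar2 M N + det N]. *)
Definition polar2 M N : F := M 0 0 * N 1 1 + M 1 1 * N 0 0 - M 0 1 * N 1 0 - M 1 0 * N 0 1.

(* The symmetric member of a noncommutative pencil, up to a scalar. *)
Definition symm2 p : 'M[F]_2 := alt2 p.2 *: p.1 - alt2 p.1 *: p.2.

(* Discriminant of the determinant as a quadratic form on the pencil. *)
Definition gram2 p : F := 4%:R * \det p.1 * \det p.2 - polar2 p.1 p.2 ^+ 2.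

(** A boolean search over the finite field, so that [code2] can branch on it. *)
Definition has_alt2 p : bool :=
  [exists x : F * F, x.1 *: p.1 + x.2 *: p.2 == mx2 0 1 (-1) 0].

Lemma has_alt2P p :
  reflect (exists x y, x *: p.1 + y *: p.2 = mx2 0 1 (-1) 0) (has_alt2 p).
Proof.
apply: (iffP existsP) => [[[x y] /eqP]|[x [y E]]]; first by exists x, y.
by exists (x, y); apply/eqP.
Qed.

Definition comb2 (a b c d : F) p := (a *: p.1 + b *: p.2, c *: p.1 + d *: p.2).
Definition congr2 P p := (P *m p.1 *m P^T, P *m p.2 *m P^T).

Lemma alt2_mx2 (a b c d : F) : alt2 (mx2 a b c d) = b - c.
Proof. by rewrite /alt2 !mxE. Qed.

Lemma polar2_mx2 (a b c d a' b' c' d' : F) :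
  polar2 (mx2 a b c d) (mx2 a' b' c' d') = a * d' + d * a' - b * c' - c * b'.
Proof. by rewrite /polar2 !mxE. Qed.

Lemma pair_eta p : exists a b c d a' b' c' d', p = (mx2 a b c d, mx2 a' b' c' d').
Proof.
case: p => M N; have [a [b [c [d ->]]]] := mx2_eta M.
by have [a' [b' [c' [d' ->]]]] := mx2_eta N; exists a, b, c, d, a', b', c', d'.
Qed.

Definition mx2E := (mx2_tr, mx2_mul, mx2_scale, mx2_opp, mx2_add, mx2_det, alt2_mx2, polar2_mx2).

Lemma alt2_congr P M : alt2 (P *m M *m P^T) = \det P * alt2 M.
Proof.
have [a [b [c [d ->]]]] := mx2_eta M; have [q [s [t [u ->]]]] := mx2_eta P.
by rewrite !mx2E; ring.
Qed.

Lemma symm2_comb a b c d p : symm2 (comb2 a b c d p) = (a * d - b * c) *: symm2 p.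
Proof.
have [? [? [? [? [? [? [? [? ->]]]]]]]] := pair_eta p.
by rewrite /symm2 /comb2 /= !mx2E; congr mx2; ring.
Qed.

Lemma gram2_comb a b c d p : gram2 (comb2 a b c d p) = (a * d - b * c) ^+ 2 * gram2 p.
Proof.
have [? [? [? [? [? [? [? [? ->]]]]]]]] := pair_eta p.
by rewrite /gram2 /comb2 /= !mx2E; ring.
Qed.

Lemma symm2_congr P p : symm2 (congr2 P p) = \det P *: (P *m symm2 p *m P^T).
Proof.
rewrite /symm2 /congr2 /= !alt2_congr mulmxBr mulmxBl scalerBr.
by rewrite -!scalemxAr -!scalemxAl !scalerA.
Qed.

Lemma gram2_congr P p : gram2 (congr2 P p) = \det P ^+ 4 * gram2 p.
Proof.
have [? [? [? [? [? [? [? [? ->]]]]]]]] := pair_eta p.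
have [q [s [t [u ->]]]] := mx2_eta P.
by rewrite /gram2 /congr2 /= !mx2E; ring.
Qed.

Definition pencil_eq p p' := exists P a b c d,
  [/\ P \in unitmx, a * d - b * c != 0 & congr2 P p' = comb2 a b c d p].

Definition indep2 p := forall x y, x *: p.1 + y *: p.2 = 0 -> x = 0 /\ y = 0.

Lemma indep2P p : indep2 p -> indep (fun l : 'I_2 => if l == 0 then p.1 else p.2).
Proof.
move=> ip w; rewrite !big_ord_recl big_ord0 addr0 /= => /ip[w0 w1].
apply/rowP => -[[|[|//]] i]; rewrite mxE; [rewrite -[RHS]w0 | rewrite -[RHS]w1];
by congr (w _ _); apply: val_inj.
Qed.

Lemma ts22_pencil p p' : indep2 p -> alg_iso (ts22 p.1 p.2) (ts22 p'.1 p'.2) ->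
  pencil_eq p p'.
Proof.
move=> ip /(ts_iso_elim (indep2P ip))[P [R [Pf Rf E]]].
exists P, (R 0 0), (R 1 0), (R 0 1), (R 1 1); split.
- by rewrite -row_full_unit.
- move: Rf; rewrite row_free_unit unitmxE unitfE.
  have [a [b [c [d ->]]]] := mx2_eta R; rewrite mx2_det !mxE /=.
  by rewrite [c * b]mulrC.
rewrite /congr2 /comb2; have := E 1; have := E 0.
rewrite !big_ord_recl !big_ord0 !addr0 /= => -> ->.
by congr (_ *: _ + _ *: _, _ *: _ + _ *: _); congr (R _ _); apply: val_inj.
Qed.

(** Both quantities acquire the same factor [(r / e)^2]. Hence their vanishing, their square classes
    and their equality are invariants of the pencil. *)
Lemma pencil_gram p p' : pencil_eq p p' -> exists e r, [/\ e != 0, r != 0,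
  e ^+ 2 * gram2 p' = r ^+ 2 * gram2 p &
  e ^+ 2 * \det (symm2 p') = r ^+ 2 * \det (symm2 p)].
Proof.
move=> [P [a [b [c [d [Pu r0 E]]]]]].
have d0 : \det P != 0 by rewrite -unitfE -unitmxE.
exists (\det P ^+ 2), (a * d - b * c); split=> //; first by rewrite expf_neq0.
  by rewrite -gram2_comb -E gram2_congr; ring.
have := congr1 (fun q => \det (symm2 q)) E.
rewrite symm2_comb symm2_congr !detZ !det_mulmx det_tr => <-; ring.
Qed.

Definition comm2 p := (alt2 p.1 == 0) && (alt2 p.2 == 0).

Lemma comm2_congr p p' : pencil_eq p p' -> comm2 p -> comm2 p'.
Proof.
move=> [P [a [b [c [d [Pu r0 E]]]]]] /andP[/eqP p1 /eqP p2].
have d0 : \det P != 0 by rewrite -unitfE -unitmxE.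
have altC x y : alt2 (x *: p.1 + y *: p.2) = x * alt2 p.1 + y * alt2 p.2.
  by rewrite /alt2 !mxE; ring.
apply/andP; split; apply/eqP/(mulfI d0); rewrite mulr0 -alt2_congr.
  by have := congr1 fst E; rewrite /= => ->; rewrite altC p1 p2 !mulr0 addr0.
by have := congr1 snd E; rewrite /= => ->; rewrite altC p1 p2 !mulr0 addr0.
Qed.

Lemma has_alt2_congr p p' : pencil_eq p p' -> has_alt2 p' -> has_alt2 p.
Proof.
move=> [P [a [b [c [d [Pu r0 [E1 E2]]]]]]] /has_alt2P[x [y E]].
have d0 : \det P != 0 by rewrite -unitfE -unitmxE.
have PJ : P *m mx2 0 1 (-1) 0 *m P^T = \det P *: mx2 0 1 (-1) 0.
  have [q [s [t [u ->]]]] := mx2_eta P.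
  by rewrite !mx2E; congr mx2; ring.
apply/has_alt2P; exists ((x * a + y * c) / \det P), ((x * b + y * d) / \det P).
apply: (scalerI d0); rewrite -PJ -E mulmxDr mulmxDl.
rewrite -!scalemxAr -!scalemxAl E1 E2 !scalerDr !scalerA.
rewrite ![\det P * _]mulrC !divfK // !scalerDl.
by rewrite addrACA.
Qed.

(** The value 1 stands for [A4_21 1], the value 2 for [A4_16] and the other [A4_21], and 25 for
    [A4_22] and all [A4_25]; the remaining values are tags. On [nf22 D t u] the last test says
    [D t^2 - u^2 = 0]. *)
Definition code2 p : nat :=
  if comm2 p then if gram2 p == 0 then 1 else 23
  else if has_alt2 p then 18
  else if \det (symm2 p) == 0 then if gram2 p == 0 then 2 else 24
  else if gram2 p == \det (symm2 p) then 20 else 25.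

Lemma code2_pencil p p' : pencil_eq p p' -> pencil_eq p' p -> code2 p = code2 p'.
Proof.
move=> pp' p'p; rewrite /code2.
have -> : comm2 p = comm2 p' by apply/idP/idP; apply: comm2_congr.
have -> : has_alt2 p = has_alt2 p' by apply/idP/idP; apply: has_alt2_congr.
have [e [r [e0 r0 EG ES]]] := pencil_gram pp'.
have e20 : e ^+ 2 != 0 by rewrite expf_neq0.
have r20 : r ^+ 2 != 0 by rewrite expf_neq0.
have z0 x y : e ^+ 2 * x = r ^+ 2 * y -> (y == 0) = (x == 0).
  by move=> E; rewrite -(mulrI_eq0 y (mulfI r20)) -E mulrI_eq0 //; apply: mulfI.
rewrite (z0 _ _ EG) (z0 _ _ ES).
by rewrite -[gram2 p == _](inj_eq (mulfI r20)) -EG -ES (inj_eq (mulfI e20)).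
Qed.

End Invariants2.

(** The tags 25 to 28 are the four families of [A4_25] in the order of the lists. *)
Definition pencil_of (F : fieldType) (xi sxi zeta szeta : F) (c : nat * F) :=
  let alpha := c.2 in
  match c.1 with
  | 25 => pair25 alpha 0 1
  | 26 => pair25 alpha sxi 1
  | 27 => pair25 alpha szeta zeta
  | 28 => pair25 alpha 0 xi
  | _ => pair2 c
  end.

(** The value of [code2] on each family. [delta1] tells whether the parameter is 1, which for tag 21
    means commutativity. *)
Definition tag_code (n : nat) (delta1 : bool) : nat :=
  match n with
  | 16 => 2
  | 21 => if delta1 then 1 else 2
  | 22 | 26 | 27 | 28 => 25
  | n => n
  end.

Section PencilCodes.
Variables (F : finFieldType) (eta xi sxi zeta szeta : F) (cA : {set F}) (q3 : bool).
Hypothesis two_neq0 : 2%:R != 0 :> F.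
Hypothesis eta_nsq : forall s : F, s ^+ 2 != eta.
Hypothesis xi_nsq : forall s : F, s ^+ 2 != xi.
Hypothesis sxi_sq : sxi ^+ 2 = xi - 1.
Hypothesis cA_max : maxset (@inverse_free F) cA.
Local Notation full2 := (pencil_of xi sxi zeta szeta).

(* The tag 27 requires a zeta as in the theorem, the tag 22 occurs for #|F| = 3. *)
Definition valid_pencil (c : nat * F) : Prop :=
  let alpha := c.2 in
  match c.1 with
  | 22 => [/\ alpha = 0, q3 & forall k : F, k ^+ 2 != -1]
  | 25 | 26 | 28 => alpha \in cA
  | 27 => [/\ alpha \in cA, ~~ q3, forall s : F, s ^+ 2 != zeta
      & szeta ^+ 2 = 1 - zeta]
  | _ => valid2 eta c
  end.

Definition code_tag (c : nat * F) : nat := tag_code c.1 (c.2 == 1).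

Lemma indep2_full2 c : valid_pencil c -> indep2 (full2 c).
Proof.
have nz : 0 <> 1 :> F by apply/eqP; rewrite eq_sym oner_eq0.
case: c => n d; rewrite /valid_pencil /valid2 /pencil_of /pair2 /pair25 /= => v x y.
do 29?[case: n v => [|n] // v]; rewrite /= !mx2_scale mx2_add -mx2_0 => /mx2_inj[];
  rewrite ?(mulr0, mulr1, addr0, add0r) => *; by split.
Qed.

Lemma pair25_invariants (alpha sigma gamma : F) :
    let p := pair25 alpha sigma gamma in
  \det (symm2 p) = - ((1 - alpha) ^+ 2 * (gamma + sigma ^+ 2)) /\
  gram2 p = 4%:R * alpha * gamma - (sigma * (1 - alpha)) ^+ 2.
Proof. by rewrite /pair25 /symm2 /gram2 /= !mx2E; split; ring. Qed.

Lemma code2_pair25 (alpha sigma gamma : F) : alpha \in cA -> gamma != 0 ->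
  gamma + sigma ^+ 2 != 0 -> code2 (pair25 alpha sigma gamma) = 25.
Proof.
move=> /(cA_neq cA_max)[a1 m0 p0] g0 D0; have [dE gE] := pair25_invariants alpha sigma gamma.
rewrite /code2 dE gE /comm2 /= !mx2E (negPf m0) andbF.
have -> : has_alt2 (pair25 alpha sigma gamma) = false.
  apply/negbTE/negP => /has_alt2P[x [y]]; rewrite /= !mx2E => /mx2_inj[].
  rewrite ?(mulr0, mulr1, addr0, add0r) => -> ->; rewrite mul0r add0r mul1r => E _.
  by rewrite E subrr eqxx in p0.
rewrite oppr_eq0 mulf_eq0 expf_eq0 (negPf m0) (negPf D0) /= -subr_eq0.
have -> : 4%:R * alpha * gamma - (sigma * (1 - alpha)) ^+ 2 -
  - ((1 - alpha) ^+ 2 * (gamma + sigma ^+ 2)) = (1 + alpha) ^+ 2 * gamma by ring.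
by rewrite mulf_eq0 expf_eq0 (negPf p0) (negPf g0).
Qed.

Lemma code2_full2 c : valid_pencil c -> code2 (full2 c) = code_tag c.
Proof.
have nz : 0 <> 1 :> F by apply/eqP; rewrite eq_sym oner_eq0.
have xi0 : xi != 0 by have := xi_nsq 0; rewrite expr0n eq_sym.
have eta0 : eta != 0 by have := eta_nsq 0; rewrite expr0n eq_sym.
case: c => n d; rewrite /valid_pencil /valid2 /pencil_of /code_tag /tag_code /pair2 /= => v.
do 29?[case: n v => [|n] // v].
all: rewrite ?(code2_pair25 v) ?oner_neq0 //.
all: rewrite /code2 /comm2 /symm2 /gram2 /= ?mx2E.
all: rewrite ?(mulr0, mul0r, subr0, addr0, add0r, sub0r, mulr1, mul1r, subrr, oppr0, addNr, eqxx, mulrN1, mulN1r, opprK, mulrN, mulNr, oppr_eq0, oner_eq0, expr0n) /=.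
- have -> // : has_alt2 (mx2 1 0 0 0 : 'M[F]_2, mx2 0 0 1 0) = false.
  apply/negbTE/negP => /has_alt2P[x [y]]; rewrite /= !mx2E => /mx2_inj[].
  by rewrite ?(mulr0, mulr1, addr0, add0r).
- have -> : 1 + 1 = 2%:R :> F by [].
  rewrite (negPf two_neq0); have -> // : has_alt2 (mx2 1 0 0 d, mx2 0 1 (-1) 0).
  apply/has_alt2P; exists 0, 1; rewrite /= !mx2E.
  by rewrite !(mulr0, mulr1, addr0, add0r, mul0r, mul1r).
- have -> : has_alt2 (mx2 1 0 1 0 : 'M[F]_2, mx2 0 1 0 0) = false.
    apply/negbTE/negP => /has_alt2P[x [y]]; rewrite /= !mx2E => /mx2_inj[].
    rewrite ?(mulr0, mulr1, addr0, add0r) => -> _ /eqP.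
    by rewrite eq_sym oppr_eq0 oner_eq0.
  by rewrite sqrrN expr1n eqxx.
- rewrite subr_eq0 eq_sym; case: eqP => // d1.
  have -> // : has_alt2 (mx2 1 0 0 0, mx2 0 1 d 0) = false.
  apply/negbTE/negP => /has_alt2P[x [y]]; rewrite /= !mx2E => /mx2_inj[].
  rewrite ?(mulr0, mulr1, addr0, add0r) => _ ->; rewrite mul1r => /eqP.
  by rewrite (negPf v).
- have -> : has_alt2 (mx2 1 0 1 1 : 'M[F]_2, mx2 0 1 1 0) = false.
    apply/negbTE/negP => /has_alt2P[x [y]]; rewrite /= !mx2E => /mx2_inj[].
    rewrite ?(mulr0, mulr1, addr0, add0r) => -> -> /eqP.
    by rewrite add0r -addr_eq0 (negPf two_neq0).
  rewrite sqrrN expr1n -subr_eq0 (_ : _ - _ = - (2%:R * 2%:R)); last by ring.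
  by rewrite oppr_eq0 mulf_eq0 (negPf two_neq0).
- have d0 : d != 0 by case/orP: v => /eqP->; rewrite ?oner_eq0.
  by rewrite -[4%N]/(2 * 2)%N natrM !mulf_eq0 (negPf two_neq0) (negPf d0).
- have -> : has_alt2 (mx2 1 0 (-1) 1 : 'M[F]_2, mx2 0 1 0 0) = false.
    apply/negbTE/negP => /has_alt2P[x [y]]; rewrite /= !mx2E => /mx2_inj[].
    rewrite ?(mulr0, mulr1, addr0, add0r) => -> _ /eqP.
    by rewrite mul0r eq_sym oppr_eq0 oner_eq0.
  by rewrite expr1n oner_eq0.
- by [].
- by rewrite sxi_sq addrC subrK.
- case: v => dA _ z_nsq sz; have z0 : zeta != 0 by have := z_nsq 0; rewrite expr0n eq_sym.
  have := @code2_pair25 d szeta zeta dA z0; rewrite sz addrC subrK oner_eq0 => /(_ isT).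
  rewrite /code2 /comm2 /symm2 /gram2 /= ?mx2E.
  by rewrite ?(mulr0, mul0r, subr0, addr0, add0r, sub0r, mulr1, mul1r, subrr, oppr0, addNr, eqxx, mulrN1, mulN1r, opprK, mulrN, mulNr, oppr_eq0, oner_eq0, expr0n) /=.
- exact: xi0.
Qed.
End PencilCodes.

(* For a pencil spanned by x * x and x * y + delta y * x, the ratio delta is
   visible on the radical of x * x. *)
Definition twisted (F : fieldType) (a b : F) (p : 'M[F]_2 * 'M[F]_2) :=
  exists V : 'M[F]_2, [/\ V != 0, a *: (V *m p.1) = b *: (V *m p.1^T)
    & a *: (V *m p.2) = b *: (V *m p.2^T)].

Lemma twisted_pencil (F : finFieldType) (a b : F) p p' :
  pencil_eq p p' -> twisted a b p -> twisted a b p'.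
Proof.
move=> [P [k [l [m [n [Pu r0 [E1 E2]]]]]]] [V [V0 H1 H2]]; exists (V *m P).
have PTu : P^T \in unitmx by rewrite unitmx_tr.
have H x y : a *: (V *m (x *: p.1 + y *: p.2)) = b *: (V *m (x *: p.1 + y *: p.2)^T).
  have -> : (x *: p.1 + y *: p.2)^T = x *: p.1^T + y *: p.2^T.
    by rewrite linearD !linearZ.
  rewrite !mulmxDr !scalerDr -!scalemxAr.
  by rewrite !scalerA ![_ * x]mulrC ![_ * y]mulrC -!scalerA H1 H2.
have K M : a *: (V *m (P *m M *m P^T)) = b *: (V *m (P *m M *m P^T)^T) ->
    a *: (V *m P *m M) = b *: (V *m P *m M^T).
  have -> : (P *m M *m P^T)^T = P *m M^T *m P^T by rewrite !trmx_mul trmxK mulmxA.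
  have L N : V *m (P *m N *m P^T) = V *m P *m N *m P^T by rewrite !mulmxA.
  by rewrite !L => E; apply: (can_inj (mulmxK PTu)); rewrite -2!(scalemxAl _ _ P^T).
split; last 2 first.
- by apply: K; rewrite E1; apply: H.
- by apply: K; rewrite E2; apply: H.
apply: contraNneq V0 => VP; apply/eqP.
by rewrite -[V](mulmxK Pu) VP mul0mx.
Qed.

(** As [a != b], the condition on [x^2] forces the rows of [V] into its radical, where the second
    form shows the ratio [d]. *)
Lemma twisted_21 (F : fieldType) (a b d : F) : a != b ->
  twisted a b (mx2 1 0 0 0, mx2 0 1 d 0) -> a * d = b.
Proof.
move=> ab [V []]; have [x [y [z [w ->]]]] := mx2_eta V.
rewrite /= !mx2_tr !mx2_mul !mx2_scale => V0 /mx2_inj[E1 _ E2 _] /mx2_inj[E3 _ E4 _].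
have zero u : a * (u * 1) = b * (u * 1) -> u = 0.
  move/eqP; rewrite mulr1 -subr_eq0 -mulrBl mulf_eq0 subr_eq0 (negPf ab).
  by move/eqP.
move: E1 E2; rewrite !mulr0 !addr0 => /zero x0 /zero z0.
move: E3 E4; rewrite x0 z0 !mul0r !add0r !mulr1 => E3 E4.
have [y0|y0] := eqVneq y 0; last by apply: (mulIf y0); rewrite -mulrA [d * y]mulrC.
have [w0|w0] := eqVneq w 0; last by apply: (mulIf w0); rewrite -mulrA [d * w]mulrC.
by move: V0; rewrite x0 y0 z0 w0 mx2_0 eqxx.
Qed.

Lemma twisted_21_self (F : fieldType) (d : F) :
  twisted 1 d (mx2 1 0 0 0, mx2 0 1 d 0).
Proof.
exists (mx2 0 1 0 0); rewrite mx2_eq0 oner_eq0 andbF /= !mx2_tr !mx2_mul !mx2_scale.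
by split=> //; congr mx2; ring.
Qed.

(** [A4_16] is the case of an infinite ratio: for [A4_21] the coefficients 0 and 1 would give
    [0 = 1]. *)
Lemma twisted_16 (F : fieldType) : twisted (0 : F) 1 (mx2 1 0 0 0, mx2 0 0 1 0).
Proof.
exists (mx2 0 1 0 0); rewrite mx2_eq0 oner_eq0 andbF /= !mx2_tr !mx2_mul !mx2_scale.
by split=> //; congr mx2; ring.
Qed.

(** * Separation of the pencils *)

Section InjectivePencils.
Variables (F : finFieldType) (eta xi sxi zeta szeta : F) (cA : {set F}) (q3 : bool).
Hypothesis two_neq0 : 2%:R != 0 :> F.
Hypothesis eta_nsq : forall s : F, s ^+ 2 != eta.
Hypothesis xi_nsq : forall s : F, s ^+ 2 != xi.
Hypothesis sxi_sq : sxi ^+ 2 = xi - 1.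
Hypothesis cA_max : maxset (@inverse_free F) cA.
Local Notation full2 := (pencil_of xi sxi zeta szeta).
Local Notation valid22 := (valid_pencil eta zeta szeta cA q3).

Let four0 : 4%:R != 0 :> F.
Proof. by rewrite -[4%N]/(2 * 2)%N natrM mulf_neq0. Qed.

(** The square class of [det symm2] determines [D], which is 1 or [xi]. The difference of [gram2]
    and [det symm2] is [(1 + a)^2 g]; relative to [det symm2] it yields [kappa a ^+ 2 * g]. *)
Lemma pair25_pencil (a s g a' s' g' : F) : a \in cA -> a' \in cA ->
    pencil_eq (pair25 a s g) (pair25 a' s' g') ->
    (g + s ^+ 2 == 1) || (g + s ^+ 2 == xi) ->
    (g' + s' ^+ 2 == 1) || (g' + s' ^+ 2 == xi) ->
  g + s ^+ 2 = g' + s' ^+ 2 /\ kappa a ^+ 2 * g = kappa a' ^+ 2 * g'.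
Proof.
move=> aA a'A /pencil_gram[e [r [e0 r0]]].
have [_ m0 p0] := cA_neq cA_max aA; have [_ m'0 p'0] := cA_neq cA_max a'A.
have [-> ->] := pair25_invariants a s g; have [-> ->] := pair25_invariants a' s' g'.
move=> EG ES vD vD'; have DD : g + s ^+ 2 = g' + s' ^+ 2.
  apply: (@sq_class_inj F xi xi_nsq _ _ (e * (1 - a')) (r * (1 - a))) => //.
    by rewrite mulf_neq0.
  by lincomb ES (-1 : F) idtac.
split=> //; have D0 : g' + s' ^+ 2 != 0.
  by case/orP: vD' => /eqP ->; rewrite ?oner_neq0 //; have := xi_nsq 0; rewrite expr0n eq_sym.
have {}ES : e ^+ 2 * (1 - a') ^+ 2 = r ^+ 2 * (1 - a) ^+ 2.
  apply: (mulIf D0); rewrite -{2}DD; by lincomb ES (-1 : F) idtac.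
have {}EG : e ^+ 2 * ((1 + a') ^+ 2 * g') = r ^+ 2 * ((1 + a) ^+ 2 * g).
  have gE : g = g' + s' ^+ 2 - s ^+ 2 by rewrite -DD addrK.
  apply/eqP; rewrite -subr_eq0; apply/eqP.
  transitivity ((e ^+ 2 * (4%:R * a' * g' - (s' * (1 - a')) ^+ 2) -
     r ^+ 2 * (4%:R * a * g - (s * (1 - a)) ^+ 2)) +
    (g' + s' ^+ 2) * (e ^+ 2 * (1 - a') ^+ 2 - r ^+ 2 * (1 - a) ^+ 2)).
    by rewrite gE; ring.
  by rewrite EG ES !subrr mulr0 addr0.
rewrite /kappa; have r20 : r ^+ 2 * (1 - a) ^+ 2 != 0 by rewrite mulf_neq0 ?expf_neq0.
apply: (mulfI r20); transitivity (r ^+ 2 * ((1 + a) ^+ 2 * g)).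
  by field; rewrite m0.
by rewrite -EG -ES; field; rewrite m'0.
Qed.

(** For tag 22, [det symm2 = -1] and [gram2 = -5], with difference -4. If [g = 1], the conclusion
    makes -1 a square, which fails in the field with three elements. *)
Lemma pair22_pencil (a s g : F) : a \in cA ->
    pencil_eq (mx2 1 0 1 1, mx2 0 1 1 0) (pair25 a s g) ->
    (g + s ^+ 2 == 1) || (g + s ^+ 2 == xi) -> g + s ^+ 2 = 1 /\
  kappa a ^+ 2 * g = - 4%:R.
Proof.
move=> aA /pencil_gram[e [r [e0 r0]]].
have [_ m0 p0] := cA_neq cA_max aA.
have [-> ->] := pair25_invariants a s g.
rewrite /symm2 /gram2 /= !mx2E => EG ES vD; have D1 : g + s ^+ 2 = 1.
  apply/esym; apply: (@sq_class_inj F xi xi_nsq _ _ (e * (1 - a)) r) => //.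
    by rewrite eqxx.
  by lincomb ES (-1 : F) idtac.
split=> //; have {}ES : e ^+ 2 * (1 - a) ^+ 2 = r ^+ 2.
  apply/eqP; rewrite -subr_eq0; apply/eqP; move: ES; rewrite D1 => ES.
  by transitivity (r ^+ 2 * 0); [lincomb ES (-1 : F) idtac | rewrite mulr0].
have gE : g = 1 - s ^+ 2 by rewrite -D1 addrK.
rewrite /kappa; apply: (mulfI (expf_neq0 2 r0)); rewrite -{1}ES.
transitivity (e ^+ 2 * ((1 + a) ^+ 2 * g)); first by field; rewrite m0.
rewrite gE in EG *.
apply/eqP; rewrite -subr_eq0; apply/eqP.
transitivity ((e ^+ 2 * (4%:R * a * (1 - s ^+ 2) - (s * (1 - a)) ^+ 2) - r ^+ 2 * (- 5%:R)) +
    (e ^+ 2 * (1 - a) ^+ 2 - r ^+ 2)); first by ring.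
by rewrite EG ES; ring.
Qed.

Definition tags2 : seq nat := [:: 16; 18; 20; 21; 23; 24; 22; 25; 26; 27; 28].

Lemma valid22_tag c : valid22 c -> c.1 \in tags2.
Proof.
by case: c => n d; rewrite /valid_pencil /valid2 /=; do 29?[case: n => [|n] //].
Qed.

(** A finite table checked by evaluation. Equal codes leave only 16 against 21, and 22, 25 to 28
    among themselves, to finer invariants. *)
Lemma tag_code_inj n n' b b' : n \in tags2 -> n' \in tags2 ->
    tag_code n b = tag_code n' b' ->
  [\/ n = n', n = 16%N /\ n' = 21%N, n = 21%N /\ n' = 16%N
    | n \in [:: 22; 25; 26; 27; 28]%N /\ n' \in [:: 22; 25; 26; 27; 28]%N].
Proof.
have /allP H : all (fun n => all (fun n' => all (fun b => all (fun b' =>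
    (tag_code n b == tag_code n' b') ==>
      [|| n == n', (n == 16%N) && (n' == 21%N), (n == 21%N) && (n' == 16%N)
       | (n \in [:: 22; 25; 26; 27; 28]%N) && (n' \in [:: 22; 25; 26; 27; 28]%N)])
  [:: true; false]) [:: true; false]) tags2) tags2 by [].
have bT (x : bool) : x \in [:: true; false] by case: x.
move=> /H/allP{}H /H/allP/(_ b (bT b))/allP/(_ b' (bT b'))/implyP{}H /eqP/H.
by case/or4P => [/eqP|/andP[/eqP ? /eqP ?]|/andP[/eqP ? /eqP ?]|/andP[? ?]];
  [apply: Or41 | apply: Or42 | apply: Or43 | apply: Or44].
Qed.

Lemma pair25_full2 c : valid22 c -> c.1 \in [:: 25; 26; 27; 28]%N ->
  c.2 \in cA /\ exists s g, full2 c = pair25 c.2 s g /\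
  [\/ [/\ c.1 = 25%N, g = 1 & g + s ^+ 2 = 1], [/\ c.1 = 26%N, g = 1 & g + s ^+ 2 = xi],
      [/\ c.1 = 27%N, g = zeta, g + s ^+ 2 = 1 & ~~ q3 /\ forall k, k ^+ 2 != g]
    | [/\ c.1 = 28%N, g = xi & g + s ^+ 2 = xi]].
Proof.
case: c => n d /= + nt; move: nt; rewrite !inE.
case/or4P => /eqP-> /= v.
- split=> //; exists 0, 1; split=> //; apply: Or41.
  by rewrite expr0n addr0.
- split=> //; exists sxi, 1; split=> //; apply: Or42.
  by rewrite sxi_sq addrC subrK.
- case: v => dA nq3 z sz; split=> //; exists szeta, zeta; split=> //; apply: Or43.
  by rewrite sz addrC subrK.
split=> //; exists 0, xi; split=> //; apply: Or44.
by rewrite expr0n addr0.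
Qed.

(** The parameter comes from the square class of [det symm2] for tag 18 and of [gram2] for 23. For
    21 it comes from [twisted], applied to whichever parameter is not 1. *)
Lemma full2_inj_tag n (d d' : F) : n \notin [:: 25; 26; 27; 28]%N ->
  valid22 (n, d) -> valid22 (n, d') -> pencil_eq (full2 (n, d)) (full2 (n, d')) ->
  pencil_eq (full2 (n, d')) (full2 (n, d)) -> d = d'.
Proof.
move=> nt v; have := valid22_tag v; move: v => + + + pp p'p.
have [e [r [e0 r0]]] := pencil_gram pp; move: nt pp p'p.
rewrite /tags2 !inE /= => nt pp p'p + + + tag; move: tag nt pp p'p.
do 6?[case/orP => [/eqP->|]]; rewrite /valid_pencil /pencil_of /valid2 /pair2 /=.
- by move=> _ _ _ _ _ /eqP-> /eqP->.
- move=> _ pp _ _; rewrite /symm2 /= !mx2E => ES v v'.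
  have {}ES : d' * e ^+ 2 = r ^+ 2 * d.
    apply: (mulfI four0); lincomb ES (1 : F) idtac.
  have e20 : e ^+ 2 != 0 by rewrite expf_neq0.
  have r20 : r ^+ 2 != 0 by rewrite expf_neq0.
  case/orP: v => [/eqP d0|v].
    move: ES => /eqP; rewrite d0 mulr0 mulf_eq0 (negPf e20) orbF => /eqP ->.
    by [].
  case/orP: v' => [/eqP d'0|v'].
    move: ES => /esym/eqP; rewrite d'0 mul0r mulf_eq0 (negPf r20) => /eqP ->.
    by [].
  exact: sq_class_inj eta_nsq _ _ e r r0 v v' ES.
- by move=> _ _ _ _ _ /eqP-> /eqP->.
- move=> _ pp p'p _ _ v v'.
  have [d1|d1] := eqVneq d 1; last first.
    have := twisted_21 _ (twisted_pencil pp (twisted_21_self d)).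
    by rewrite eq_sym mul1r => /(_ d1) ->.
  have [d'1|d'1] := eqVneq d' 1; first by rewrite d1 d'1.
  have := twisted_21 _ (twisted_pencil p'p (twisted_21_self d')).
  by rewrite eq_sym mul1r => /(_ d'1) ->.
- move=> _ pp _ EG _ v v'.
  apply: (@sq_class_inj F eta eta_nsq _ _ e r) => //.
  move: EG; rewrite /gram2 /= !mx2E => EG.
  apply: (mulfI four0); lincomb EG (1 : F) idtac.
- by move=> _ _ _ _ _ /eqP-> /eqP->.
case/orP => [/eqP->|n25]; first by move=> _ _ _ _ _ [-> _ _] [-> _ _].
by rewrite n25.
Qed.

Lemma full2_inj c c' : valid22 c -> valid22 c' ->
  alg_iso (ts22 (full2 c).1 (full2 c).2) (ts22 (full2 c').1 (full2 c').2) -> c = c'.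
Proof.
move=> vc vc' I.
have pp' := ts22_pencil (indep2_full2 vc) I.
have p'p := ts22_pencil (indep2_full2 vc') (alg_iso_sym I).
have := code2_pencil pp' p'p; clear I.
rewrite (code2_full2 two_neq0 eta_nsq xi_nsq sxi_sq cA_max vc).
rewrite (code2_full2 two_neq0 eta_nsq xi_nsq sxi_sq cA_max vc').
have kap a : a \in cA -> kappa a != 0.
  by case/(cA_neq cA_max) => _ m0 p0; rewrite mulf_neq0 ?invr_neq0.
have vD g : g = 1 \/ g = xi -> (g == 1) || (g == xi).
  by case=> ->; rewrite eqxx ?orbT.
have main25 : c.1 \in [:: 25; 26; 27; 28]%N -> c'.1 \in [:: 25; 26; 27; 28]%N -> c = c'.
  move=> /(pair25_full2 vc)[aA [s [g [E H]]]] /(pair25_full2 vc')[a'A [s' [g' [E' H']]]].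
  rewrite E E' in pp'.
  have [||DD KK] := pair25_pencil aA a'A pp'.
  - by apply: vD; case: H => [[_ _ ->]|[_ _ ->]|[_ _ ->]|[_ _ ->]]; auto.
  - by apply: vD; case: H' => [[_ _ ->]|[_ _ ->]|[_ _ ->]|[_ _ ->]]; auto.
  have k0 := kap _ aA; have k'0 := kap _ a'A.
  have contra' (k k' z : F) : k != 0 -> k' != 0 -> (forall s, s ^+ 2 != z) -> k ^+ 2 * z != k' ^+ 2.
    move=> h0 h'0 hz; apply/eqP => E1; case/eqP: (hz (k' / k)).
    by rewrite expr_div_n -E1 mulrC mulKf ?expf_neq0.
  have same : c.1 = c'.1 -> g = g' -> g' != 0 -> c = c'.
    move=> e1 e2 g0; rewrite [c]surjective_pairing [c']surjective_pairing e1.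
    by rewrite (kappa_inj two_neq0 cA_max aA a'A) //; apply: (mulIf g0); rewrite -KK e2.
  have xi0 : xi != 0 by have := xi_nsq 0; rewrite expr0n eq_sym.
  have one_xi : 1 <> xi by apply/eqP; rewrite -(expr1n _ 2).
  (* [D] separates the tags 25, 27 from 26, 28. Within each of these pairs one [gamma] is a square
     and the other is not, while [kappa^2 gamma] is the same. *)
  case: H => [[t G D]|[t G D]|[t G D [nq z]]|[t G D]];
  case: H' => [[t' G' D']|[t' G' D']|[t' G' D' [nq' z']]|[t' G' D']].
  all: try by case: one_xi; rewrite -D DD D'.
  all: try by case: one_xi; rewrite -D' -DD D.
  all: try by apply: same; rewrite ?t ?t' // ?G ?G' ?oner_neq0.
  - by case/eqP: (contra' _ _ _ k'0 k0 z'); rewrite -KK G mulr1.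
  - by case/eqP: (contra' _ _ _ k'0 k0 xi_nsq); rewrite -G' -KK G mulr1.
  - by case/eqP: (contra' _ _ _ k0 k'0 z); rewrite KK G' mulr1.
  - apply: same; rewrite ?t ?t' ?G ?G' //; have := z 0; by rewrite G expr0n eq_sym.
  - by case/eqP: (contra' _ _ _ k0 k'0 xi_nsq); rewrite -G KK G' mulr1.
have main22 c1 c2 : valid22 c1 -> valid22 c2 -> c1.1 = 22%N -> c2.1 \in [:: 25; 26; 27; 28]%N ->
    pencil_eq (full2 c1) (full2 c2) -> False.
  move=> v1 v2 t1 t2; have [aA [s [g [-> H]]]] := pair25_full2 v2 t2.
  move: v1; rewrite /valid_pencil /pencil_of /pair2 t1 => -[d0 hq3 nsq].
  move=> /(pair22_pencil aA)[|D1 K].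
    by apply: vD; case: H => [[_ _ ->]|[_ _ ->]|[_ _ ->]|[_ _ ->]]; auto.
  have one_xi : 1 <> xi by apply/eqP; rewrite -(expr1n _ 2).
  case: H => [[_ G _]|[_ _ D]|[_ _ _ [nq _]]|[_ _ D]].
  - case/eqP: (nsq (kappa c2.2 / 2%:R)); rewrite expr_div_n.
    move: K; rewrite G mulr1 => ->; by field; rewrite four0.
  - by case: one_xi; rewrite -D1 D.
  - by rewrite hq3 in nq.
  - by case: one_xi; rewrite -D1 D.
have in25 n : n \in [:: 22; 25; 26; 27; 28]%N -> n = 22%N \/ n \in [:: 25; 26; 27; 28]%N.
  by rewrite in_cons => /orP[/eqP|]; auto.
move/(tag_code_inj (valid22_tag vc) (valid22_tag vc'))=> [tt|[t t']|[t t']|[t t']].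
- have [t25|t25] := boolP (c.1 \in [:: 25; 26; 27; 28]%N).
    by apply: main25; rewrite // -tt.
  move: {main25} tt t25 vc vc' pp' p'p; case: c c' => [n d] [n' d'] /= <- t25 v v' pp' p'p.
  by rewrite (full2_inj_tag t25 v v' pp' p'p).
- move: {main25 p'p} vc vc' pp'; case: c c' t t' => [n d] [n' d'] /= -> -> _ v pp'.
  have n01 : 0 != 1 :> F by rewrite eq_sym oner_neq0.
  have := twisted_21 n01 (twisted_pencil pp' (twisted_16 F)).
  by rewrite mul0r => /eqP; rewrite (negPf n01).
- move: {main25 pp'} vc vc' p'p; case: c c' t t' => [n d] [n' d'] /= -> -> v _ p'p.
  have n01 : 0 != 1 :> F by rewrite eq_sym oner_neq0.
  have := twisted_21 n01 (twisted_pencil p'p (twisted_16 F)).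
  by rewrite mul0r => /eqP; rewrite (negPf n01).
case: (in25 _ t) (in25 _ t') => {}t [] {}t'.
- move: vc vc'; rewrite [c]surjective_pairing [c']surjective_pairing t t'.
  by case=> /= -> _ _ [/= -> _ _].
- by case: (main22 _ _ vc vc' t t' pp').
- by case: (main22 _ _ vc' vc t' t p'p).
exact: main25.
Qed.
End InjectivePencils.

(** * Isomorphisms with the listed presentations *)

Section Coordinates.
Variable F : fieldType.

Definition row3 (p q s t : F) : 'rV[F]_3 * 'rV[F]_1 :=
  (\row_j [:: p; q; s]`_j, \row_j t).

Definition row22 (p q s t : F) : 'rV[F]_2 * 'rV[F]_2 :=
  (\row_j [:: p; q]`_j, \row_j [:: s; t]`_j).

Lemma row3_eta x : exists p q s t, x = row3 p q s t.
Proof.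
case: x => u v; exists (u 0 0), (u 0 1), (u 0 2%:R), (v 0 0).
congr pair; apply/rowP; last by move=> j; rewrite mxE ord1.
by case=> [[|[|[|//]]] i]; rewrite mxE /=; congr (u _ _); apply: val_inj.
Qed.

Lemma row22_eta x : exists p q s t, x = row22 p q s t.
Proof.
case: x => u v; exists (u 0 0), (u 0 1), (v 0 0), (v 0 1).
by congr pair; apply/rowP; case=> [[|[|//]] i]; rewrite mxE /=;
  congr (_ _ _); apply: val_inj.
Qed.

Lemma row3_add p q s t p' q' s' t' :
  row3 p q s t + row3 p' q' s' t' = row3 (p + p') (q + q') (s + s') (t + t').
Proof.
by congr pair; apply/rowP => j; rewrite !mxE //; case: j => [[|[|[|]]]].
Qed.

Lemma row22_add p q s t p' q' s' t' :
  row22 p q s t + row22 p' q' s' t' = row22 (p + p') (q + q') (s + s') (t + t').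
Proof.
by congr pair; apply/rowP => j; rewrite !mxE //; case: j => [[|[|]]].
Qed.

Lemma row3_scale k p q s t : k *: row3 p q s t = row3 (k * p) (k * q) (k * s) (k * t).
Proof.
by congr pair; apply/rowP => j; rewrite !mxE //; case: j => [[|[|[|]]]].
Qed.

Lemma row22_scale k p q s t : k *: row22 p q s t = row22 (k * p) (k * q) (k * s) (k * t).
Proof.
by congr pair; apply/rowP => j; rewrite !mxE //; case: j => [[|[|]]].
Qed.

Lemma row3_mul a b c d e f g h i p q s t p' q' s' t' :
  alg_mul (ts3 (mx3 a b c d e f g h i)) (row3 p q s t) (row3 p' q' s' t') =
  row3 0 0 0 (p * (a * p' + b * q' + c * s') + q * (d * p' + e * q' + f * s')
    + s * (g * p' + h * q' + i * s')).
Proof.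
congr pair; apply/rowP => j; first by rewrite !mxE; case: j => [[|[|[|]]]].
rewrite !mxE !big_ord_recl !big_ord0 !mxE !big_ord_recl !big_ord0 !mxE /=.
by ring.
Qed.

Lemma row22_mul a b c d a' b' c' d' p q s t p' q' s' t' :
  alg_mul (ts22 (mx2 a b c d) (mx2 a' b' c' d')) (row22 p q s t) (row22 p' q' s' t') =
  row22 0 0 (p * (a * p' + b * q') + q * (c * p' + d * q'))
            (p * (a' * p' + b' * q') + q * (c' * p' + d' * q')).
Proof.
congr pair; apply/rowP => j; first by rewrite !mxE; case: j => [[|[|]]].
rewrite !mxE !big_ord_recl !big_ord0 !mxE !big_ord_recl !big_ord0.
by case: j => [[|[|//]] j]; rewrite !mxE /=; ring.
Qed.

Lemma ts3_presented (M : 'M[F]_3) r (e0 e1 e2 e3 : ts3 M) :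
    (forall x, exists s t u v, x = s *: e0 + t *: e1 + u *: e2 + v *: e3) ->
    (forall i j : 'I_4, alg_mul (ts3 M) [:: e0; e1; e2; e3]`_i [:: e0; e1; e2; e3]`_j =
      table r i j 0 ord0 *: e0 + table r i j 0 (inord 1) *: e1
      + table r i j 0 (inord 2) *: e2 + table r i j 0 (inord 3) *: e3) ->
  alg_iso (presented r) (ts3 M).
Proof.
move=> eS eM; apply/alg_iso_sym; apply: presented_iso4 eS eM.
by have [] := @ts_nilpotent4 F 3 1 (fun=> M) erefl.
Qed.

Lemma ts22_presented (M N : 'M[F]_2) r :
    (forall i j : 'I_4, let e := [:: row22 1 0 0 0; row22 0 1 0 0; row22 0 0 1 0; row22 0 0 0 1] in
      alg_mul (ts22 M N) e`_i e`_j = row22 (table r i j 0 ord0) (table r i j 0 (inord 1))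
            (table r i j 0 (inord 2)) (table r i j 0 (inord 3))) ->
  alg_iso (presented r) (ts22 M N).
Proof.
move=> eM; apply/alg_iso_sym.
apply: (@presented_iso4 _ (ts22 M N) r (row22 1 0 0 0) (row22 0 1 0 0) (row22 0 0 1 0)
  (row22 0 0 0 1)).
- by have [] := @ts_nilpotent4 F 2 2 (fun l : 'I_2 => if l == 0 then M else N) erefl.
- move=> x; have [p [q [s [t ->]]]] := row22_eta x; exists p, q, s, t.
  by rewrite !row22_scale !row22_add; congr row22; ring.
move=> i j; rewrite eM.
by rewrite !row22_scale !row22_add; congr row22; ring.
Qed.
End Coordinates.

Ltac pres_table :=
  let i := fresh "i" in let j := fresh "j" in
  move=> i j; ord4_cases i; ord4_cases j;
  rewrite /= ?row3_mul ?row22_mul ?row3_scale ?row3_add;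
  (congr row3 || congr row22); table_eval; ring.

Section PresentedForms.
Variable F : fieldType.
#[local] Opaque mx2 mx3 ts3 ts22.

Lemma presented_form3 (r : presentation F) (c : nat * F) :
  (r, c.1) \in [:: (A4_2, 2); (A4_3 c.2, 3); (A4_4 c.2, 4); (A4_5, 5); (A4_7, 7);
    (A4_8 1 1, 8); (A4_9 1 c.2, 9); (A4_10 0, 10); (A4_11, 11); (A4_9 c.2 4^-1, 17)]%N ->
  alg_iso (presented r) (ts3 (form3 c)).
Proof.
case: c => n d /=; rewrite !inE.
do 9?[case/orP=> [/eqP[-> ->]|]]; last move=> /eqP[-> ->].
all: rewrite /form3 /=.
(* The vector carrying the values of the form goes where the presentation has its product: second
   for [A4_2], third for [A4_3], [A4_4], [A4_5], fourth for the others. *)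
- apply: (@ts3_presented _ _ _ (row3 1 0 0 0) (row3 0 0 0 1) (row3 0 1 0 0) (row3 0 0 1 0)).
    move=> x; have [p [q [s [t ->]]]] := row3_eta x; exists p, t, q, s.
    by rewrite !row3_scale !row3_add; congr row3; ring.
  by pres_table.
1-3: apply: (@ts3_presented _ _ _ (row3 1 0 0 0) (row3 0 1 0 0) (row3 0 0 0 1) (row3 0 0 1 0));
  [by move=> x; have [p [q [s [t ->]]]] := row3_eta x; exists p, q, t, s;
   rewrite !row3_scale !row3_add; congr row3; ring | by pres_table].
all: apply: (@ts3_presented _ _ _ (row3 1 0 0 0) (row3 0 1 0 0) (row3 0 0 1 0) (row3 0 0 0 1));
  [by move=> x; have [p [q [s [t ->]]]] := row3_eta x; exists p, q, s, t;
   rewrite !row3_scale !row3_add; congr row3; ring | by pres_table].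
Qed.

End PresentedForms.

Section PresentedPencils.
#[local] Opaque mx2 mx3 ts3 ts22.

Lemma presented_full2 (F : fieldType) (xi sxi zeta szeta : F) (r : presentation F)
    (c : nat * F) (p := pencil_of xi sxi zeta szeta c) :
  (r, c.1) \in [:: (A4_16, 16); (A4_18 c.2, 18); (A4_20, 20); (A4_21 c.2, 21);
    (A4_22, 22); (A4_23 c.2, 23); (A4_24, 24); (A4_25 c.2 0 1, 25);
    (A4_25 c.2 (sxi * (1 - c.2)) 1, 26);
    (A4_25 c.2 (szeta * (1 - c.2)) zeta, 27); (A4_25 c.2 0 xi, 28)]%N ->
  alg_iso (presented r) (ts22 p.1 p.2).
Proof.
rewrite {}/p; case: c => n d /=; rewrite !inE.
do 10?[case/orP=> [/eqP[-> ->]|]]; last move=> /eqP[-> ->].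
all: rewrite /pencil_of /pair25 /pair2 /=; apply: ts22_presented => /=; pres_table.
Qed.

End PresentedPencils.

(** * Classification *)

Section FieldFacts.
Variables (F : finFieldType) (p : nat).
Hypotheses (charFp : p \in [pchar F]) (odd_p : odd p).

Lemma odd_pchar_two_neq0 : 2%:R != 0 :> F.
Proof.
rewrite -(dvdn_pcharf charFp); apply/negP => /(@dvdn_leq p 2 isT) p2.
have := pcharf_prime charFp; move: odd_p p2.
by case: p => [|[|[|]]].
Qed.

Variable eta : F.
Hypothesis eta_prim : primitive_element eta.

Lemma primitive_power x : x != 0 -> exists n, x = eta ^+ n.
Proof.
case: eta_prim => u <- /eqP gen x0.
have xu : x \is a GRing.unit by rewrite unitfE.
have : FinRing.unit F xu \in [set: {unit F}] by rewrite inE.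
rewrite gen => /cycleP[n E]; exists n.
by rewrite -FinRing.val_unitX -E.
Qed.

Lemma primitive_sq_class x : x != 0 ->
  exists2 k, k != 0 & x = k ^+ 2 \/ x = eta * k ^+ 2.
Proof.
move=> x0; have [n xE] := primitive_power x0.
have eta0 : eta != 0 by case: eta_prim => -[y yu] <- _; rewrite -unitfE.
exists (eta ^+ n./2); first by rewrite expf_neq0.
rewrite xE -{1 3}(odd_double_half n) -muln2 exprD exprM.
by case: (odd n); [right; rewrite expr1 | left; rewrite mul1r].
Qed.

(** If [eta] were a square, squaring would be surjective, hence injective on a finite set, but 1 and
    -1 have the same square. *)
Lemma primitive_nonsquare (s : F) : s ^+ 2 != eta.
Proof.
apply/eqP => sE; pose sq (x : F) := x ^+ 2.
have sq_surj x : x \in codom sq.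
  have [->|x0] := eqVneq x 0; first by apply/codomP; exists 0; rewrite /sq expr0n.
  have [k _ [->|->]] := primitive_sq_class x0; apply/codomP; first by exists k.
  by exists (s * k); rewrite /sq exprMn sE.
have /image_injP sq_inj : #|image sq F| == #|F|.
  by apply/eqP; apply: eq_card => x; rewrite sq_surj.
have /eqP : 1 = -1 :> F by apply: sq_inj => //; rewrite /sq sqrrN.
by rewrite -addr_eq0 (negPf odd_pchar_two_neq0).
Qed.

(** The quotient of two nonsquares is a square, so any nonsquare represents the second class as well
    as [eta] does. *)
Lemma nonsquare_sq_class nu x : (forall s : F, s ^+ 2 != nu) -> x != 0 ->
  exists2 k, k != 0 & x = k ^+ 2 \/ x = nu * k ^+ 2.
Proof.
move=> nu_nsq x0.
have nu0 : nu != 0 by have := nu_nsq 0; rewrite expr0n eq_sym.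
have [k k0 [->|xE]] := primitive_sq_class x0; first by exists k => //; left.
have [l l0 [nuE|nuE]] := primitive_sq_class nu0.
  by have := nu_nsq l; rewrite nuE eqxx.
exists (k / l); first by rewrite mulf_neq0 ?invr_neq0.
by right; rewrite xE nuE expr_div_n; field.
Qed.

(** If [x] or [y] is a square, one term suffices; for two nonsquares, divide [1 + s^2 = xi] by
    [xi]. *)
Lemma sum2sq_one (xi s x y : F) : (forall s : F, s ^+ 2 != xi) -> s ^+ 2 = xi - 1 ->
  x != 0 -> y != 0 -> exists u v, x * u ^+ 2 + y * v ^+ 2 = 1.
Proof.
move=> xi_nsq sE x0 y0.
have xi0 : xi != 0 by have := xi_nsq 0; rewrite expr0n eq_sym.
have [k k0 [->|->]] := nonsquare_sq_class xi_nsq x0.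
  by exists k^-1, 0; field.
have [l l0 [->|->]] := nonsquare_sq_class xi_nsq y0.
  by exists 0, l^-1; field.
exists (xi * k)^-1, (s / (xi * l)); lincomb sE (xi^-1) ltac:(rewrite ?xi0 ?k0 ?l0).
Qed.

Lemma card3_cases (x : F) : #|F| = 3%N -> [\/ x = 0, x = 1 | x = -1].
Proof.
move=> F3; have u : uniq [:: 0; 1; -1 : F].
  rewrite /= !inE !negb_or eq_sym oner_neq0 eq_sym oppr_eq0 oner_neq0 /= andbT.
  by rewrite -addr_eq0 odd_pchar_two_neq0.
have : x \in [:: 0; 1; -1 : F].
  have /subset_cardP : #|[:: 0; 1; -1 : F]| = #|F| by rewrite (card_uniqP u) F3.
  by move=> /(_ (subset_predT _)) ->.
by rewrite !inE => /or3P[]/eqP; [apply: Or31 | apply: Or32 | apply: Or33].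
Qed.
End FieldFacts.

(** As [cs] has no duplicates, positions and codes determine each other, and a unique position
    amounts to a unique code. *)
Lemma classifies4_map (F : fieldType) (C : eqType) (cs : seq C) (f : C -> presentation F) :
    uniq cs ->
    (forall c, c \in cs -> nilpotent_assoc_alg4 (presented (f c))) ->
    (forall X : algebra F, nilpotent_assoc_alg4 X ->
       exists2 c, c \in cs & alg_iso X (presented (f c))) ->
    (forall c c', c \in cs -> c' \in cs ->
       alg_iso (presented (f c)) (presented (f c')) -> c = c') ->
  classifies4 (map f cs).
Proof.
move=> Ucs nil_cs ex_cs inj_cs.
have nthE (i : 'I_(size (map f cs))) : exists c, [/\ c \in cs, index c cs = i
    & tnth (in_tuple (map f cs)) i = f c].
  have := ltn_ord i; rewrite {2}size_map => ics.
  have c0 : C by move: ics; move: (nat_of_ord i) => j; case: (cs) => [|c].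
  exists (nth c0 cs i); split; [exact: mem_nth | exact: index_uniq |].
  by rewrite (tnth_nth [::]) /= (nth_map c0).
split=> [i|X nX]; first by have [c [/nil_cs ? _ ->]] := nthE i.
have [c ccs iX] := ex_cs X nX.
have ics : (index c cs < size (map f cs))%N by rewrite size_map index_mem.
have at_i : tnth (in_tuple (map f cs)) (Ordinal ics) = f c.
  by rewrite (tnth_nth [::]) /= (nth_map c) ?index_mem // nth_index.
exists (Ordinal ics); split=> [|j]; first by rewrite at_i.
have [c' [c'cs c'j ->]] := nthE j => iX'; apply: val_inj; rewrite /= -c'j.
by congr index; apply: inj_cs => //; apply: alg_iso_trans iX'; apply: alg_iso_sym.
Qed.

Lemma uniq_tagged (A B : eqType) (gs : seq (A * seq B)) :
  uniq (map fst gs) -> all (fun g => uniq g.2) gs -> uniq [seq (g.1, x) | g <- gs, x <- g.2].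
Proof.
elim: gs => //= g gs IH /andP[g1 Ugs] /andP[g2 Ags].
rewrite cat_uniq map_inj_uniq ?g2 /= => [|x y [] //]; rewrite IH // andbT.
apply/hasPn => c /allpairsPdep[h [x [hgs _ ->]]] /=; apply/negP => /mapP[y _ [E _]].
by case/negP: g1; rewrite -E map_f.
Qed.

(** * Assembly of the two lists from the codes *)

Section Classification.
#[local] Opaque mx2 mx3 ts3 ts22.
Variables (F : finFieldType) (p : nat) (charFp : p \in [pchar F]) (odd_p : odd p).
Variables (eta : F) (eta_prim : primitive_element eta).
Variables (xi sxi zeta szeta : F) (cA : {set F}) (q3 : bool).
Hypothesis xi_nsq : forall s : F, s ^+ 2 != xi.
Hypothesis sxi_sq : sxi ^+ 2 = xi - 1.
Hypothesis cA_max : maxset (@inverse_free F) cA.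
Hypothesis q3_card : q3 -> #|F| = 3%N.
Hypothesis zeta_nsq : ~~ q3 -> forall s : F, s ^+ 2 != zeta.
Hypothesis szeta_sq : ~~ q3 -> szeta ^+ 2 = 1 - zeta.

Let two_neq0 := odd_pchar_two_neq0 charFp odd_p.
Let eta_nsq := primitive_nonsquare charFp odd_p eta_prim.
Let sq_class nu x := @nonsquare_sq_class F eta eta_prim nu x.
Local Notation full2 := (pencil_of xi sxi zeta szeta).
Local Notation valid22 := (valid_pencil eta zeta szeta cA q3).

Definition algebra_of (c : nat * F) : presentation F :=
  let delta := c.2 in
  match c.1 with
  | 1 => A4_1 | 2 => A4_2 | 3 => A4_3 delta | 4 => A4_4 delta | 5 => A4_5
  | 6 => A4_6 | 7 => A4_7 | 8 => A4_8 1 1 | 9 => A4_9 1 delta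
  | 10 => A4_10 0 | 11 => A4_11 | 12 => A4_12 | 13 => A4_13 | 14 => A4_14
  | 15 => A4_15 | 16 => A4_16 | 17 => A4_9 delta 4^-1 | 18 => A4_18 delta
  | 20 => A4_20 | 21 => A4_21 delta | 22 => A4_22 | 23 => A4_23 delta
  | 24 => A4_24 | 25 => A4_25 delta 0 1
  | 26 => A4_25 delta (sxi * (1 - delta)) 1
  | 27 => A4_25 delta (szeta * (1 - delta)) zeta
  | _ => A4_25 delta 0 xi
  end.

(** The order is that of the two lists, so that mapping [algebra_of] over the codes gives them
    literally; this is why 17 follows 9. *)
Definition families : seq (nat * seq F) :=
  [:: (1%N, [:: 0]); (2%N, [:: 0]); (3%N, [:: 1; eta]); (4%N, enum F); (5%N, [:: 0]); (6%N, [:: 0]);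
      (7%N, [:: 0]); (8%N, [:: 0]); (9%N, enum [pred x : F | x != 4^-1]);
      (17%N, [:: 1; eta]); (10%N, [:: 0]); (11%N, [:: 0]); (12%N, [:: 0]); (13%N, [:: 0]);
      (14%N, [:: 0]); (15%N, [:: 0]); (16%N, [:: 0]); (18%N, [:: 0; 1; eta]); (20%N, [:: 0]);
      (21%N, enum [pred x : F | x != -1])]
  ++ (if q3 then [:: (22%N, [:: 0])] else [::])
  ++ [:: (23%N, [:: 1; eta]); (24%N, [:: 0]); (25%N, enum cA); (26%N, enum cA)]
  ++ (if q3 then [::] else [:: (27%N, enum cA)])
  ++ [:: (28%N, enum cA)].

Definition codes : seq (nat * F) := [seq (g.1, x) | g <- families, x <- g.2].

Lemma mem_codes n x :
  ((n, x) \in codes) = has (fun g => (n == g.1) && (x \in g.2)) families.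
Proof.
apply/allpairsPdep/hasP => [[g [y [gf yg [-> ->]]]]|[g gf /andP[/eqP-> xg]]].
  by exists g; rewrite // eqxx.
by exists g, x.
Qed.

Lemma codes_uniq : uniq codes.
Proof.
have eta1 : 1 != eta by have := eta_nsq 1; rewrite expr1n.
have eta0 : 0 != eta by have := eta_nsq 0; rewrite expr0n.
apply: uniq_tagged; rewrite /families; case: q3 => //=;
by rewrite !enum_uniq !inE !negb_or eta1 eta0 eq_sym oner_neq0.
Qed.

Lemma card3_N1_nsq (k : F) : q3 -> k ^+ 2 != -1.
Proof.
move=> /q3_card F3.
have [->|->|->] := card3_cases charFp odd_p k F3.
- by rewrite expr0n /= eq_sym oppr_eq0 oner_neq0.
- by rewrite expr1n -addr_eq0 two_neq0.
- by rewrite sqrrN expr1n -addr_eq0 two_neq0.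
Qed.

Lemma codes_cases c : c \in codes ->
  [\/ c = (1%N, 0), valid3 eta c, valid22 c
    | c \in [:: (6%N, 0); (12%N, 0); (13%N, 0); (14%N, 0); (15%N, 0)]].
Proof.
have m1 := card3_N1_nsq.
case: c => n x; rewrite mem_codes /families /valid3 /valid_pencil /valid2 /=.
move: m1 zeta_nsq szeta_sq; case: (q3) => m1 hz hs; rewrite /= ?mem_enum ?inE.
all: do 29?[case: n => [|n] //=]; rewrite ?orbF ?mem_enum ?inE.
all: move=> H; first [by apply: Or42 | by apply: Or43 | by apply: Or44
  | by apply: Or43; split; auto | by move/eqP: H => ->; apply: Or41
  | by move/eqP: H => ->; apply: Or44 | by move/eqP: H => ->; apply: Or43; split; auto].
Qed.

Lemma codes_1 : (1%N, 0) \in codes.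
Proof. by rewrite mem_codes /= inE eqxx. Qed.

Lemma codes_long n : n \in [:: 6; 12; 13; 14; 15]%N -> (n, 0) \in codes.
Proof.
rewrite mem_codes; move: n; apply/allP.
by rewrite /families /= !inE !eqxx.
Qed.

Lemma codes_valid3 c : valid3 eta c -> c \in codes.
Proof.
case: c => n x; rewrite mem_codes /families /valid3 /=; case: (q3) => /=.
all: by do 18?[case: n => [|n] //=]; rewrite ?orbF ?mem_enum ?inE // => ->.
Qed.

Lemma codes_valid2 c : valid2 eta c -> c \in codes.
Proof.
case: c => n x; rewrite mem_codes /families /valid2 /=; case: (q3) => /=.
all: by do 25?[case: n => [|n] //=]; rewrite ?orbF ?mem_enum ?inE // => ->.
Qed.

Lemma codes_25 n x : n \in [:: 25; 26; 28]%N -> x \in cA -> (n, x) \in codes.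
Proof.
rewrite mem_codes /families !inE => + xA; case: (q3) => /=.
all: by case/or3P => /eqP-> /=; rewrite mem_enum xA.
Qed.

Lemma codes_27 x : ~~ q3 -> x \in cA -> (27%N, x) \in codes.
Proof. by rewrite mem_codes /families; case: (q3) => //= _ xA; rewrite mem_enum xA. Qed.

Lemma codes_22 : q3 -> (22%N, 0) \in codes.
Proof. by rewrite mem_codes /families; case: (q3) => //= _; rewrite inE eqxx. Qed.

Lemma algebra_of_form3 c : valid3 eta c ->
  alg_iso (presented (algebra_of c)) (ts3 (form3 c)).
Proof.
move=> v; apply: presented_form3; case: c v => n x; rewrite /valid3 /algebra_of /=.
by do 18?[case: n => [|n] //=]; move=> _; rewrite !inE eqxx ?orbT.
Qed.

Lemma algebra_of_full2 c : valid22 c ->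
  alg_iso (presented (algebra_of c)) (ts22 (full2 c).1 (full2 c).2).
Proof.
move=> v; apply: presented_full2; case: c v => n x; rewrite /valid_pencil /valid2 /algebra_of /=.
by do 29?[case: n => [|n] //=]; move=> _; rewrite !inE eqxx ?orbT.
Qed.

Lemma A4_1_ts (M : 'I_0 -> 'M[F]_4) : alg_iso (presented A4_1) (ts M).
Proof.
apply/alg_iso_sym; apply: (@presented_iso _ (ts M) _ (fun i => (delta_mx 0 i, 0))).
- by have [] := @ts_nilpotent4 F 4 0 M erefl.
- case=> u v; exists u; have -> : v = 0 by apply/rowP => -[].
  rewrite {1}(row_sum_delta u); elim/big_rec2: _ => // i y1 y2 _ <-.
  by congr pair; rewrite /= scaler0 addr0.
move=> i j; rewrite big1 => [|k _]; last by rewrite /table big_nil mxE scale0r.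
by congr pair; apply/rowP => -[].
Qed.

Lemma codes_nilpotent4 c : c \in codes ->
  nilpotent_assoc_alg4 (presented (algebra_of c)).
Proof.
case/codes_cases => [->|/algebra_of_form3 I|/algebra_of_full2 I|].
- apply: alg_iso_nilpotent4 (alg_iso_sym (A4_1_ts (fun=> 0))) _.
  exact: (@ts_nilpotent4 F 4 0).
- by apply: alg_iso_nilpotent4 (alg_iso_sym I) _; apply: (@ts_nilpotent4 F 3 1).
- by apply: alg_iso_nilpotent4 (alg_iso_sym I) _; apply: (@ts_nilpotent4 F 2 2).
rewrite !inE; do 4?[case/orP=> [/eqP->|]]; last move/eqP->.
all: by apply: long_nilpotent4; rewrite !inE eqxx ?orbT.
Qed.

(** By [rot] it suffices to solve [gamma + sigma^2 = D] and [kappa(alpha)^2 gamma = - m D]. The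
    square class of [- m] selects the family, and [kappa_surj] supplies [alpha]. *)
Lemma pencil_normal_form D t u : D = 1 \/ D = xi -> D * t ^+ 2 - u ^+ 2 != 0 ->
  exists2 c, c \in codes & alg_iso (nf22 D t u) (presented (algebra_of c)).
Proof.
move=> hD m0; pose m := D * t ^+ 2 - u ^+ 2.
have xi0 : xi != 0 by have := xi_nsq 0; rewrite expr0n eq_sym.
have D0 : D != 0 by case: hD => ->; rewrite ?oner_neq0.
have rot n alpha sigma gamma : (n, alpha) \in codes -> valid22 (n, alpha) ->
    full2 (n, alpha) = pair25 alpha sigma gamma -> alpha \in cA ->
    gamma + sigma ^+ 2 = D -> kappa alpha ^+ 2 * gamma = - m * D ->
    exists2 c, c \in codes & alg_iso (nf22 D t u) (presented (algebra_of c)).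
  move=> nc v E aA DE K; exists (n, alpha) => //.
  apply: alg_iso_trans (alg_iso_sym (algebra_of_full2 v)); rewrite E.
  have := pair25_iso two_neq0 cA_max aA; move=> /(_ sigma gamma); rewrite DE => /(_ D0) I.
  apply: alg_iso_trans (alg_iso_sym I); apply: nf22_rot => //.
  apply: (mulIf D0); have -> : (D * t ^+ 2 - u ^+ 2) * D = - (kappa alpha ^+ 2 * gamma).
    by rewrite K /m; ring.
  by rewrite -DE in D0 *; field.
have Nm0 : - m != 0 by rewrite oppr_eq0.
have sxiE : 1 + sxi ^+ 2 = xi by rewrite sxi_sq; ring.
case: hD => DE.
  have [q3F|q3F] := boolP q3; last first.
    have [k k0 [mE|mE]] := sq_class (zeta_nsq q3F) Nm0;
      have [alpha aA aE] := kappa_surj two_neq0 cA_max k0.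
      apply: (rot 25%N alpha 0 1) => //; first exact: codes_25.
        by rewrite DE; ring.
      by rewrite aE -mE DE.
    apply: (rot 27%N alpha szeta zeta) => //; first exact: codes_27.
    - by split; auto.
    - by rewrite szeta_sq // DE; ring.
    by rewrite aE mE DE; ring.
  have [m0'|m1|m1] := card3_cases charFp odd_p m (q3_card q3F).
  - by move: m0; rewrite -/m m0' eqxx.
  - exists (22%N, 0); first exact: codes_22.
    have v : valid22 (22%N, 0) by split=> // k; apply: card3_N1_nsq.
    apply: alg_iso_trans (alg_iso_sym (algebra_of_full2 v)).
    have two_N1 : 2%:R = -1 :> F.
      have := card3_cases charFp odd_p (2%:R : F) (q3_card q3F).
      case=> // /eqP; rewrite ?(negPf two_neq0) //.
      by rewrite -subr_eq0 (_ : _ - 1 = 1 :> F) ?oner_eq0 //; ring.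
    (* The pencil of tag 22 in the basis [(1, 1)], [(1, -1)] gives [nf22 1 2 0], whose invariant is
       [4 = 1]. *)
    apply: (alg_iso_trans (Y := nf22 D 2%:R 0)).
      by apply: nf22_rot => //; rewrite -/m m1 DE two_N1; ring.
    rewrite DE; apply: alg_iso_sym; rewrite /pencil_of /pair2 /nf22 /=.
    apply: (mx2_iso 1 1 1 (-1) (- 2%:R) 0 2%:R^-1 1 (- 2%:R^-1) (- 2%:R^-1)).
    by mx2_check ltac:(rewrite ?two_neq0).
  have [alpha aA aE] := kappa_surj two_neq0 cA_max (oner_neq0 F).
  apply: (rot 25%N alpha 0 1) => //; first exact: codes_25.
    by rewrite DE; ring.
  by rewrite aE m1 DE; ring.
have [k k0 [mE|mE]] := sq_class xi_nsq Nm0.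
  have [alpha aA aE] := kappa_surj two_neq0 cA_max k0.
  apply: (rot 28%N alpha 0 xi) => //; first exact: codes_25.
    by rewrite DE; ring.
  by rewrite aE -mE DE.
(* Here [gamma = 1] and [- m D = (xi k)^2]. *)
have xik0 : xi * k != 0 by rewrite mulf_neq0.
have [alpha aA aE] := kappa_surj two_neq0 cA_max xik0.
apply: (rot 26%N alpha sxi 1) => //; first exact: codes_25.
  by rewrite DE.
by rewrite aE mE DE; ring.
Qed.

Lemma codes_surj (X : algebra F) : nilpotent_assoc_alg4 X ->
  exists2 c, c \in codes & alg_iso X (presented (algebra_of c)).
Proof.
have xi0 : xi != 0 by have := xi_nsq 0; rewrite expr0n eq_sym.
have eta0 : eta != 0 by have := eta_nsq 0; rewrite expr0n eq_sym.
have long n : n \in [:: 6; 12; 13; 14; 15]%N -> alg_iso X (presented (algebra_of (n, 0))) ->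
    exists2 c, c \in codes & alg_iso X (presented (algebra_of c)).
  by move=> /codes_long nc I; exists (n, 0).
case/nilpotent4_cases => [[n [k [nk [M iM I]]]]|[I|[I|I|I|I]]]; last first.
- exact: (long 14).
- exact: (long 13).
- exact: (long 12).
- exact: (long 6).
- exact: (long 15).
have k2 : (k <= 2)%N.
  have := indep_dim iM; case: k nk {M iM I} => [|[|[|k]]] // nk.
  move: nk; rewrite !addnS => -[nk]; have {nk}n1 : (n <= 1)%N by rewrite -ltnS -nk leq_addr.
  by move/leq_trans/(_ (leq_mul n1 n1)).
case: k k2 nk M iM I => [|[|[|//]]] _ nk M iM I.
- rewrite addn0 in nk; subst n; exists (1%N, 0); first exact: codes_1.
  by apply: alg_iso_trans I (alg_iso_sym _); apply: A4_1_ts.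
- have n3 : n = 3%N by case: nk; rewrite addn1 => -[].
  subst n; have M0 : M ord0 != 0.
    apply/eqP => M0; have := iM (const_mx 1); rewrite big_ord1 M0 scaler0 => /(_ erefl).
    by move/matrixP/(_ ord0 ord0)/eqP; rewrite !mxE oner_eq0.
  have [c [vc J]] : normalizes3 eta (M ord0).
    exact: (normalizes3_all two_neq0 (fun x => @sq_class eta x eta_nsq)
      (fun x y => @sum2sq_one F eta eta_prim xi sxi x y xi_nsq sxi_sq)).
  exists c; first exact: codes_valid3.
  apply: alg_iso_trans (alg_iso_sym (algebra_of_form3 vc)).
  exact: alg_iso_trans I (alg_iso_trans (ts_ts3 M) J).
have n2 : n = 2%N by case: nk; rewrite addn2 => -[].
subst n; have [[c [vc J]]|[D [t [u [hD m0 J]]]]] : normalizes2 eta xi (ts M).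
- exact: (normalizes2_all two_neq0 (fun x => @sq_class eta x eta_nsq)
    (fun x => @sq_class xi x xi_nsq)).
- exists c; first exact: codes_valid2.
  have [v22 fE] : valid22 c /\ full2 c = pair2 c.
    case: c vc {J} => n d; rewrite /valid_pencil /valid2 /pencil_of /=.
    by do 25?[case: n => [|n] //].
  apply: alg_iso_trans (alg_iso_sym (algebra_of_full2 v22)); rewrite fE.
  exact: alg_iso_trans I J.
have [c cc K] := pencil_normal_form hD m0.
exists c => //; exact: alg_iso_trans I (alg_iso_trans J K).
Qed.

Lemma long_inj c c' :
  c \in [:: (6%N, 0); (12%N, 0); (13%N, 0); (14%N, 0); (15%N, 0 : F)] ->
  c' \in [:: (6%N, 0); (12%N, 0); (13%N, 0); (14%N, 0); (15%N, 0 : F)] ->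
  alg_iso (presented (algebra_of c)) (presented (algebra_of c')) -> c = c'.
Proof.
have no15 n : n \in [:: 6; 12; 13; 14]%N ->
    ~ alg_iso (presented (@A4_15 F)) (presented (algebra_of (n, 0))).
  move=> hn I; have /fourth_211 : algebra_of (n, 0) \in [:: A4_6; A4_12; A4_13; A4_14].
    by move: hn; rewrite !inE => /or4P[] /eqP-> /=; rewrite eqxx ?orbT.
  by apply; apply: fourth_iso I _; apply: fourth_A4_15.
have noC n n' : n \in [:: 6; 13]%N -> n' \in [:: 12; 14]%N ->
    ~ alg_iso (presented (algebra_of (n, 0))) (presented (algebra_of (n', 0))).
  rewrite !inE => /orP[]/eqP-> /orP[]/eqP-> /= I.
  - apply: noncommutative_A4_12; apply: commutative_alg_iso I _; exact: commutative_A4_6.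
  - apply: noncommutative_A4_14; apply: commutative_alg_iso I _; exact: commutative_A4_6.
  - apply: noncommutative_A4_12; apply: commutative_alg_iso I _; exact: commutative_A4_13.
  - apply: noncommutative_A4_14; apply: commutative_alg_iso I _; exact: commutative_A4_13.
have no_6_13 : ~ alg_iso (presented (@A4_6 F)) (presented A4_13).
  by move=> I; apply: not_null_squares_A4_13; apply: null_squares_iso I _; exact: null_squares_A4_6.
have no_14_12 : ~ alg_iso (presented (@A4_14 F)) (presented A4_12).
  by move=> I; apply: not_null_squares_A4_12; apply: null_squares_iso I _; exact: null_squares_A4_14.
move=> + hc'; rewrite !inE; do 4?[case/orP=> [/eqP->|]]; last move/eqP->.
all: move: hc'; rewrite !inE; do 4?[case/orP=> [/eqP->|]]; last move/eqP->.
all: move=> I; try reflexivity.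
all: exfalso.
all: first [exact: no_6_13 I | exact: no_6_13 (alg_iso_sym I)
  | exact: no_14_12 I | exact: no_14_12 (alg_iso_sym I)
  | by apply: no15 I; rewrite !inE eqxx ?orbT | by apply: no15 (alg_iso_sym I); rewrite !inE eqxx ?orbT
  | by apply: noC I; rewrite !inE eqxx ?orbT | by apply: noC (alg_iso_sym I); rewrite !inE eqxx ?orbT].
Qed.

Lemma codes_inj c c' : c \in codes -> c' \in codes ->
  alg_iso (presented (algebra_of c)) (presented (algebra_of c')) -> c = c'.
Proof.
(* The number [k] of independent forms is an isomorphism invariant, which separates codes of
   different kinds. *)
pose deg c k := exists n (M : 'I_k -> 'M[F]_n),
  indep M /\ alg_iso (presented (algebra_of c)) (ts M).
have deg0 : deg (1%N, 0) 0%N.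
  exists 4%N, (fun=> 0); split; first by move=> w _; apply/rowP => -[].
  exact: A4_1_ts.
have deg1 d : valid3 eta d -> deg d 1%N.
  move=> v; exists 3%N, (fun=> form3 d); split; last exact: (algebra_of_form3 v).
  move=> w; rewrite big_ord1 => /eqP; rewrite scaler_eq0 (negPf (form3_neq0 v)) orbF.
  by move=> /eqP w0; apply/rowP => j; rewrite ord1 w0 mxE.
have deg2 d : valid22 d -> deg d 2%N.
  move=> v; exists 2%N, (fun l : 'I_2 => if l == 0 then (full2 d).1 else (full2 d).2).
  by split; [exact: indep2P (indep2_full2 v) | exact: (algebra_of_full2 v)].
have deg_eq d d' k k' : deg d k -> deg d' k' ->
    alg_iso (presented (algebra_of d)) (presented (algebra_of d')) -> k = k'.
  move=> [n [M [iM J]]] [n' [M' [iM' J']]] I; apply: (ts_iso_dim iM iM').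
  by apply: alg_iso_trans (alg_iso_sym J) (alg_iso_trans I J').
pose long d := d \in [:: (6%N, 0); (12%N, 0); (13%N, 0); (14%N, 0); (15%N, 0 : F)].
have cubeL d : long d -> cube (presented (algebra_of d)).
  by rewrite /long !inE; do 4?[case/orP=> [/eqP->|]]; last move/eqP->;
    apply: cube_long; rewrite !inE eqxx ?orbT.
have deg_long d d' k : deg d k -> long d' ->
    ~ alg_iso (presented (algebra_of d)) (presented (algebra_of d')).
  move=> [n [M [_ J]]] /cubeL C I; apply: (@cube_ts F n k M).
  by apply: cube_iso C; apply: alg_iso_trans (alg_iso_sym I) J.
move=> /codes_cases Hc /codes_cases Hc' I.
case: Hc => [E|v|v|l]; case: Hc' => [E'|v'|v'|l'].
- by rewrite E E'.
- by rewrite E in I; have := deg_eq _ _ _ _ deg0 (deg1 _ v') I.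
- by rewrite E in I; have := deg_eq _ _ _ _ deg0 (deg2 _ v') I.
- by rewrite E in I; case: (deg_long _ _ _ deg0 l' I).
- by rewrite E' in I; have := deg_eq _ _ _ _ (deg1 _ v) deg0 I.
- apply: (form3_inj two_neq0 eta_nsq v v').
  exact: alg_iso_trans (alg_iso_sym (algebra_of_form3 v)) (alg_iso_trans I (algebra_of_form3 v')).
- by have := deg_eq _ _ _ _ (deg1 _ v) (deg2 _ v') I.
- by case: (deg_long _ _ _ (deg1 _ v) l' I).
- by rewrite E' in I; have := deg_eq _ _ _ _ (deg2 _ v) deg0 I.
- by have := deg_eq _ _ _ _ (deg2 _ v) (deg1 _ v') I.
- apply: (full2_inj two_neq0 eta_nsq xi_nsq sxi_sq cA_max v v').
  exact: alg_iso_trans (alg_iso_sym (algebra_of_full2 v)) (alg_iso_trans I (algebra_of_full2 v')).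
- by case: (deg_long _ _ _ (deg2 _ v) l' I).
- by rewrite E' in I; case: (deg_long _ _ _ deg0 l (alg_iso_sym I)).
- by case: (deg_long _ _ _ (deg1 _ v') l (alg_iso_sym I)).
- by case: (deg_long _ _ _ (deg2 _ v') l (alg_iso_sym I)).
exact: long_inj.
Qed.

End Classification.

Lemma list_gt3E (F : finFieldType) (eta xi sxi zeta szeta : F) cA :
  list_gt3 eta xi sxi zeta szeta cA =
      map (algebra_of xi sxi zeta szeta) (codes eta cA false).
Proof.
rewrite /codes /=; do 9?[rewrite ?map_cat ?cats0 /=].
by rewrite -!map_comp /list_gt3 /image_mem enumT.
Qed.

Lemma list_eq3E (F : finFieldType) (eta xi sxi zeta szeta : F) cA :
  list_eq3 eta xi sxi cA =
      map (algebra_of xi sxi zeta szeta) (codes eta cA true).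
Proof.
rewrite /codes /=; do 9?[rewrite ?map_cat ?cats0 /=].
by rewrite -!map_comp /list_eq3 /image_mem enumT.
Qed.

Theorem proposition7p3 (F : finFieldType) (p : nat) (charFp : p \in [pchar F])
  (odd_p : odd p) (eta : F) (eta_prim : primitive_element eta)
  (xi : F) (xi_nsq : ~ is_square xi) (xi1_sq : is_square (xi - 1))
  (sxi : F) (sxi_sq : sxi ^+ 2 = xi - 1)
  (cA : {set F}) (cA_max : maxset (@inverse_free F) cA) :
  ((3 < #|F|)%N ->
     forall zeta : F, ~ is_square zeta -> is_square (1 - zeta) ->
     forall szeta : F, szeta ^+ 2 = 1 - zeta ->
     classifies4 (list_gt3 eta xi sxi zeta szeta cA)) /\
  (#|F| = 3%N -> classifies4 (list_eq3 eta xi sxi cA)).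
Proof.
have nsq (x : F) : ~ is_square x -> forall s : F, s ^+ 2 != x.
  by move=> nx s; apply/eqP => E; apply: nx; exists s.
have classified (q3 : bool) (zeta szeta : F) : (q3 -> #|F| = 3%N) ->
    (~~ q3 -> forall s : F, s ^+ 2 != zeta) -> (~~ q3 -> szeta ^+ 2 = 1 - zeta) ->
    classifies4 (map (algebra_of xi sxi zeta szeta) (codes eta cA q3)).
  move=> q3F z_nsq sz_sq; apply: classifies4_map.
  - exact: codes_uniq charFp odd_p _ eta_prim _ _.
  - by move=> c; apply: (codes_nilpotent4 charFp odd_p xi sxi q3F z_nsq sz_sq).
  - move=> X; exact: (codes_surj charFp odd_p eta_prim (nsq _ xi_nsq) sxi_sq cA_max q3F z_nsq sz_sq).
  - move=> c c'; exact: (codes_inj charFp odd_p eta_prim (nsq _ xi_nsq) sxi_sq cA_max q3F z_nsq sz_sq).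
split=> [_ zeta zeta_nsq _ szeta szetaE|F3].
  by rewrite list_gt3E; apply: classified => // _; apply: nsq.
(* This list has no family with [zeta]; the two zeros are placeholders. *)
by rewrite (list_eq3E _ _ _ 0 0); apply: classified.
Qed.
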